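(* Let $p$ be a prime, $K$ a finite extension of $\mathbb{Q}_p$, and $A\subset K((\frac1T))$ a $K$-subalgebra with $A\cap K[[\frac1T]]=K$ and $g:=\dim_KK((\frac1T))/(A+K[[\frac1T]])<\infty$, which is strictly integral. Let $\boldsymbol{\mu}=(\mu_1,\ldots,\mu_g)$ be its gap sequence. Let $n\in\mathbb{Z}_{>0}$. For any $\vec{\pi}\in T_n$, we have $[h_{\boldsymbol{\mu}}(T;\vec{\pi})^{p^n}]=1$ in $\Gamma_A$. Consequently, there is an injective map $$T_n\to\Gamma_A[p^n],\qquad\vec{\pi}\mapsto[h_{\boldsymbol{\mu}}(T;\vec{\pi})].$$
   Context: $|\cdot|$ is the absolute value on $K$ with $|p|=1/p$, $O_K=\{|a|\le1\}$, $\mathcal{M}_K=\{|a|<1\}$. $K((\frac1T))$ is the field of series $\sum_{i\le n}v_iT^i$; the degree is the largest exponent with nonzero coefficient. Put $\underline{M}(A)=\{\deg v : 0\ne v\in A\}\subset\mathbb{Z}_{\ge0}$, written $\{s_1<s_2<\cdots\}$; the gap sequence is $\mathbb{Z}_{\ge0}\setminus\underline{M}(A)=\{\mu_1<\cdots<\mu_g\}$. The standard basis of $A$ is the unique basis $v_i=\sum_jv_{ij}T^j$ with $v_i$ monic of degree $s_i$ and $v_{i,s_j}=0$ for $i>j\ge1$; $A$ is strictly integral if all $v_{ij}\in O_K$. $H:=\{\sum_{i\in\mathbb{Z}}a_iT^i : a_i\in K,\ \sup|a_i|<\infty,\ \lim_{i\to+\infty}|a_i|=0\}$, a field complete for $\|\sum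 a_iT^i\|=\sup|a_i|$. $A^{\mathrm{an}}$ is the closure of $A$ in $H$. For $0\le\rho<1$, $\Gamma_\rho:=\{h=\sum h_iT^i\in H^* : \|h\|=|h_0|=1,\ |h_i|\le\rho^i\ \forall i>0\}$, $\Gamma:=\bigcup_{0\le\rho<1}\Gamma_\rho$, $\Gamma_A:=\Gamma/\big(((A^{\mathrm{an}})^*\cap\Gamma)\Gamma_0\big)$; $[h]$ is the class of $h$, and $\Gamma_A[p^n]$ the subgroup of elements killed by $p^n$. With $l(T):=\sum_{k\ge0}p^{-k}T^{p^k}$, set $h(T;\pi):=\exp(l(\pi T))$ for $\pi\in\mathcal{M}_K$ and $h_{\boldsymbol{\mu}}(T;\vec{\pi}):=\prod_{i=1}^gh(T^{\mu_i};\pi_i)\in\Gamma$. Let $O(A)$ be the set of elements of $A$ with all coefficients in $O_K$. One has $O_K[[\frac1T]][T]=O(A)\oplus\frac1TO_K[[\frac1T]]\oplus\bigoplus_{i=1}^gO_KT^{\mu_i}$. For $k\ge0$, $\mathbf{e}^{(k)}=(e^{(k)}_{ij})\in M_g(O_K)$ is defined by $T^{\mu_jp^k}-\sum_ie^{(k)}_{ij}T^{\mu_i}\in O(A)\oplus\frac1TO_K[[\frac1T]]$ for $j=1,\dots,g$. Put $\vec{l}(X_1,\ldots,X_g):=\sum_{k\ge0}p^{-k}\mathbf{e}^{(k)}(X_1^{p^k},\ldots,X_g^{p^k})^{t}\in K[[X_1,\ldots,X_g]]^{\oplus g}$ (convergent on $\mathcal{M}_K^{\oplus g}$), and $$T_n:=\{\vec{\pi}\in\mathcal{M}_K^{\oplus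 g} : \vec{l}(\vec{\pi})=0,\ \max_i|\pi_i|\le|p|^{1/(p^n-p^{n-1})}\}.$$ *)

(* Defs.v *)
From mathcomp Require Import all_boot all_order all_algebra all_field.
From mathcomp Require Import all_classical all_reals all_analysis.

Set Implicit Arguments.
Unset Strict Implicit.
Unset Printing Implicit Defensive.
Import Order.TTheory GRing.Theory Num.Theory.
Import numFieldNormedType.Exports.
Local Open Scope classical_set_scope.
Local Open Scope ring_scope.

(* Absolute values are bare functions F -> R, so convergence in F is expressed *)
(* through convergence of real sequences.                                      *)
Section AbsoluteValue.
Context {R : realType} {F : fieldType}.
Variable abs : F -> R.

Record nonarch_absval : Prop := NonarchAbsval {
  absval_ge0 : forall x, 0 <= abs x;
  absval_eq0 : forall x, abs x = 0 <-> x = 0;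
  absvalM : forall x y, abs (x * y) = abs x * abs y;
  absvalD : forall x y, abs (x + y) <= Num.max (abs x) (abs y) }.

Definition abs_cvg (u : nat -> F) (l : F) : Prop :=
  (fun n => abs (u n - l)) @ \oo --> (0 : R).

Definition abs_cauchy (u : nat -> F) : Prop :=
  forall e : R, 0 < e ->
    exists N, forall m n, (N <= m)%N -> (N <= n)%N -> abs (u m - u n) < e.

Definition abs_complete : Prop :=
  forall u, abs_cauchy u -> exists l, abs_cvg u l.

(* The limit of u; it is 0 when u does not converge. *)
Definition abs_lim (u : nat -> F) : F := xget 0 [set l | abs_cvg u l].

Definition integer_ring : set F := [set a | abs a <= 1].
Definition maximal_ideal : set F := [set a | abs a < 1].

End AbsoluteValue.

Definition padic_abs (R : realType) (p : nat) (q : rat) : R :=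
  if q == 0 then 0
  else p%:R ^+ logn p `|denq q|%N / p%:R ^+ logn p `|numq q|%N.

(* (Qp, v) is the field of p-adic numbers: a completion of rat for the p-adic  *)
(* absolute value, hence unique up to a unique isometric isomorphism.          *)
Record is_padic_field (R : realType) (p : nat) (Qp : fieldType) (v : Qp -> R)
    : Prop := IsPadicField {
  padic_absval : nonarch_absval v;
  padic_ratr : forall q : rat, v (ratr q) = padic_abs R p q;
  padic_complete : abs_complete v;
  padic_dense : forall (x : Qp) (e : R), 0 < e ->
    exists q : rat, v (x - ratr q) < e }.

(* dim (V / W) = g for subspaces W and V: there are g elements of V whose      *)
(* classes modulo W form a basis of V / W.                                     *)
Definition quotient_dim (K : fieldType) (E : lmodType K) (V W : set E) (g : nat)
    : Prop :=
  exists b : 'I_g -> E, (forall i, V (b i)) /\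
    forall x, V x -> exists! c : {ffun 'I_g -> K}, W (x - \sum_(i < g) c i *: b i).

Definition countable_basis (K : fieldType) (E : lmodType K) (A : set E)
    (b : nat -> E) : Prop :=
  [/\ forall i, A (b i),
      forall x, A x ->
        exists (N : nat) (c : nat -> K), x = \sum_(i < N) c i *: b i
    & forall (N : nat) (c : nat -> K), \sum_(i < N) c i *: b i = 0 ->
        forall i, (i < N)%N -> c i = 0].

(* The formal series \sum_(i : int) a_i T^i, encoded by i |-> a_i. The         *)
(* pointwise operations +, - and *: are the intended ones; the product is lmul *)
(* below, never the pointwise product of functions.                            *)
Notation biseries K := (int -> K^o).

Section Series.
Context {R : realType} {K : fieldType}.
Variable abs : K -> R.
Implicit Types (a b f h : biseries K) (A : set (biseries K)).

Definition mono (d : int) : biseries K := fun i => (i == d)%:R.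

(* Convergence is unconditional when u_i tends to 0 at both ends, hence the     *)
(* symmetric partial sums.                                                     *)
Definition zsum (u : int -> K) : K :=
  abs_lim abs (fun N => \sum_(j < N.*2.+1) u (j%:Z - N%:Z)).

(* Cauchy product. On K((1/T)) each coefficient is a finite sum, and on H a    *)
(* sum whose terms tend to 0 at both ends, so this is the product of both.     *)
Definition lmul a b : biseries K := fun n => zsum (fun i => a i * b (n - i)).
Definition lpow h (m : nat) : biseries K := iter m (lmul h) (mono 0).

Definition constants : set (biseries K) := range (fun c : K => c *: mono 0).

(* K((1/T)); power_inv is K[[1/T]]. *)
Definition laurent_inv : set (biseries K) :=
  [set f | exists d : int, forall i, d < i -> f i = 0].
Definition power_inv : set (biseries K) := [set f | forall i, 0 < i -> f i = 0].

Definition has_deg f (d : int) : Prop :=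
  f d != 0 /\ forall i, d < i -> f i = 0.

Record is_subalgebra A : Prop := IsSubalgebra {
  subalg_laurent : A `<=` laurent_inv;
  subalg1 : A (mono 0);
  subalgD : forall a b, A a -> A b -> A (a + b);
  subalgZ : forall (c : K) a, A a -> A (c *: a);
  subalgM : forall a b, A a -> A b -> A (lmul a b) }.

Definition degree_set A : set int := [set d | exists2 f, A f & has_deg f d].

Definition is_gap_sequence A (g : nat) (mu : 'I_g -> nat) : Prop :=
  (forall i j : 'I_g, (i < j)%N -> (mu i < mu j)%N) /\
  range mu = [set m : nat | ~ degree_set A m%:Z].

(* The sequences s_1 < s_2 < ... and v_1, v_2, ... are indexed from 0 here. *)
Record is_standard_basis A (s : nat -> int) (v : nat -> biseries K) : Prop :=
  IsStandardBasis {
    std_increasing : forall i j, (i < j)%N -> s i < s j;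
    std_degrees : range s = degree_set A;
    std_basis : countable_basis A v;
    std_deg : forall i, has_deg (v i) (s i);
    std_monic : forall i, v i (s i) = 1;
    std_reduced : forall i j, (j < i)%N -> v i (s j) = 0 }.

Definition strictly_integral A : Prop :=
  exists s v, is_standard_basis A s v /\
    forall (i : nat) (j : int), integer_ring abs (v i j).

Definition bounded_coefs f : Prop := has_ubound (range (fun i => abs (f i))).

Definition Hfield : set (biseries K) :=
  [set f | bounded_coefs f /\ (fun n : nat => abs (f n%:Z)) @ \oo --> (0 : R)].
Definition hnorm f : R := sup (range (fun i => abs (f i))).

Definition units (S : set (biseries K)) : set (biseries K) :=
  [set f | S f /\ exists2 f', S f' & lmul f f' = mono 0].

(* The closure in H; a strictly integral A is contained in H. *)
Definition Aan A : set (biseries K) :=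
  [set h | Hfield h /\ forall e : R, 0 < e ->
     exists f, [/\ A f, Hfield f & hnorm (h - f) < e]].

Definition Gamma_ (rho : R) : set (biseries K) :=
  [set h | [/\ units Hfield h, hnorm h = 1, abs (h 0) = 1
             & forall i : nat, (0 < i)%N -> abs (h i%:Z) <= rho ^+ i]].
Definition Gamma : set (biseries K) :=
  \bigcup_(rho in [set rho : R | 0 <= rho < 1]) Gamma_ rho.

(* The group Gamma_A is the set of cosets in Gamma of the subgroup             *)
(* ((Aan A)^* \cap Gamma) Gamma_0, under the product of cosets as sets.        *)
Definition prod_set (C D : set (biseries K)) : set (biseries K) :=
  [set lmul c d | c in C & d in D].
Definition Gamma_sub A : set (biseries K) :=
  prod_set (units (Aan A) `&` Gamma) (Gamma_ 0).
Definition cls A h : set (biseries K) := prod_set [set h] (Gamma_sub A).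
Definition GammaA A : set (set (biseries K)) := cls A @` Gamma.
Definition GammaA1 A : set (biseries K) := cls A (mono 0).
Definition GammaA_exp A (C : set (biseries K)) (m : nat) : set (biseries K) :=
  iter m (prod_set C) (GammaA1 A).
Definition GammaA_torsion A (m : nat) : set (set (biseries K)) :=
  [set C | GammaA A C /\ GammaA_exp A C m = GammaA1 A].

(* Formal power series in T over K are encoded by their coefficients nat -> K. *)

(* l(T) = \sum_k p^-k T^(p^k); note that m = p ^ logn p m fails for m = 0. *)
Definition l_series (p : nat) : nat -> K :=
  fun m => if (m == p ^ logn p m)%N then p%:R ^- logn p m else 0.

(* exp f for f without constant term: modulo T^(m+1), only f mod T^(m+1) and   *)
(* the powers f ^+ k with k <= m contribute.                                   *)
Definition ps_exp (f : nat -> K) : nat -> K :=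
  fun m => (\sum_(k < m.+1) (k`!%:R)^-1 *: (\poly_(i < m.+1) f i) ^+ k)`_m.

Definition h_series (p : nat) (x : K) : nat -> K :=
  ps_exp (fun m => l_series p m * x ^+ m).

(* f(T^d), for d > 0 *)
Definition ps_subst (f : nat -> K) (d : nat) : biseries K :=
  fun i => if i is Posz m then (if (d %| m)%N then f (m %/ d)%N else 0) else 0.

Definition h_mu (p g : nat) (mu : 'I_g -> nat) (x : 'rV[K]_g) : biseries K :=
  \big[lmul/mono 0]_(i < g) ps_subst (h_series p (x 0 i)) (mu i).

Definition O_part A : set (biseries K) :=
  [set f | A f /\ forall i, integer_ring abs (f i)].
Definition O_neg : set (biseries K) :=
  [set f | (forall i, 0 <= i -> f i = 0) /\ forall i, integer_ring abs (f i)].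

Definition is_e_matrix A (p g : nat) (mu : 'I_g -> nat) (k : nat) (e : 'M[K]_g)
    : Prop :=
  (forall i j, integer_ring abs (e i j)) /\
  forall j, [set f1 + f2 | f1 in O_part A & f2 in O_neg]
    (mono (mu j * p ^ k)%N%:Z - \sum_(i < g) e i j *: mono (mu i)%:Z).
Definition e_matrix A (p g : nat) (mu : 'I_g -> nat) (k : nat) : 'M[K]_g :=
  xget 0 [set e | is_e_matrix A p mu k e].

(* The value at x of the vector of power series l; the sum over k converges    *)
(* when all entries of x lie in the maximal ideal.                             *)
Definition l_vec A (p g : nat) (mu : 'I_g -> nat) (x : 'rV[K]_g) : 'cV[K]_g :=
  \col_i abs_lim abs (fun N => \sum_(k < N)
    (p%:R ^- k *: (e_matrix A p mu k *m (map_mx (fun y => y ^+ (p ^ k)) x)^T)) i 0).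

Definition T_ A (p g : nat) (mu : 'I_g -> nat) (n : nat) : set 'rV[K]_g :=
  [set x : 'rV[K]_g | [/\ forall i, maximal_ideal abs (x 0 i),
               l_vec A p mu x = 0
             & \big[Num.max/0]_(i < g) abs (x 0 i)
                 <= abs p%:R `^ ((p ^ n - p ^ n.-1)%N%:R^-1)]].

End Series.

(* Main.v *)
(* Write [G_c] for the product over i of [exp (c l (pi_i T^mu_i))]. Dwork's        *)
(* argument shows that [exp (c l)] is integral for every p-adic integer c, so     *)
(* all [G_c] with c an integer lie in Gamma; they satisfy [G_b G_c = G_(b+c)],    *)
(* and [G_1 = h_mu]. The bound on pi makes every term of                          *)
(* [F = p^n sum_(i, k) p^-k pi_i^(p^k) T^(mu_i p^k)] so small that exp converges  *)
(* in norm and [G_(p^n) = exp F]. Decomposing each monomial along A, 1/T K[[1/T]] *)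
(* and the gaps, the gap part of F is [p^n l(pi) = 0], so [F = a + b] with a in   *)
(* the closure of A and b in 1/T K[[1/T]]; hence [G_(p^n) = exp a * exp b] is     *)
(* trivial in Gamma_A.                                                            *)
(* For injectivity, let [h_mu pi = h_mu pi' * a * u]. To first order in the       *)
(* distance d of pi and pi', [a u - 1] is the sum of the [(pi_i - pi'_i) T^mu_i], *)
(* while comparing components in the orthogonal decomposition bounds these        *)
(* coefficients by something strictly smaller than d.                             *)

From HB Require Import structures.
Require Import Defs.
From mathcomp Require Import all_boot all_order all_algebra all_field.
From mathcomp Require Import zify ring lra.
From mathcomp Require Import all_classical all_reals all_analysis.

Set Implicit Arguments.
Unset Strict Implicit.
Unset Printing Implicit Defensive.
Import Order.TTheory GRing.Theory Num.Theory.
Import numFieldNormedType.Exports.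
Local Open Scope classical_set_scope.
Local Open Scope ring_scope.

(** * Absolute values and sums over the integers *)

(** Everything is expressed through the family [G_c = ah_prod mu c x], with [c] an integer. [G_1] is
    [h_mu], [ah_prodX] gives [G_1^m = G_m], and [G_(-c)] is the inverse of [G_c], so powers and
    inverses in Gamma become arithmetic on the parameter. Membership in Gamma rests on
    [artin_hasse_integral]. This needs x^p and x to be congruent modulo p, which holds for p-adic
    integers ([fermat_padic]) but may fail over [K]; so integrality is proved over Q_p and carried
    to [K] by [ps_exp_map]. Torsion: the bound in [T_] brings the exponent of [G_(p^n)] into the
    domain where exp converges in norm ([lterm_small]), and there the formal and the normed
    exponentials agree ([hexp_subst]). The exponent can then be split. [e_matrixP] cuts each
    monomial into components of norm at most 1 in A, in negative powers and in the gaps; by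
    [l_vec_cvg] the gap components sum to p^n l(pi) = 0, and [lsum_decomp] leaves a + b with exp a a
    unit of the closure of A and exp b in Gamma_0. Injectivity: strict integrality makes the
    coordinates of an element of A equal to its coefficients at the degrees of A ([coef_std]), so
    the decomposition is orthogonal ([decomp_le]). Let d be the distance of two points and r < 1 a
    bound on their entries. If their classes agree, the quotient m of the two products is 1 plus the
    gap vector of differences, up to d r ([ah_prod_diff]). An element of the subgroup has almost no
    gap component, since only the product of the nonconstant parts of its two factors can contribute
    ([hGamma_sub_diff_le]). Hence d <= d r and d = 0. *)

Lemma expr_small (R : realType) (r e : R) : 0 <= r < 1 -> 0 < e ->
  exists N : nat, forall n, (N <= n)%N -> r ^+ n <= e.
Proof.
move=> /andP[r0 r1] e0; have h : `|r| < 1 by rewrite ger0_norm.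
have /cvgrPdist_le /(_ e e0) [N _ hN] := cvg_expr h.
exists N => n Nn; have := hN n Nn; rewrite /= sub0r normrN ger0_norm //.
by rewrite exprn_ge0.
Qed.

Section AbsvalTheory.
Context {R : realType} {F : fieldType} {abs : F -> R}.
Hypothesis Habs : nonarch_absval abs.
Implicit Types (x y : F) (u : nat -> F).

Lemma absval0 : abs 0 = 0.
Proof. exact/(absval_eq0 Habs). Qed.

Lemma absval1 : abs 1 = 1.
Proof.
have h : abs 1 != 0 by apply/eqP => /(absval_eq0 Habs)/eqP; rewrite oner_eq0.
by apply: (mulfI h); rewrite -(absvalM Habs) !mulr1.
Qed.

Lemma absvalN x : abs (- x) = abs x.
Proof.
have h : abs (-1) = 1.
  have := absvalM Habs (-1) (-1); rewrite mulrNN mulr1 absval1 -expr2 => /esym/eqP.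
  rewrite sqrf_eq1 => /orP[/eqP //|/eqP e].
  by have := absval_ge0 Habs (-1); rewrite e; lra.
by rewrite -mulN1r (absvalM Habs) h mul1r.
Qed.

Lemma absvalD_le x y c : abs x <= c -> abs y <= c -> abs (x + y) <= c.
Proof.
by move=> hx hy; apply: le_trans (absvalD Habs x y) _; rewrite ge_max hx.
Qed.

Lemma absvalB_le x y c : abs x <= c -> abs y <= c -> abs (x - y) <= c.
Proof. by move=> hx hy; apply: absvalD_le; rewrite ?absvalN. Qed.

Lemma absval_eps_eq0 x : (forall e : R, 0 < e -> abs x <= e) -> x = 0.
Proof.
move=> h; apply/(absval_eq0 Habs)/eqP; rewrite eq_le (absval_ge0 Habs) andbT.
by apply/ler_addgt0Pl => e e0; rewrite addr0; exact: h.
Qed.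

Lemma absval_cvgP u l : abs_cvg abs u l <->
  forall e : R, 0 < e -> exists N : nat, forall n, (N <= n)%N -> abs (u n - l) <= e.
Proof.
rewrite /abs_cvg; split => [/cvgrPdist_le h e e0|h].
  have [N _ hN] := h e e0; exists N => n Nn.
  by have := hN n Nn; rewrite /= sub0r normrN ger0_norm // (absval_ge0 Habs).
apply/cvgrPdist_le => e e0; have [N hN] := h e e0.
exists N => // n /= Nn.
by rewrite sub0r normrN ger0_norm ?(absval_ge0 Habs) //; exact: hN.
Qed.

End AbsvalTheory.

(** Both Q_p and [K] are instances. The absolute value is bundled with the field so that H can later
    be a type depending on it. *)
Record pvField (R : realType) (p : nat) := PvField {
  pv_sort :> fieldType;
  pabs : pv_sort -> R;
  pabs_absval : nonarch_absval pabs;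
  pabs_complete : abs_complete pabs;
  pv_prime : prime p;
  pabs_p : 0 < pabs p%:R < 1 }.

Section Absval.
Context {R : realType} {p : nat} {K : pvField R p}.
Local Notation abs := (@pabs R p K).
Implicit Types (x y : K) (u : nat -> K).

Lemma pabs_ge0 x : 0 <= abs x.
Proof. exact: absval_ge0 (pabs_absval K) x. Qed.

Lemma pabs0 : abs 0 = 0.
Proof. exact: absval0 (pabs_absval K). Qed.

Lemma pabs_eq0 x : (abs x == 0) = (x == 0).
Proof.
apply/eqP/eqP => [|->]; last exact: pabs0.
by move/(absval_eq0 (pabs_absval K)).
Qed.

Lemma pabsM x y : abs (x * y) = abs x * abs y.
Proof. exact: absvalM (pabs_absval K) x y. Qed.

Lemma pabs1 : abs 1 = 1.
Proof. exact: absval1 (pabs_absval K). Qed.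

Lemma pabsN x : abs (- x) = abs x.
Proof. exact: absvalN (pabs_absval K) x. Qed.

Lemma pabs_subC x y : abs (x - y) = abs (y - x).
Proof. by rewrite -pabsN opprB. Qed.

Lemma pabsX x n : abs (x ^+ n) = abs x ^+ n.
Proof. by elim: n => [|n IH]; rewrite ?expr0 ?pabs1 // !exprS pabsM IH. Qed.

Lemma pabsV x : abs x^-1 = (abs x)^-1.
Proof.
have [->|x0] := eqVneq x 0; first by rewrite invr0 pabs0 invr0.
have h : abs x != 0 by rewrite pabs_eq0.
by apply: (mulfI h); rewrite -pabsM !mulfV // pabs1.
Qed.

Lemma pabsD_le x y c : abs x <= c -> abs y <= c -> abs (x + y) <= c.
Proof. exact: absvalD_le (pabs_absval K) _ _ _. Qed.

Lemma pabsB_le x y c : abs x <= c -> abs y <= c -> abs (x - y) <= c.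
Proof. by move=> hx hy; apply: pabsD_le; rewrite ?pabsN. Qed.

Lemma pabs_sum_le (I : Type) (r : seq I) (P : pred I) (F : I -> K) c : 0 <= c ->
  (forall i, P i -> abs (F i) <= c) -> abs (\sum_(i <- r | P i) F i) <= c.
Proof.
move=> c0 h; apply: (big_ind (fun x => abs x <= c)) => //; first by rewrite pabs0.
by move=> x y; exact: pabsD_le.
Qed.

Lemma pabs_addl x y : abs y < abs x -> abs (x + y) = abs x.
Proof.
move=> h; apply/eqP; rewrite eq_le; apply/andP; split.
  by apply: pabsD_le => //; exact: ltW.
rewrite leNgt; apply/negP => h2.
have : abs (x + y - y) <= Num.max (abs (x + y)) (abs y).
  by apply: pabsB_le; rewrite le_max lexx ?orbT.
by rewrite addrK leNgt gt_max h2 h.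
Qed.

Lemma pabs_mul_le x y c d : abs x <= c -> abs y <= d -> abs (x * y) <= c * d.
Proof. by move=> hx hy; rewrite pabsM ler_pM // pabs_ge0. Qed.

Lemma pabs_mul_le1 x y c : abs x <= 1 -> abs y <= c -> abs (x * y) <= c.
Proof. by move=> hx hy; rewrite -[c]mul1r; apply: pabs_mul_le. Qed.

Lemma pabs_nat_le1 n : abs n%:R <= 1.
Proof.
by elim: n => [|n IH]; rewrite ?pabs0 // -natr1; apply: pabsD_le; rewrite ?pabs1.
Qed.

Lemma pabs_int_le1 (z : int) : abs z%:~R <= 1.
Proof.
by case: z => n; rewrite ?NegzE ?mulrNz ?pabsN; exact: pabs_nat_le1.
Qed.

Lemma pabs_X_le1 x n : abs x <= 1 -> abs (x ^+ n) <= 1.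
Proof. by move=> h; rewrite pabsX exprn_ile1 // pabs_ge0. Qed.

Lemma pabs_eps_eq0 x : (forall e : R, 0 < e -> abs x <= e) -> x = 0.
Proof. exact: absval_eps_eq0 (pabs_absval K) _. Qed.

Lemma abs_cvgP u l : abs_cvg abs u l <->
  forall e : R, 0 < e -> exists N : nat, forall n, (N <= n)%N -> abs (u n - l) <= e.
Proof. exact: absval_cvgP (pabs_absval K) _ _. Qed.

Lemma abs_cvg_unique u l m : abs_cvg abs u l -> abs_cvg abs u m -> l = m.
Proof.
move=> /abs_cvgP hl /abs_cvgP hm; apply/eqP; rewrite -subr_eq0; apply/eqP.
apply: pabs_eps_eq0 => e e0.
have [N hN] := hl e e0; have [M hM] := hm e e0.
have -> : l - m = (u (N + M)%N - m) - (u (N + M)%N - l) by ring.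
by apply: pabsB_le; [apply: hM; rewrite leq_addl | apply: hN; rewrite leq_addr].
Qed.

Lemma abs_cvg_lim u l : abs_cvg abs u l -> abs_lim abs u = l.
Proof.
move=> h; apply: (abs_cvg_unique _ h).
by apply: (@xgetPex _ 0 [set l | abs_cvg abs u l]); exists l.
Qed.

Lemma abs_cvg_le u l c : abs_cvg abs u l -> 0 <= c ->
  (exists N : nat, forall n, (N <= n)%N -> abs (u n) <= c) -> abs l <= c.
Proof.
move=> /abs_cvgP hl c0 [N hN]; apply/ler_addgt0Pl => e e0.
have [M hM] := hl e e0.
have -> : l = u (N + M)%N - (u (N + M)%N - l) by ring.
apply: pabsB_le.
  by apply: (le_trans (hN _ (leq_addr _ _))); rewrite lerDr ltW.
by apply: (le_trans (hM _ (leq_addl _ _))); rewrite lerDl.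
Qed.

Lemma pabs_step_le u (N : nat) c : 0 <= c ->
  (forall n, (N <= n)%N -> abs (u n.+1 - u n) <= c) ->
  forall m, (N <= m)%N -> abs (u m - u N) <= c.
Proof.
move=> c0 h m /subnK <-; elim: (m - N)%N => [|d IH].
  by rewrite add0n subrr pabs0.
have -> : u (d.+1 + N)%N - u N = (u (d + N).+1 - u (d + N)%N) + (u (d + N)%N - u N).
  by rewrite addSn; ring.
by apply: pabsD_le => //; apply: h; rewrite leq_addl.
Qed.

(** Ultrametric completeness: by [pabs_step_le] consecutive differences bound all later ones, so it
    suffices that they tend to 0. *)
Lemma abs_cvg_step u :
  (forall e : R, 0 < e ->
     exists N : nat, forall n, (N <= n)%N -> abs (u n.+1 - u n) <= e) ->
  abs_cvg abs u (abs_lim abs u).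
Proof.
move=> h; suff [l hl] : exists l, abs_cvg abs u l by rewrite (abs_cvg_lim hl).
apply: pabs_complete => e e0; have e20 : 0 < e / 2 by rewrite divr_gt0.
have [N hN] := h _ e20; exists N => m n Nm Nn.
have -> : u m - u n = (u m - u N) - (u n - u N) by ring.
apply: (@le_lt_trans _ _ (e / 2)); last by rewrite ltr_pdivrMr // ltr_pMr // ltr1n.
by apply: pabsB_le; apply: pabs_step_le => //; exact: ltW.
Qed.

End Absval.

Section Zsum.
Context {R : realType} {p : nat} {K : pvField R p}.
Local Notation abs := (@pabs R p K).
Implicit Types (u w : int -> K).

Definition c0_family u :=
  forall e : R, 0 < e -> exists N : nat, forall j : int, (N < absz j)%N -> abs (u j) <= e.

Definition psum u (N : nat) : K := \sum_(j < N.*2.+1) u (j%:Z - N%:Z).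

Lemma psumS u N : psum u N.+1 = psum u N + (u N.+1%:Z + u (- N.+1%:Z)).
Proof.
rewrite /psum doubleS big_ord_recl big_ord_recr /= add0r.
under eq_bigr => i _ do rewrite /bump /= add1n.
have -> : (bump 0 N.*2.+1)%:Z - N.+1%:Z = N.+1%:Z.
  by rewrite /bump /=; lia.
rewrite [LHS]addrC -addrA; congr (_ + (_ + _)).
by apply: eq_bigr => i _; congr u; lia.
Qed.

Lemma psum_err u (N : nat) c : 0 <= c ->
  (forall j : int, (N < absz j)%N -> abs (u j) <= c) ->
  forall M, (N <= M)%N -> abs (psum u M - psum u N) <= c.
Proof.
move=> c0 h; apply: pabs_step_le => // n Nn; rewrite psumS addrAC subrr add0r.
by apply: pabsD_le; apply: h; lia.
Qed.

Lemma zsum_cvg u : c0_family u -> abs_cvg abs (psum u) (zsum abs u).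
Proof.
move=> h; apply: abs_cvg_step => e e0; have [N hN] := h e e0.
exists N => n Nn; rewrite psumS addrAC subrr add0r.
by apply: pabsD_le; apply: hN; lia.
Qed.

Lemma zsum_near u (N : nat) c : c0_family u -> 0 <= c ->
  (forall j : int, (N < absz j)%N -> abs (u j) <= c) ->
  forall M, (N <= M)%N -> abs (zsum abs u - psum u M) <= c.
Proof.
move=> hu c0 h M NM.
have hc : abs_cvg abs (fun n => psum u n - psum u M) (zsum abs u - psum u M).
  apply/abs_cvgP => e e0; have [N0 hN0] := (abs_cvgP _ _).1 (zsum_cvg hu) e e0.
  exists N0 => n /hN0; congr (_ <= _); congr (abs _); ring.
apply: (abs_cvg_le hc c0); exists M => n Mn; apply: psum_err => // j Mj.
by apply: h; apply: leq_ltn_trans Mj.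
Qed.

Lemma psum_le u c N : 0 <= c -> (forall j, abs (u j) <= c) -> abs (psum u N) <= c.
Proof. by move=> c0 h; apply: pabs_sum_le. Qed.

Lemma zsum_le u c : c0_family u -> 0 <= c -> (forall j, abs (u j) <= c) ->
  abs (zsum abs u) <= c.
Proof.
move=> hu c0 h; rewrite -[zsum _ _](subrK (psum u 0)).
apply: pabsD_le; last exact: psum_le.
by apply: (@zsum_near _ 0).
Qed.

Lemma zsum_finite u (N : nat) : (forall j : int, (N < absz j)%N -> u j = 0) ->
  zsum abs u = psum u N.
Proof.
move=> h; have hu : c0_family u.
  by move=> e e0; exists N => j /h ->; rewrite pabs0 ltW.
apply/eqP; rewrite -subr_eq0; apply/eqP/pabs_eps_eq0 => e e0.
by apply: (@zsum_near _ N) => //; rewrite ?ltW // => j /h ->; rewrite pabs0 ltW.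
Qed.

Lemma c0_familyD u w : c0_family u -> c0_family w -> c0_family (fun j => u j + w j).
Proof.
move=> hu hw e e0; have [N hN] := hu e e0; have [M hM] := hw e e0.
exists (N + M)%N => j hj; apply: pabsD_le; [apply: hN | apply: hM]; lia.
Qed.

Lemma c0_familyZ (a : K) u : c0_family u -> c0_family (fun j => a * u j).
Proof.
move=> hu e e0.
have h : 0 < abs a + 1 by rewrite ltr_wpDl // pabs_ge0.
have [N hN] := hu (e / (abs a + 1)) (divr_gt0 e0 h); exists N => j /hN hj.
apply: (le_trans (pabs_mul_le (lexx _) hj)).
rewrite mulrA ler_pdivrMr // mulrC ler_pM2l // lerDl //.
Qed.

Lemma zsum_cvg_unique u l : c0_family u -> abs_cvg abs (psum u) l -> zsum abs u = l.
Proof. by move=> hu; exact/abs_cvg_unique/zsum_cvg. Qed.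

Lemma zsumD u w : c0_family u -> c0_family w ->
  zsum abs (fun j => u j + w j) = zsum abs u + zsum abs w.
Proof.
move=> hu hw; apply: zsum_cvg_unique; first exact: c0_familyD.
apply/abs_cvgP => e e0.
have [N hN] := (abs_cvgP _ _).1 (zsum_cvg hu) e e0.
have [M hM] := (abs_cvgP _ _).1 (zsum_cvg hw) e e0.
exists (N + M)%N => n hn; rewrite /psum big_split /= opprD addrACA.
by apply: pabsD_le; [apply: hN | apply: hM]; lia.
Qed.

Lemma zsumZ (a : K) u : c0_family u -> zsum abs (fun j => a * u j) = a * zsum abs u.
Proof.
move=> hu; apply: zsum_cvg_unique; first exact: c0_familyZ.
apply/abs_cvgP => e e0.
have h : 0 < abs a + 1 by rewrite ltr_wpDl // pabs_ge0.
have [N hN] := (abs_cvgP _ _).1 (zsum_cvg hu) _ (divr_gt0 e0 h).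
exists N => n /hN hn; rewrite /psum -mulr_sumr -mulrBr.
apply: (le_trans (pabs_mul_le (lexx _) hn)).
by rewrite mulrA ler_pdivrMr // mulrC ler_pM2l // lerDl.
Qed.

Lemma zsum1 u (k : int) : (forall j : int, j != k -> u j = 0) -> zsum abs u = u k.
Proof.
move=> h; rewrite (@zsum_finite _ (absz k)) => [|j jk]; last first.
  by apply: h; apply: contraTneq jk => ->; rewrite ltnn.
have hk : (absz (k + (absz k)%:Z)%R < (absz k).*2.+1)%N by lia.
rewrite /psum (bigD1 (Ordinal hk)) //= big1 ?addr0; first by congr u; lia.
move=> j jk; apply: h; apply: contraNneq jk => e.
by apply/eqP/val_inj => /=; lia.
Qed.

(** Collapses a Cauchy product supported on the multiples of some [d] to a finite sum; the positions
    [k i] may coincide. *)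
Lemma zsum_sum_delta (I : Type) (r : seq I) (c : I -> K) (k : I -> int) :
  c0_family (fun j => \sum_(i <- r) (if j == k i then c i else 0)) /\
  zsum abs (fun j => \sum_(i <- r) (if j == k i then c i else 0)) = \sum_(i <- r) c i.
Proof.
elim: r => [|i r [IH1 IH2]].
  split=> [e e0|]; first by exists 0%N => j _; rewrite big_nil pabs0 ltW.
  by rewrite (@zsum1 _ 0) ?big_nil // => j _; rewrite big_nil.
have -> : (fun j => \sum_(i0 <- i :: r) (if j == k i0 then c i0 else 0)) =
  (fun j => (if j == k i then c i else 0) + \sum_(i0 <- r) (if j == k i0 then c i0 else 0)).
  by apply: funext => j; rewrite big_cons.
have hd : c0_family (fun j => if j == k i then c i else 0).
  move=> e e0; exists (absz (k i)) => j hj.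
  by case: eqP hj => [->|]; rewrite ?ltnn // pabs0 ltW.
split; first exact: c0_familyD.
rewrite zsumD // IH2 big_cons (@zsum1 _ (k i)) ?eqxx // => j /negbTE -> //.
Qed.

Lemma c0_shift u (k : int) : c0_family u -> c0_family (fun j => u (j + k)).
Proof.
move=> hu e e0; have [N hN] := hu e e0; exists (N + absz k)%N => j hj.
by apply: hN; lia.
Qed.

(** The shift moves the symmetric window by one place, so the partial sums differ by two boundary
    terms, which tend to 0. *)
Lemma zsum_shift1 u : c0_family u -> zsum abs (fun j => u (j + 1)) = zsum abs u.
Proof.
move=> hu; apply: zsum_cvg_unique; first exact: c0_shift.
apply/abs_cvgP => e e0.
have [N hN] := (abs_cvgP _ _).1 (zsum_cvg hu) _ e0.
have [M hM] := hu e e0.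
exists (N + M).+1 => n hn.
have -> : psum (fun j => u (j + 1)) n = psum u n + (u n.+1%:Z - u (- n%:Z)).
  rewrite addrC; apply/eqP; rewrite -subr_eq; apply/eqP; rewrite /psum.
  have E (i : nat) : u (i%:Z - n%:Z + 1) = u (i.+1%:Z - n%:Z) by congr u; lia.
  under eq_bigr => i _ do rewrite E.
  rewrite -sumrB.
  rewrite -(big_mkord xpredT (fun i => u (i.+1%:Z - n%:Z) - u (i%:Z - n%:Z))).
  rewrite (telescope_sumr (fun i => u (i%:Z - n%:Z))) //.
  have -> : (n.*2.+1)%:Z - n%:Z = n.+1%:Z by lia.
  by rewrite sub0r.
rewrite addrAC; apply: pabsD_le; first by apply: hN; lia.
by apply: pabsB_le; apply: hM; lia.
Qed.

Lemma zsum_shift u (k : int) : c0_family u -> zsum abs (fun j => u (j + k)) = zsum abs u.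
Proof.
have pos (w : int -> K) (n : nat) : c0_family w -> zsum abs (fun j => w (j + n%:Z)) = zsum abs w.
  move=> hw; elim: n => [|n IH].
    by congr zsum; apply: funext => j; rewrite addr0.
  rewrite -[RHS]IH -(zsum_shift1 (c0_shift n%:Z hw)).
  by congr zsum; apply: funext => j; congr w; lia.
move=> hu; case: k => n; first exact: pos.
rewrite NegzE -(pos _ n.+1 (c0_shift (- n.+1%:Z) hu)).
by congr zsum; apply: funext => j; congr u; lia.
Qed.

Lemma c0_opp u : c0_family u -> c0_family (fun j => u (- j)).
Proof.
move=> hu e e0; have [N hN] := hu e e0; exists N => j hj; apply: hN.
by rewrite abszN.
Qed.

Lemma zsum_opp u : c0_family u -> zsum abs (fun j => u (- j)) = zsum abs u.
Proof.
move=> hu; apply: zsum_cvg_unique; first exact: c0_opp.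
have -> : psum (fun j => u (- j)) = psum u; last exact: zsum_cvg.
apply: funext => n; elim: n => [|n IH]; last by rewrite !psumS IH /= opprK [u _ + _ in RHS]addrC.
by rewrite /psum !big_ord_recl !big_ord0.
Qed.

Definition c0_family2 (w : int -> int -> K) := forall e : R, 0 < e ->
  exists N : nat, forall i j : int, (N < absz i)%N || (N < absz j)%N -> abs (w i j) <= e.

Lemma c0_family2_row (w : int -> int -> K) i : c0_family2 w -> c0_family (w i).
Proof.
by move=> hw e e0; have [N hN] := hw e e0; exists N => j hj; rewrite hN // hj orbT.
Qed.

Lemma c0_family2_sum (w : int -> int -> K) : c0_family2 w -> c0_family (fun i => zsum abs (w i)).
Proof.
move=> hw e e0; have [N hN] := hw e e0; exists N => i hi.
apply: zsum_le; rewrite ?ltW //; first exact: c0_family2_row.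
by move=> j; apply: hN; rewrite hi.
Qed.

Lemma zsum2_near (w : int -> int -> K) c : c0_family2 w -> 0 < c -> exists N : nat, forall M, (N <= M)%N ->
  abs (zsum abs (fun i => zsum abs (w i)) - psum (fun i => psum (w i) M) M) <= c.
Proof.
move=> hw c0; have [N hN] := hw c c0; exists N => M NM.
rewrite -[zsum _ _](subrK (psum (fun i => zsum abs (w i)) M)) -addrA.
apply: pabsD_le.
  apply: (@zsum_near _ N) => //; rewrite ?ltW //; first exact: c0_family2_sum.
  move=> i hi; apply: zsum_le; rewrite ?ltW //; first exact: c0_family2_row.
  by move=> j; apply: hN; rewrite hi.
rewrite /psum -sumrB; apply: pabs_sum_le; rewrite ?ltW // => i _.
apply: (@zsum_near _ N) => //; rewrite ?ltW //; first exact: c0_family2_row.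
by move=> j hj; apply: hN; rewrite hj orbT.
Qed.

Lemma c0_family2_tr (w : int -> int -> K) : c0_family2 w -> c0_family2 (fun i j => w j i).
Proof.
by move=> hw e e0; have [N hN] := hw e e0; exists N => i j hij; apply: hN; rewrite orbC.
Qed.

(** Both iterated sums are approximated by the same sums over squares, where the order of summation
    is irrelevant. *)
Lemma exchange_zsum (w : int -> int -> K) : c0_family2 w ->
  zsum abs (fun i => zsum abs (w i)) = zsum abs (fun j => zsum abs (fun i => w i j)).
Proof.
move=> hw; apply/eqP; rewrite -subr_eq0; apply/eqP/pabs_eps_eq0 => e e0.
have [N hN] := zsum2_near hw e0; have [M hM] := zsum2_near (c0_family2_tr hw) e0.
set S := (X in X - _); set T := (X in _ - X).
pose Q := psum (fun i => psum (w i) (N + M)) (N + M).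
have hQ : Q = psum (fun j => psum (fun i => w i j) (N + M)) (N + M).
  by rewrite /Q /psum exchange_big.
have -> : S - T = (S - Q) - (T - Q) by ring.
apply: pabsB_le; first by apply: hN; rewrite leq_addr.
by rewrite hQ; apply: hM; rewrite leq_addl.
Qed.

End Zsum.

(** * The ring H *)

Section Hring.
Context {R : realType} {p : nat} {K : pvField R p}.
Local Notation abs := (@pabs R p K).
Implicit Types (f g h : biseries K).

Lemma HfieldP f : Hfield abs f <->
  (exists2 C : R, 0 < C & forall i, abs (f i) <= C) /\
  (forall e : R, 0 < e -> exists N : nat, forall i : int, N%:Z < i -> abs (f i) <= e).
Proof.
have hcv : (fun n : nat => abs (f n%:Z)) @ \oo --> (0 : R) <->
    abs_cvg abs (fun n => f n%:Z) 0.
  rewrite /abs_cvg; suff -> : (fun n : nat => abs (f n%:Z)) = (fun n => abs ((f n%:Z : K) - 0)) by [].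
  by apply: funext => n; rewrite subr0.
split=> -[h1 h2]; split.
- case: h1 => C hC; exists (Num.max C 1); first by rewrite lt_max ltr01 orbT.
  by move=> i; rewrite le_max hC //; exists i.
- move/hcv/abs_cvgP: h2 => h2 e /h2 [N hN]; exists N => -[] // i hi.
  by rewrite -[f _]subr0; apply: hN; lia.
- by case: h1 => C C0 hC; exists C => _ [i _ <-].
- apply/hcv/abs_cvgP => e /h2 [N hN]; exists N.+1 => i hi.
  by rewrite subr0; apply: hN; lia.
Qed.

Lemma lmulE f g n : lmul abs f g n = zsum abs (fun i => (f i : K) * (g (n - i) : K)).
Proof. by []. Qed.

(** For [i] far to the right [f i] is small; for [i] far to the left [n - i] is far to the right and
    [g (n - i)] is small. The other factor is bounded. *)
Lemma c0_lmul f g n : Hfield abs f -> Hfield abs g ->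
  c0_family (fun i => (f i : K) * (g (n - i) : K)).
Proof.
move=> /HfieldP[[C C0 hC] hf] /HfieldP[[D D0 hD] hg] e e0.
have [N hN] := hf _ (divr_gt0 e0 D0); have [M hM] := hg _ (divr_gt0 e0 C0).
exists (N + M + absz n)%N => i hi.
have [iN|iN] := ltP N%:Z i.
  rewrite -[e](divfK (lt0r_neq0 D0)); exact: pabs_mul_le (hN _ iN) (hD _).
rewrite -[e](divfK (lt0r_neq0 C0)) [_ / C * _]mulrC; apply: pabs_mul_le (hC _) (hM _ _).
lia.
Qed.

Lemma lmul_le f g (C D : R) n : Hfield abs f -> Hfield abs g ->
  (forall i, abs (f i) <= C) -> (forall i, abs (g i) <= D) -> abs (lmul abs f g n) <= C * D.
Proof.
move=> hf hg hC hD; rewrite lmulE; apply: zsum_le; first exact: c0_lmul.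
  apply: mulr_ge0; [exact: le_trans (pabs_ge0 _) (hC 0)|exact: le_trans (pabs_ge0 _) (hD 0)].
by move=> i; apply: pabs_mul_le.
Qed.

Lemma Hfield_lmul f g : Hfield abs f -> Hfield abs g -> Hfield abs (lmul abs f g).
Proof.
move=> hf hg; have /HfieldP[[C C0 hC] hf'] := hf; have /HfieldP[[D D0 hD] hg'] := hg.
apply/HfieldP; split.
  by exists (C * D); [exact: mulr_gt0 | move=> i; exact: lmul_le].
move=> e e0.
have [N hN] := hf' _ (divr_gt0 e0 D0); have [M hM] := hg' _ (divr_gt0 e0 C0).
exists (N + M)%N => n hn; rewrite lmulE; apply: zsum_le; rewrite ?(ltW e0) //.
  exact: c0_lmul.
move=> i; have [iN|iN] := ltP N%:Z i.
  rewrite -[e](divfK (lt0r_neq0 D0)); exact: pabs_mul_le (hN _ iN) (hD _).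
rewrite -[e](divfK (lt0r_neq0 C0)) [_ / C * _]mulrC; apply: pabs_mul_le (hC _) (hM _ _).
lia.
Qed.

Lemma HfieldD f g : Hfield abs f -> Hfield abs g -> Hfield abs (f + g).
Proof.
move=> /HfieldP[[C C0 hC] hf] /HfieldP[[D D0 hD] hg]; apply/HfieldP; split.
  exists (Num.max C D); first by rewrite lt_max C0.
  by move=> i; apply: pabsD_le; rewrite le_max ?hC ?hD ?orbT.
move=> e e0; have [N hN] := hf _ e0; have [M hM] := hg _ e0.
exists (N + M)%N => i hi; apply: pabsD_le; [apply: hN | apply: hM]; lia.
Qed.

Lemma HfieldN f : Hfield abs f -> Hfield abs (- f).
Proof.
move=> /HfieldP[[C C0 hC] hf]; apply/HfieldP; split.
  by exists C => // i; rewrite pabsN.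
by move=> e /hf[N hN]; exists N => i /hN; rewrite pabsN.
Qed.

Lemma Hfield_finite f (C : R) (N : nat) : 0 < C -> (forall i, abs (f i) <= C) ->
  (forall i, N%:Z < i -> f i = 0) -> Hfield abs f.
Proof.
move=> C0 hC h; apply/HfieldP; split; first by exists C.
by move=> e e0; exists N => i /h ->; rewrite pabs0 ltW.
Qed.

Lemma Hfield0 : Hfield abs 0.
Proof. by apply: (@Hfield_finite _ 1 0) => // i; rewrite pabs0. Qed.

Lemma pabs_mono d i : abs (mono d i : K) <= 1.
Proof. by rewrite /mono; case: eqP; rewrite ?pabs1 ?pabs0. Qed.

Lemma Hfield_mono d : Hfield abs (mono d).
Proof.
apply: (@Hfield_finite _ 1 (absz d)) => // [i|i hi]; first exact: pabs_mono.
rewrite /mono; case: eqP => // e; lia.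
Qed.

Lemma lmulC f g : Hfield abs f -> Hfield abs g -> lmul abs f g = lmul abs g f.
Proof.
move=> hf hg; apply: funext => n; rewrite !lmulE -(zsum_opp (c0_lmul n hf hg)).
rewrite -(zsum_shift (- n) (c0_opp (c0_lmul n hf hg))).
congr zsum; apply: funext => i; rewrite mulrC; congr (_ * _).
  by congr g; ring.
by congr f; ring.
Qed.

Lemma lmul_mono d f : lmul abs (mono d) f = fun n => f (n - d).
Proof.
apply: funext => n; rewrite lmulE (zsum1 (k := d)) /mono ?eqxx ?mul1r // => j /negbTE ->.
exact: mul0r.
Qed.

Lemma lmulDl f g h : Hfield abs f -> Hfield abs g -> Hfield abs h ->
  lmul abs (f + g) h = lmul abs f h + lmul abs g h.
Proof.
move=> hf hg hh; apply: funext => n.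
rewrite [RHS](_ : _ = (lmul abs f h n + lmul abs g h n)) // !lmulE -zsumD; try exact: c0_lmul.
by congr zsum; apply: funext => i; exact: mulrDl.
Qed.

Lemma lmulA f g h : Hfield abs f -> Hfield abs g -> Hfield abs h ->
  lmul abs f (lmul abs g h) = lmul abs (lmul abs f g) h.
Proof.
move=> hf hg hh; apply: funext => n; rewrite !lmulE.
(* The indices [i], [m - i], [n - m] add up to [n], so outside a bounded set of pairs one of them is
   large and its factor is small. *)
pose w (m i : int) : K := (f i : K) * (g (m - i) : K) * (h (n - m) : K).
have hw : c0_family2 w.
  move: hf hg hh => /HfieldP[[C C0 hC] hf] /HfieldP[[D D0 hD] hg] /HfieldP[[E E0 hE] hh].
  move=> e e0.
  have [N hN] := hf _ (divr_gt0 e0 (mulr_gt0 D0 E0)).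
  have [M hM] := hg _ (divr_gt0 e0 (mulr_gt0 C0 E0)).
  have [L hL] := hh _ (divr_gt0 e0 (mulr_gt0 C0 D0)).
  exists (N + M + L + absz n)%N => m i hmi; rewrite /w.
  have [iN|iN] := ltP N%:Z i.
    have -> : e = e / (D * E) * D * E by field; rewrite !gt_eqF.
    exact: pabs_mul_le (pabs_mul_le (hN _ iN) (hD _)) (hE _).
  have [iM|iM] := ltP M%:Z (m - i).
    have -> : e = C * (e / (C * E)) * E by field; rewrite !gt_eqF.
    exact: pabs_mul_le (pabs_mul_le (hC _) (hM _ iM)) (hE _).
  have -> : e = C * D * (e / (C * D)) by field; rewrite !gt_eqF.
  apply: pabs_mul_le (pabs_mul_le (hC _) (hD _)) (hL _ _).
  lia.
transitivity (zsum abs (fun i => zsum abs (fun m => w m i))); last first.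
  rewrite -(exchange_zsum hw); congr zsum; apply: funext => m.
  rewrite /w lmulE mulrC -zsumZ; last exact: c0_lmul.
  by congr zsum; apply: funext => i; rewrite mulrC.
congr zsum; apply: funext => i; rewrite lmulE -zsumZ; last exact: c0_lmul.
rewrite -(zsum_shift (- i)); last exact/c0_familyZ/c0_lmul.
congr zsum; apply: funext => m; rewrite /w !mulrA; congr (_ * _ * _).
by congr h; ring.
Qed.

End Hring.

(** H as a type rather than a set, so that it carries a commutative ring structure and [ring] and
    big operators apply. *)
Record hring (R : realType) (p : nat) (K : pvField R p) :=
  HRing { hval :> biseries K; hvalP : Hfield (@pabs R p K) hval }.

Section HringType.
Context {R : realType} {p : nat} {K : pvField R p}.
Local Notation abs := (@pabs R p K).
Local Notation H := (hring K).
Implicit Types (x y z : H).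

Lemma hval_inj : injective (@hval R p K).
Proof. by move=> [f hf] [g hg] /= e; subst g; congr HRing; exact: Prop_irrelevance. Qed.

Lemma hringP x y : (forall i, x i = y i) -> x = y.
Proof. by move=> h; apply/hval_inj/funext. Qed.

HB.instance Definition _ := gen_eqMixin H.
HB.instance Definition _ := gen_choiceMixin H.

Definition hadd x y : H := HRing (HfieldD (hvalP x) (hvalP y)).
Definition hopp x : H := HRing (HfieldN (hvalP x)).
Definition hzero : H := HRing Hfield0.

Fact haddA : associative hadd. Proof. by move=> x y z; apply/hval_inj/addrA. Qed.
Fact haddC : commutative hadd. Proof. by move=> x y; apply/hval_inj/addrC. Qed.
Fact hadd0 : left_id hzero hadd. Proof. by move=> x; apply/hval_inj/add0r. Qed.
Fact haddN : left_inverse hzero hopp hadd.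
Proof. by move=> x; apply/hval_inj/addNr. Qed.
HB.instance Definition _ := GRing.isZmodule.Build H haddA haddC hadd0 haddN.

(* Opaque, to keep unification from unfolding products of elements of H. *)
Fact hmul_subproof : {m : H -> H -> H | forall x y, hval (m x y) = lmul abs x y}.
Proof. by exists (fun x y => HRing (Hfield_lmul (hvalP x) (hvalP y))). Qed.
Definition hmul : H -> H -> H := sval hmul_subproof.
Fact hval_hmul x y : hval (hmul x y) = lmul abs x y.
Proof. exact: svalP hmul_subproof x y. Qed.
Definition hmono (d : int) : H := HRing (Hfield_mono d).

Fact hmulA : associative hmul.
Proof. by move=> x y z; apply/hval_inj; rewrite !hval_hmul; exact: lmulA (hvalP x) (hvalP y) (hvalP z). Qed.
Fact hmulC : commutative hmul.
Proof. by move=> x y; apply/hval_inj; rewrite !hval_hmul; exact: lmulC (hvalP x) (hvalP y). Qed.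
Fact hmul1 : left_id (hmono 0) hmul.
Proof.
by move=> x; apply/hringP => i; rewrite hval_hmul (@lmul_mono R p K) subr0.
Qed.
Fact hmulDl : left_distributive hmul (fun x y => x + y).
Proof. by move=> x y z; apply/hval_inj; rewrite -[RHS]/(hval (hmul x z) + hval (hmul y z)) !hval_hmul; exact: lmulDl (hvalP x) (hvalP y) (hvalP z). Qed.
Fact hone_neq0 : hmono 0 != 0 :> H.
Proof.
apply/eqP => /(congr1 (fun x : H => x 0)) /= /eqP.
by rewrite /mono eqxx (negbTE (oner_neq0 K)).
Qed.
HB.instance Definition _ :=
  GRing.Zmodule_isComNzRing.Build H hmulA hmulC hmul1 hmulDl hone_neq0.

Lemma hvalM x y : hval (x * y) = lmul abs (hval x) (hval y). Proof. exact: hval_hmul. Qed.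
Lemma hval1 : hval (1 : H) = mono 0. Proof. by []. Qed.
Lemma hcoef0 i : (0 : H) i = 0. Proof. by []. Qed.
Lemma hcoef1 i : (1 : H) i = (i == 0)%:R. Proof. by []. Qed.
Lemma hcoefD x y i : (x + y) i = x i + y i. Proof. by []. Qed.
Lemma hcoefN x i : (- x) i = - x i. Proof. by []. Qed.
Lemma hcoefB x y i : (x - y) i = x i - y i. Proof. by []. Qed.
Lemma hcoefM x y n : (x * y) n = zsum abs (fun i => (x i : K) * (y (n - i) : K)).
Proof. by rewrite hvalM. Qed.
Lemma hcoef_sum (I : Type) (r : seq I) (P : pred I) (F : I -> H) i :
  (\sum_(j <- r | P j) F j) i = \sum_(j <- r | P j) F j i.
Proof. by elim/big_rec2: _ => // j y z _ <-. Qed.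
Lemma hcoef_mono d i : hmono d i = (i == d)%:R. Proof. by []. Qed.

Lemma hval_lpow x m : hval (x ^+ m) = lpow abs (hval x) m.
Proof. by elim: m => // m IH; rewrite exprS hvalM IH. Qed.

Lemma hval_prod (n : nat) (F : 'I_n -> H) :
  hval (\prod_(i < n) F i) = \big[lmul abs/mono 0]_(i < n) hval (F i).
Proof. exact: (big_morph _ hvalM hval1). Qed.

Fact Hfield_cst (c : K) : Hfield abs (c *: mono 0 : biseries K).
Proof.
apply: (@Hfield_finite _ _ _ _ (Num.max (abs c) 1) 0); first by rewrite lt_max ltr01 orbT.
  by move=> i; rewrite le_max [X in X || _](_ : _ = true) // -[X in _ <= X]mulr1; apply: pabs_mul_le (pabs_mono _ _).
by move=> i i0; rewrite [LHS](_ : _ = c * (i == 0)%:R) // gt_eqF // mulr0.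
Qed.
Definition hcst (c : K) : H := HRing (Hfield_cst c).

Lemma hcoef_cst c i : hcst c i = if i == 0 then c else 0.
Proof. by rewrite [LHS](_ : _ = c * (i == 0)%:R) //; case: eqP; rewrite ?mulr1 ?mulr0. Qed.

Lemma hcoef_cstM c x i : (hcst c * x) i = c * x i.
Proof.
rewrite hcoefM (zsum1 (k := 0)) ?hcoef_cst ?eqxx ?subr0 // => j /negbTE j0.
by rewrite hcoef_cst j0 mul0r.
Qed.

Fact hcst_additive : {morph hcst : c d / c - d}.
Proof. by move=> c d; apply/hringP => i; rewrite hcoefB !hcoef_cst; case: eqP; rewrite ?subr0. Qed.
Fact hcst_multiplicative : monoid_morphism hcst.
Proof.
split=> [|c d]; apply/hringP => i; first by rewrite hcoef_cst hcoef1; case: eqP.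
by rewrite hcoef_cstM !hcoef_cst; case: eqP; rewrite ?mulr0.
Qed.
HB.instance Definition _ := GRing.isZmodMorphism.Build K H hcst hcst_additive.
HB.instance Definition _ := GRing.isMonoidMorphism.Build K H hcst hcst_multiplicative.

(** The norm of [x] is at most [c], phrased without a supremum. *)
Definition hle x (c : R) := forall i, abs (x i) <= c.

Lemma hle_ge0 x c : hle x c -> 0 <= c.
Proof. by move=> h; exact: le_trans (pabs_ge0 _) (h 0). Qed.
Lemma hle_trans c x d : hle x c -> c <= d -> hle x d.
Proof. by move=> h cd i; exact: le_trans cd. Qed.
Lemma hle0 c : 0 <= c -> hle 0 c.
Proof. by move=> c0 i; rewrite hcoef0 pabs0. Qed.
Lemma hleD x y c : hle x c -> hle y c -> hle (x + y) c.
Proof. by move=> hx hy i; exact: pabsD_le. Qed.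
Lemma hleN x c : hle x c -> hle (- x) c.
Proof. by move=> hx i; rewrite hcoefN pabsN. Qed.
Lemma hleB x y c : hle x c -> hle y c -> hle (x - y) c.
Proof. by move=> hx hy; apply/hleD/hleN. Qed.
Lemma hleM x y c d : hle x c -> hle y d -> hle (x * y) (c * d).
Proof. by move=> hx hy i; rewrite hvalM; apply: lmul_le (hvalP x) (hvalP y) hx hy. Qed.
Lemma hle_sum (I : Type) (r : seq I) (P : pred I) (F : I -> H) c : 0 <= c ->
  (forall i, P i -> hle (F i) c) -> hle (\sum_(i <- r | P i) F i) c.
Proof. by move=> c0 h i; rewrite hcoef_sum; apply: pabs_sum_le => // j /h. Qed.
Lemma hle_cst c : hle (hcst c) (abs c).
Proof. by move=> i; rewrite hcoef_cst; case: eqP; rewrite ?pabs0 ?pabs_ge0. Qed.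
Lemma hle_mono d : hle (hmono d) 1.
Proof. exact: pabs_mono. Qed.
Lemma hle1 : hle 1 1. Proof. exact: pabs_mono. Qed.
Lemma hleX x c n : hle x c -> hle (x ^+ n) (c ^+ n).
Proof. by move=> h; elim: n => [|n IH]; [exact: hle1 | rewrite !exprS; exact: hleM]. Qed.
Lemma hle_bounded x : exists2 C, 0 < C & hle x C.
Proof. by have /HfieldP[[C C0 hC] _] := hvalP x; exists C. Qed.

Definition hcvg (u : nat -> H) (x : H) := forall e : R, 0 < e ->
  exists N : nat, forall n, (N <= n)%N -> hle (u n - x) e.

Lemma hcvg_coef u x i : hcvg u x -> abs_cvg abs (fun n => u n i) (x i).
Proof. by move=> h; apply/abs_cvgP => e /h [N hN]; exists N => n /hN; exact. Qed.

Lemma hcvg_unique u x y : hcvg u x -> hcvg u y -> x = y.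
Proof.
by move=> hx hy; apply/hringP => i; exact: abs_cvg_unique (hcvg_coef i hx) (hcvg_coef i hy).
Qed.

Lemma hcvg_ext u v x : u =1 v -> hcvg u x -> hcvg v x.
Proof. by move=> h hu e /hu[N hN]; exists N => n; rewrite -h; exact: hN. Qed.

Lemma hcvg_cst x : hcvg (fun=> x) x.
Proof. by move=> e e0; exists 0%N => n _; rewrite subrr; apply: hle0; exact: ltW. Qed.

Lemma hcvgD u v x y : hcvg u x -> hcvg v y -> hcvg (fun n => u n + v n) (x + y).
Proof.
move=> hx hy e e0; have [N hN] := hx e e0; have [M hM] := hy e e0.
exists (N + M)%N => n hn; rewrite opprD addrACA.
by apply: hleD; [apply: hN | apply: hM]; lia.
Qed.

Lemma hcvg_cstM (u : nat -> K) l x : abs_cvg abs u l ->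
  hcvg (fun n => hcst (u n) * x) (hcst l * x).
Proof.
move=> /abs_cvgP hu e e0; have [C C0 hC] := hle_bounded x.
have [N hN] := hu _ (divr_gt0 e0 C0); exists N => n /hN h.
rewrite -mulrBl -rmorphB -[e](divfK (lt0r_neq0 C0)).
exact: hleM (hle_trans (hle_cst _) h) hC.
Qed.

Lemma hcvg_sum (I : Type) (r : seq I) (u : I -> nat -> H) (x : I -> H) :
  (forall i, hcvg (u i) (x i)) ->
  hcvg (fun n => \sum_(i <- r) u i n) (\sum_(i <- r) x i).
Proof.
move=> h; elim: r => [|i r IH].
  by rewrite big_nil; apply: (hcvg_ext _ (hcvg_cst 0)) => n; rewrite big_nil.
by rewrite big_cons; apply: (hcvg_ext _ (hcvgD (h i) IH)) => n; rewrite big_cons.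
Qed.

Lemma hcvgM u v x y : hcvg u x -> hcvg v y -> hcvg (fun n => u n * v n) (x * y).
Proof.
move=> hx hy e e0; have [C C0 hC] := hle_bounded x; have [D D0 hD] := hle_bounded y.
have h1 : 0 < Num.min (e / C) 1 by rewrite lt_min divr_gt0 ?ltr01.
have h2 : 0 < e / Num.max D 1 by rewrite divr_gt0 // lt_max ltr01 orbT.
have [N hN] := hx _ h2; have [M hM] := hy _ h1.
exists (N + M)%N => n hn.
have -> : u n * v n - x * y = (u n - x) * (v n - y + y) + x * (v n - y) by ring.
have D1 : Num.max D 1 != 0 by rewrite gt_eqF // lt_max ltr01 orbT.
apply: hleD.
  rewrite -[e](divfK D1); apply: hleM; first by apply: hN; lia.
  apply: hleD; last by apply: hle_trans hD _; rewrite le_max lexx.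
  apply: (@hle_trans (Num.min (e / C) 1)); first by apply: hM; lia.
  by rewrite ge_min !le_max lexx !orbT.
apply: (@hle_trans (C * (e / C))); last by rewrite mulrC divfK ?gt_eqF.
apply: hleM => //; apply: (@hle_trans (Num.min (e / C) 1)); first by apply: hM; lia.
by rewrite ge_min lexx.
Qed.

Lemma hle_lim u x c : hcvg u x -> 0 <= c ->
  (exists N : nat, forall n, (N <= n)%N -> hle (u n) c) -> hle x c.
Proof.
move=> hx c0 [N hN] i; apply: (abs_cvg_le (hcvg_coef i hx)) => //.
by exists N => n /hN.
Qed.

(** Completeness of H: limits exist coefficientwise, and since the bounds are uniform in the index,
    the limit lies in H and is a limit in norm. *)
Lemma hcvg_step u :
  (forall e : R, 0 < e ->
     exists N : nat, forall n, (N <= n)%N -> hle (u n.+1 - u n) e) ->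
  exists x, hcvg u x.
Proof.
move=> hu; pose f : biseries K := fun i => abs_lim abs (fun n => u n i).
have hi i : abs_cvg abs (fun n => u n i) (f i).
  by apply: abs_cvg_step => e /hu [N hN]; exists N => n /hN; exact.
have near e : 0 < e -> exists N : nat, forall n, (N <= n)%N -> forall i,
    abs (u n i - f i) <= e.
  move=> e0; have [N hN] := hu e e0; exists N => n Nn i.
  rewrite pabs_subC.
  have hc : abs_cvg abs (fun m => u m i - u n i) (f i - u n i).
    apply/abs_cvgP => e1 e10; have [M hM] := (abs_cvgP _ _).1 (hi i) e1 e10.
    by exists M => m /hM; congr (abs _ <= _); ring.
  apply: (abs_cvg_le hc (ltW e0)); exists n => m nm.
  apply: (@pabs_step_le _ _ _ (fun m => u m i) n) => // [|k nk]; first exact: ltW.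
  by apply: hN; exact: leq_trans nk.
have hf : Hfield abs f.
  apply/HfieldP; split.
    have [N hN] := near 1 ltr01; have [C C0 hC] := hle_bounded (u N).
    exists (Num.max C 1) => [|i]; first by rewrite lt_max C0.
    have -> : f i = u N i - (u N i - f i) by ring.
    by apply: pabsB_le; rewrite le_max ?hC ?hN ?orbT.
  move=> e e0; have [N hN] := near e e0; have /HfieldP[_ hu'] := hvalP (u N).
  have [M hM] := hu' e e0; exists M => i Mi.
  have -> : f i = u N i - (u N i - f i) by ring.
  by apply: pabsB_le; rewrite ?hM ?hN.
exists (HRing hf) => e /near [N hN]; exists N => n Nn i; exact: hN.
Qed.

Lemma hcvg_series (t : nat -> H) :
  (forall e : R, 0 < e -> exists N : nat, forall n, (N <= n)%N -> hle (t n) e) ->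
  exists x, hcvg (fun N => \sum_(k < N) t k) x.
Proof.
move=> ht; apply: hcvg_step => e /ht [N hN]; exists N => n /hN.
by rewrite big_ord_recr /= addrAC subrr add0r.
Qed.

End HringType.

(** * Formal exponentials and the Artin-Hasse series *)

Section Triangle.
Context {S : comNzRingType}.

Lemma sum_triangle (t : nat -> nat -> S) N :
  \sum_(k < N) \sum_(i < k.+1) t (k - i)%N i = \sum_(i < N) \sum_(j < N - i) t i j.
Proof.
elim: N => [|N IH]; first by rewrite !big_ord0.
rewrite big_ord_recr /= IH [RHS]big_ord_recr /= subSnn.
rewrite [X in _ = _ + X]big_ord_recl big_ord0 addr0.
under [in RHS]eq_bigr => i _ do rewrite subSn ?(ltnW (ltn_ord i)) // big_ord_recr /=.
rewrite big_split /= -addrA; congr (_ + _).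
rewrite (reindex_inj rev_ord_inj) /= big_ord_recr /= subnn subn0; congr (_ + _).
by apply: eq_bigr => i _; rewrite subSS subKn // ltnW.
Qed.

Lemma exprD_mid (x y : S) n : (x + y) ^+ n.+1 - x ^+ n.+1 - y ^+ n.+1 =
  \sum_(i < n) (x ^+ (n.+1 - i.+1) * y ^+ i.+1) *+ 'C(n.+1, i.+1).
Proof.
rewrite exprDn big_ord_recl big_ord_recr /= /bump /= !add1n.
rewrite subnn !expr0 subn0 mulr1 mul1r binn bin0 !mulr1n.
by move: (\sum_(i < n) _) => T; ring.
Qed.

Variable c : nat -> S.
Hypothesis cD : forall i j, c (i + j)%N *+ 'C(i + j, j) = c i * c j.
(** The condition [cD] is the divided power identity satisfied by c k = 1/k!. It is kept abstract so
    that one computation serves polynomials as well as H. *)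
Definition exp_trunc N x := \sum_(k < N) c k * x ^+ k.

(** Terms of total degree below [N] cancel. The remaining ones have i + j >= N and are negligible
    both formally and in norm. *)
Lemma exp_truncD N x y : exp_trunc N x * exp_trunc N y - exp_trunc N (x + y) =
  \sum_(i < N) \sum_(N - i <= j < N) (c i * x ^+ i) * (c j * y ^+ j).
Proof.
have -> : exp_trunc N (x + y) =
    \sum_(i < N) \sum_(j < N - i) (c i * x ^+ i) * (c j * y ^+ j).
  rewrite -(sum_triangle (fun i j => (c i * x ^+ i) * (c j * y ^+ j))).
  apply: eq_bigr => k _; rewrite exprDn mulr_sumr; apply: eq_bigr => i _.
  have ik : (i <= k)%N by rewrite -ltnS ltn_ord.
  rewrite mulrACA -cD subnK // mulrnAl mulrnAr //.
rewrite /exp_trunc big_distrlr /= -sumrB; apply: eq_bigr => i _.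
rewrite -!(big_mkord xpredT (fun j => (c i * x ^+ i) * (c j * y ^+ j))).
by rewrite (big_cat_nat (n := (N - i)%N)) ?leq_subr //= addrAC subrr add0r.
Qed.
End Triangle.

(** * Absolute values of integers and factorials *)

Section NatAbs.
Context {R : realType} {p : nat} {K : pvField R p}.
Local Notation abs := (@pabs R p K).
Local Notation q := (abs p%:R).

Lemma q_gt0 : 0 < q. Proof. by case/andP: (pabs_p K). Qed.
Lemma q_lt1 : q < 1. Proof. by case/andP: (pabs_p K). Qed.
Lemma q_le1 : q <= 1. Proof. exact/ltW/q_lt1. Qed.
Lemma p_gt1 : (1 < p)%N. Proof. exact: prime_gt1 (pv_prime K). Qed.
Lemma p_gt0 : (0 < p)%N. Proof. exact: prime_gt0 (pv_prime K). Qed.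

(** By Bezout some multiple of [m] is 1 plus a multiple of p, hence has absolute value 1, while both
    of its factors have absolute value at most 1. *)
Lemma pabs_coprime m : coprime p m -> abs m%:R = 1.
Proof.
case: (posnP m) => [->|m0]; first by rewrite /coprime gcdn0 => /eqP e; have h1 := p_gt1; lia.
move=> cpm; apply/eqP; rewrite eq_le pabs_nat_le1 /=.
have [u v e _] := egcdnP p m0; move: cpm; rewrite coprime_sym => /eqP g1.
have h : abs (u * m)%N%:R = 1.
  rewrite e g1 natrD addrC pabs_addl pabs1 // natrM.
  by apply: le_lt_trans q_lt1; apply: pabs_mul_le1 (pabs_nat_le1 _) (lexx _).
rewrite -h natrM pabsM -[X in _ <= X]mul1r ler_wpM2r ?pabs_ge0 //.
exact: pabs_nat_le1.
Qed.

Lemma pabs_nat m : (0 < m)%N -> abs m%:R = q ^+ logn p m.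
Proof.
move=> m0; have [k hk {1}->] := pfactor_coprime (pv_prime K) m0.
by rewrite natrM pabsM pabs_coprime // mul1r natrX pabsX.
Qed.

Lemma natr_neq0 m : (0 < m)%N -> m%:R != 0 :> K.
Proof. by move=> m0; rewrite -pabs_eq0 pabs_nat // expf_neq0 // gt_eqF // q_gt0. Qed.

Lemma pabs_dvd m : (p %| m)%N -> abs m%:R <= q.
Proof. by case/dvdnP=> k ->; rewrite natrM; apply: pabs_mul_le1 (pabs_nat_le1 _) (lexx _). Qed.

Lemma fact_neq0 k : k`!%:R != 0 :> K. Proof. exact/natr_neq0/fact_gt0. Qed.

Lemma invfact_mul i j :
  ((i + j)`!%:R)^-1 *+ 'C(i + j, j) = (i`!%:R)^-1 * (j`!%:R)^-1 :> K.
Proof.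
have := bin_fact (leq_addl i j); rewrite addnK => h.
apply: (mulfI (fact_neq0 (i + j))).
rewrite mulrnAr mulfV ?fact_neq0 // -[in RHS]h !natrM.
by field; rewrite !fact_neq0.
Qed.

(** Legendre's formula: (p - 1) times the sum of the floors of n / p^i for i <= k telescopes to at
    most n minus the floor of n / p^k. Strictness comes from a [k] with p^k <= n. *)
Lemma logn_fact_lt n : (0 < n)%N -> (p.-1 * logn p n`! < n)%N.
Proof.
move=> n0; rewrite logn_fact ?(pv_prime K) //.
have tel k : (p.-1 * (\sum_(1 <= i < k.+1) n %/ p ^ i) + n %/ p ^ k <= n)%N.
  elim: k => [|k IH]; first by rewrite big_geq // muln0 add0n leq_div.
  apply: leq_trans IH; rewrite big_nat_recr //= mulnDr -addnA leq_add2l.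
  have := leq_divM (n %/ p ^ k) p; rewrite -divnMA -expnSr.
  by rewrite -[X in (_ + X <= _)%N]mul1n -mulnDl addn1 prednK ?p_gt0 // mulnC.
pose K0 := trunc_log p n.
have h1 := trunc_logP p_gt1 n0; have h2 := trunc_log_ltn n p_gt1.
have hK : (K0 < n.+1)%N.
  by apply: ltnW; rewrite ltnS; apply: leq_trans (ltn_expl _ p_gt1) h1.
have -> : (\sum_(1 <= i < n.+1) n %/ p ^ i = \sum_(1 <= i < K0.+1) n %/ p ^ i)%N.
  rewrite (big_cat_nat (n := K0.+1)) //= [X in (_ + X)%N]big_nat [X in (_ + X)%N]big1 ?addn0 // => i /andP[hi _].
  rewrite divn_small //; apply: (leq_trans h2); rewrite leq_exp2l // p_gt1 //.
apply: leq_trans (tel K0).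
by rewrite -addn1 leq_add2l divn_gt0 // expn_gt0 p_gt0.
Qed.

Lemma logn_fact_le n : (p.-1 * logn p n`! <= n)%N.
Proof. by case: n => [|n]; [rewrite logn1 muln0 | exact/ltnW/logn_fact_lt]. Qed.

(** Since v_p(k!) < k, at least one factor p survives. This makes exp (c p X) congruent to 1 modulo
    p for integral c. *)
Lemma pabs_pX_fact k : (0 < k)%N -> abs (p%:R ^+ k / k`!%:R) <= q.
Proof.
move=> k0; rewrite pabsM pabsV pabsX (pabs_nat (fact_gt0 k)).
have hv : (logn p k`! < k)%N.
  apply: leq_ltn_trans (logn_fact_lt k0); rewrite leq_pmull //.
  by rewrite -subn1 subn_gt0 p_gt1.
rewrite -[in q ^+ k](subnK (ltnW hv)) exprD mulfK ?expf_neq0 ?gt_eqF ?q_gt0 //.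
by rewrite -(subnSK hv) exprS ler_piMr ?pabs_ge0 // exprn_ile1 ?pabs_ge0 ?q_le1.
Qed.

End NatAbs.

Section FormalExp.
Context {R : realType} {p : nat} {K : pvField R p}.
Local Notation abs := (@pabs R p K).
Local Notation q := (abs p%:R).
Implicit Types (f g : nat -> K) (F G : {poly K}).

Definition psmul f g (m : nat) : K := \sum_(i < m.+1) f i * g (m - i)%N.
Definition ptrunc (M : nat) f : {poly K} := \poly_(i < M.+1) f i.
Definition eqm (M : nat) F G := forall i, (i <= M)%N -> F`_i = G`_i.
Definition pexp (N : nat) F : {poly K} := exp_trunc (fun k => (k`!%:R)^-1%:P) N.+1 F.

Lemma coef_ptrunc M f i : (i <= M)%N -> (ptrunc M f)`_i = f i.
Proof. by move=> h; rewrite coef_poly ltnS h. Qed.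

Lemma eqm_mul M F F' G G' : eqm M F F' -> eqm M G G' -> eqm M (F * G) (F' * G').
Proof.
move=> hF hG i hi; rewrite !coefM; apply: eq_bigr => j _.
have ji : (j <= i)%N by rewrite -ltnS ltn_ord.
by rewrite hF ?hG ?(leq_trans ji) // (leq_trans (leq_subr _ _)).
Qed.

Lemma eqm_exp M F G k : eqm M F G -> eqm M (F ^+ k) (G ^+ k).
Proof. by move=> h; elim: k => [|k IH] //; rewrite !exprS; exact: eqm_mul. Qed.

Lemma eqm_ptrunc M N f : (M <= N)%N -> eqm M (ptrunc M f) (ptrunc N f).
Proof. by move=> MN i iM; rewrite !coef_ptrunc // (leq_trans iM). Qed.

Lemma coefX_small F k i : F`_0 = 0 -> (i < k)%N -> (F ^+ k)`_i = 0.
Proof.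
move=> F0; elim: k i => // k IH i ik; rewrite exprS coefM big1 // => j _.
case: (posnP j) => [->|j0]; first by rewrite F0 mul0r.
rewrite IH ?mulr0 //; have := ltn_ord j; lia.
Qed.

Lemma coefXM_small F G i j m : F`_0 = 0 -> G`_0 = 0 -> (m < i + j)%N ->
  (F ^+ i * G ^+ j)`_m = 0.
Proof.
move=> F0 G0 h; rewrite coefM big1 // => a _; have := ltn_ord a => am.
case: (ltnP a i) => ai; first by rewrite (coefX_small F0) // mul0r.
by rewrite (coefX_small G0) ?mulr0 //; lia.
Qed.

Lemma pexpE N F : pexp N F = \sum_(k < N.+1) (k`!%:R)^-1 *: F ^+ k.
Proof. by apply: eq_bigr => k _; rewrite mul_polyC. Qed.

(** The k-th power of a series without constant term starts in degree k, so all truncations beyond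
    [m] agree in degree [m]. Identities of formal exponentials thus reduce to polynomials. *)
Lemma ps_exp_coef f m M N : f 0%N = 0 -> (m <= M)%N -> (m <= N)%N ->
  ps_exp f m = (pexp N (ptrunc M f))`_m.
Proof.
move=> f0 mM mN; rewrite /ps_exp pexpE !coef_sum.
under eq_bigr => k _ do rewrite coefZ (eqm_exp _ (eqm_ptrunc f mM)) //.
under [RHS]eq_bigr => k _ do rewrite coefZ.
rewrite -!(big_mkord xpredT (fun k => (k`!%:R)^-1 * ((ptrunc M f) ^+ k)`_m)).
rewrite [RHS](big_cat_nat (n := m.+1)) //= [X in _ + X]big_nat [X in _ + X]big1 ?addr0 // => k.
by case/andP=> mk _; rewrite coefX_small ?mulr0 // coef_ptrunc.
Qed.

Lemma ps_exp0 f : f 0%N = 0 -> ps_exp f 0 = 1.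
Proof.
by move=> f0; rewrite /ps_exp big_ord_recl big_ord0 addr0 expr0 fact0 invr1 scale1r coefC.
Qed.

Lemma ps_expD f g : f 0%N = 0 -> g 0%N = 0 ->
  ps_exp (fun m => f m + g m) = psmul (ps_exp f) (ps_exp g).
Proof.
move=> f0 g0; apply: funext => m.
have F0 : (ptrunc m f)`_0 = 0 by rewrite coef_ptrunc.
have G0 : (ptrunc m g)`_0 = 0 by rewrite coef_ptrunc.
have -> : psmul (ps_exp f) (ps_exp g) m = (pexp m (ptrunc m f) * pexp m (ptrunc m g))`_m.
  rewrite coefM; apply: eq_bigr => i _; have im : (i <= m)%N by rewrite -ltnS ltn_ord.
  by congr (_ * _); apply: ps_exp_coef; rewrite ?leq_subr.
rewrite (@ps_exp_coef _ m m m) ?f0 ?g0 ?addr0 //.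
have -> : ptrunc m (fun m => f m + g m) = ptrunc m f + ptrunc m g.
  by apply/polyP => i; rewrite coefD !coef_poly; case: ifP; rewrite ?addr0.
apply/eqP; rewrite eq_sym -subr_eq0 -coefB exp_truncD; last first.
  by move=> i j; rewrite -polyCMn -polyCM invfact_mul.
rewrite coef_sum big1 // => i _; rewrite coef_sum big_nat big1 // => j /andP[hj _].
rewrite mulrACA -polyCM mul_polyC coefZ coefXM_small ?mulr0 //.
by move: hj; have := ltn_ord i; lia.
Qed.

Lemma ptrunc_psmul M f g : eqm M (ptrunc M (psmul f g)) (ptrunc M f * ptrunc M g).
Proof.
move=> i iM; rewrite coef_ptrunc // coefM; apply: eq_bigr => j _.
have ji : (j <= i)%N by rewrite -ltnS ltn_ord.
by rewrite !coef_ptrunc ?(leq_trans ji) // (leq_trans (leq_subr _ _)).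
Qed.

Lemma ps_exp_zero m : ps_exp (fun=> 0 : K) m = (m == 0%N)%:R.
Proof.
rewrite (@ps_exp_coef _ m m m) //.
have -> : ptrunc m (fun=> 0) = 0 by apply/polyP => i; rewrite coef_poly coef0; case: ifP.
rewrite pexpE coef_sum big_ord_recl big1 ?addr0 => [|k _]; last by rewrite expr0n scaler0 coef0.
by rewrite expr0 fact0 invr1 scale1r coef1.
Qed.

Lemma ps_exp_muln M f n : f 0%N = 0 ->
  eqm M (ptrunc M (ps_exp (fun m => n%:R * f m))) ((ptrunc M (ps_exp f)) ^+ n).
Proof.
move=> f0; elim: n => [|n IH].
  move=> i iM; rewrite coef_ptrunc // expr0 coef1 -ps_exp_zero; congr (ps_exp _ _).
  by apply: funext => m; rewrite mul0r.
have -> : (fun m => n.+1%:R * f m) = (fun m => f m + n%:R * f m).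
  by apply: funext => m; rewrite -nat1r mulrDl mul1r.
rewrite ps_expD ?f0 ?mulr0 // exprS => i iM.
rewrite ptrunc_psmul //; exact: (eqm_mul (fun _ _ => erefl) IH).
Qed.

Lemma comp_pexp N F G : pexp N F \Po G = pexp N (F \Po G).
Proof.
rewrite /pexp /exp_trunc rmorph_sum /=; apply: eq_bigr => k _.
by rewrite comp_polyM comp_polyC rmorphXn.
Qed.

Lemma coef_comp_scaleX F (a : K) i : (F \Po (a *: 'X))`_i = F`_i * a ^+ i.
Proof.
rewrite comp_polyE coef_sum; under eq_bigr => j _ do
  rewrite exprZn scalerA coefZ coefXn.
case: (ltnP i (size F)) => iF.
  rewrite (bigD1 (Ordinal iF)) //= eqxx mulr1 big1 ?addr0 // => j ji.
  have /negbTE -> : (i != j)%N by apply: contraNneq ji => e; apply/eqP/val_inj.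
  by rewrite mulr0.
rewrite nth_default // mul0r big1 // => j _.
by rewrite gtn_eqF ?mulr0 // (leq_trans (ltn_ord j)).
Qed.

Lemma ps_exp_scale f (a : K) m : f 0%N = 0 ->
  ps_exp (fun m => f m * a ^+ m) m = ps_exp f m * a ^+ m.
Proof.
move=> f0; rewrite (@ps_exp_coef _ m m m) ?f0 ?mul0r // (@ps_exp_coef f m m m) //.
rewrite -coef_comp_scaleX comp_pexp; congr (pexp _ _)`_m.
apply/polyP => i; rewrite coef_comp_scaleX !coef_poly; case: ifP => //.
by rewrite mul0r.
Qed.

Definition ps_frob f (m : nat) : K := if (p %| m)%N then f (m %/ p)%N else 0.

Lemma ps_exp_frob f m : f 0%N = 0 -> ps_exp (ps_frob f) m = ps_frob (ps_exp f) m.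
Proof.
move=> f0; have p0 := @p_gt0 _ _ K.
have fr0 : ps_frob f 0%N = 0 by rewrite /ps_frob dvdn0 div0n.
(* With the bound m p + p - 1 the truncation of f(X^p) is exactly the truncation of f in degree m
   composed with X^p. *)
rewrite (@ps_exp_coef _ m (m * p + p.-1) m) //; last by have := leq_pmulr m p0; lia.
have -> : ptrunc (m * p + p.-1) (ps_frob f) = ptrunc m f \Po 'X^p.
  apply/polyP => i; rewrite coef_comp_poly_Xn // !coef_poly /ps_frob.
  rewrite ltn_divLR // mulSn -addnS prednK // addnC.
  by case: ifP; case: ifP.
rewrite -comp_pexp coef_comp_poly_Xn // /ps_frob; case: ifP => // _.
by rewrite -ps_exp_coef // leq_div.
Qed.

Definition pint F := forall i, abs F`_i <= 1.

Lemma pintM F G : pint F -> pint G -> pint (F * G).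
Proof.
move=> hF hG i; rewrite coefM; apply: pabs_sum_le => // j _.
by rewrite -[X in _ <= X]mul1r; apply: pabs_mul_le.
Qed.

Lemma pintX F n : pint F -> pint (F ^+ n).
Proof.
move=> hF; elim: n => [|n IH]; last by rewrite exprS; exact: pintM.
by move=> i; rewrite coef1; exact: pabs_nat_le1.
Qed.

(** True when [K] is Q_p; a larger residue field or ramification breaks it. *)
Hypothesis fermat : forall x : K, abs x <= 1 -> abs (x ^+ p - x) <= q.

Lemma frobeniusD F G i : pint F -> pint G ->
  abs ((F + G) ^+ p - F ^+ p - G ^+ p)`_i <= q.
Proof.
move=> hF hG; have p0 := @p_gt0 _ _ K.
have := exprD_mid F G p.-1; rewrite prednK // => ->.
rewrite coef_sum; apply: pabs_sum_le => [|j _]; first exact: pabs_ge0.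
have hj : (0 < j.+1 < p)%N by have := ltn_ord j; lia.
rewrite coefMn -[_ *+ binomial _ _]mulr_natl -[X in _ <= X]mulr1.
apply: pabs_mul_le.
  by apply: pabs_dvd; apply: prime_dvd_bin (pv_prime K) hj.
by apply: pintM; exact: pintX.
Qed.

(** Modulo p the p-th power is additive, and [fermat] replaces the p-th power of each coefficient by
    the coefficient itself. *)
Lemma frobenius_poly (e : nat -> K) m i : (forall k, (k < m)%N -> abs (e k) <= 1) ->
  abs ((\poly_(k < m) e k) ^+ p - ((\poly_(k < m) e k) \Po 'X^p))`_i <= q.
Proof.
have p0 := @p_gt0 _ _ K.
elim: m i => [|m IH] i he.
  have -> : \poly_(k < 0) e k = 0 by apply/polyP => k; rewrite coef_poly coef0.
  rewrite comp_poly0 expr0n gtn_eqF // subr0 coef0 pabs0.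
  exact: pabs_ge0.
have he' k : (k < m)%N -> abs (e k) <= 1 by move=> km; apply: he; exact: ltnW.
have -> : \poly_(k < m.+1) e k = \poly_(k < m) e k + e m *: 'X^m.
  by rewrite !poly_def big_ord_recr.
set G := \poly_(k < m) e k.
have hG : pint G by move=> k; rewrite coef_poly; case: ifP => [/he'|] //; rewrite pabs0.
have hH : pint (e m *: 'X^m).
  move=> k; rewrite coefZ; apply: pabs_mul_le1; first exact: he.
  by rewrite coefXn; exact: pabs_nat_le1.
have -> : (G + e m *: 'X^m) ^+ p - ((G + e m *: 'X^m) \Po 'X^p) =
  ((G + e m *: 'X^m) ^+ p - G ^+ p - (e m *: 'X^m) ^+ p) +
  ((G ^+ p - (G \Po 'X^p)) + ((e m) ^+ p - e m) *: 'X^(m * p)).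
  rewrite comp_polyD linearZ /= comp_Xn_poly exprZn -!exprM [(p * m)%N]mulnC scalerBl.
  ring.
rewrite coefD; apply: pabsD_le; first exact: frobeniusD.
rewrite coefD; apply: pabsD_le; first exact: IH.
rewrite coefZ mulrC; apply: pabs_mul_le1; last exact/fermat/he.
by rewrite coefXn; exact: pabs_nat_le1.
Qed.

Lemma l_series0 : l_series p 0 = 0 :> K.
Proof. by rewrite /l_series logn0 expn0. Qed.

(** The functional equation p l(X) = l(X^p) + p X that drives Dwork's lemma. *)
Lemma l_series_frob m :
  p%:R * l_series p m = ps_frob (l_series p) m + (m == 1%N)%:R * p%:R :> K.
Proof.
have pp := pv_prime K; have p1 := @p_gt1 _ _ K; have p0 := @p_gt0 _ _ K.
rewrite /ps_frob; case: (posnP m) => [->|m0].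
  by rewrite dvdn0 div0n l_series0 mulr0 mul0r addr0.
case: ifP => [/dvdnP[k e]|pm].
  subst m; rewrite muln_gt0 in m0; case/andP: m0 => k0 _.
  rewrite mulnK // /l_series lognM // (logn_prime p pp) eqxx addn1 expnSr eqn_pmul2r //.
  have /negbTE -> : (k * p != 1)%N.
    by rewrite gtn_eqF // (leq_trans p1) // leq_pmull.
  rewrite mul0r addr0; case: ifP => _; last by rewrite mulr0.
  rewrite exprS invfM mulrA mulfV ?mul1r //; exact: natr_neq0.
have l0 : logn p m = 0%N by rewrite logn_coprime // prime_coprime // pm.
rewrite /l_series l0 expn0 expr0 add0r; case: ifP; rewrite ?mulr0 ?mul0r //.
by rewrite invr1 mulr1 mul1r.
Qed.

Lemma ps_exp_X (a : K) k : ps_exp (fun m => (m == 1%N)%:R * a) k = a ^+ k / k`!%:R.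
Proof.
(* Truncating at [k.+1] keeps the linear term also for k = 0. *)
rewrite (@ps_exp_coef _ k k.+1 k) ?mul0r //.
have -> : ptrunc k.+1 (fun m => (m == 1%N)%:R * a) = a *: 'X.
  apply/polyP => i; rewrite coefZ coefX coef_poly [_ * a]mulrC.
  by case: ifP => // /negbT; case: eqP => [-> //|_]; rewrite mulr0.
rewrite pexpE coef_sum big_ord_recr /= big1 => [|i _].
  by rewrite add0r exprZn !coefZ coefXn eqxx mulr1 mulrC.
by rewrite exprZn !coefZ coefXn gtn_eqF ?mulr0.
Qed.

(** First-order expansion: in degree m the linear term in a X^m sees only F(0), and higher powers of
    X^m start beyond degree m. *)
Lemma coef_exp_perturb (n m : nat) F (a : K) : (0 < m)%N -> (0 < n)%N ->
  ((F + a *: 'X^m) ^+ n)`_m = (F ^+ n)`_m + n%:R * a * F`_0 ^+ n.-1.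
Proof.
move=> m0; case: n => // n _; rewrite exprDn big_ord_recl /= subn0 expr0 mulr1 bin0 mulr1n.
rewrite coefD; congr (_ + _); rewrite big_ord_recl coefD coef_sum big1 => [|i _].
  rewrite addr0 /bump /= subn1 /= bin1 expr1 -scalerAr coefMn coefZ coefMXn ltnn subnn.
  by rewrite -!horner_coef0 horner_exp -[LHS]mulr_natl mulrA.
rewrite coefMn exprZn -scalerAr coefZ -exprM coefMXn.
rewrite ifT ?mulr0 ?mul0rn // /bump /=.
by rewrite -[X in (X < _)%N]muln1 ltn_pmul2l.
Qed.

(* Dwork's lemma for [E = exp (c l)]: [E(X)^p = E(X^p) exp (c p X)], where       *)
(* [exp (c p X)] is 1 modulo p, and [E(X^p)] is [E(X)^p] modulo p up to degree  *)
(* m as soon as E is integral below degree m.                                   *)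
Lemma artin_hasse_integral (c : K) m : abs c <= 1 ->
  abs (ps_exp (fun m => c * l_series p m) m) <= 1.
Proof.
move=> c1; have p0 := @p_gt0 _ _ K.
set L := fun m => c * l_series p m; set e := ps_exp L.
have L0 : L 0%N = 0 by rewrite /L l_series0 mulr0.
have e0 : e 0%N = 1 by rewrite /e ps_exp0.
(* The exponential of p L(X) = L(X^p) + p c X, read modulo X^(M+1). *)
have key M : eqm M ((ptrunc M e) ^+ p)
    (ptrunc M (ps_frob e) * ptrunc M (fun k => (p%:R * c) ^+ k / k`!%:R)).
  move=> i iM; rewrite -ps_exp_muln //.
  have -> : (fun m => p%:R * L m) = (fun m => ps_frob L m + (m == 1%N)%:R * (p%:R * c)).
    apply: funext => k; rewrite /L mulrCA l_series_frob mulrDr /ps_frob.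
    by case: ifP => _; ring.
  rewrite ps_expD; last by rewrite mul0r.
    rewrite ptrunc_psmul //; congr ((polyseq (_ * _))`_i).
      by congr ptrunc; apply: funext => k; rewrite ps_exp_frob.
    by congr ptrunc; apply: funext => k; rewrite ps_exp_X.
  by rewrite /ps_frob dvdn0 div0n.
elim/ltn_ind: m => m IH; case: (posnP m) => [->|m0]; first by rewrite e0 pabs1.
have := key m m (leqnn m).
have -> : ptrunc m e = \poly_(k < m) e k + e m *: 'X^m.
  by rewrite /ptrunc !poly_def big_ord_recr.
rewrite coef_exp_perturb // coef_poly m0 e0 expr1n mulr1 coefM big_ord_recr /= subnn.
rewrite !coef_ptrunc // expr0 fact0 divr1 mulr1.
set T := \sum_(_ < _) _; set G := \poly_(k < m) e k => hm.
have hT : abs T <= q.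
  apply: pabs_sum_le => [|i _]; first exact: pabs_ge0.
  have im := ltn_ord i; rewrite !coef_ptrunc ?leq_subr ?(ltnW im) //.
  apply: pabs_mul_le1.
    rewrite /ps_frob; case: ifP => _; last by rewrite pabs0.
    by apply: IH; apply: leq_ltn_trans (leq_div _ _) im.
  rewrite exprMn mulrAC mulrC; apply: pabs_mul_le1; first exact: pabs_X_le1.
  by apply: pabs_pX_fact; rewrite subn_gt0.
have hG : abs ((G ^+ p)`_m - ps_frob e m) <= q.
  have := @frobenius_poly e m m IH; rewrite coefB coef_comp_poly_Xn // -/G.
  congr (abs (_ - _) <= _); rewrite /ps_frob; case: ifP => // _.
  by rewrite coef_poly ltn_Pdiv // (@p_gt1 _ _ K).
(* In degree m, [key] reads (G^p)_m + p e_m = T + (E(X^p))_m. Both T and the difference of G^p and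
   E(X^p) in degree m are divisible by p, hence so is p e_m, which means that e_m is integral. *)
have : abs (p%:R * e m) <= q.
  have -> : p%:R * e m = T - ((G ^+ p)`_m - ps_frob e m).
    by rewrite -[p%:R * e m](addKr ((G ^+ p)`_m)) hm; ring.
  exact: pabsB_le.
by rewrite pabsM -[X in _ <= X]mulr1 ler_pM2l // q_gt0.
Qed.

End FormalExp.

(** * The exponential on H *)

Section Hsubst.
Context {R : realType} {p : nat} {K : pvField R p}.
Local Notation abs := (@pabs R p K).
Local Notation q := (abs p%:R).
Local Notation H := (hring K).
Implicit Types (f g : nat -> K) (x y : H).

Lemma q_expr_small (e : R) : 0 < e ->
  exists N : nat, forall n, (N <= n)%N -> q ^+ n <= e.
Proof. by apply: expr_small; rewrite pabs_ge0 q_lt1. Qed.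

Definition c0_seq f := (exists2 C : R, 0 < C & forall m, abs (f m) <= C) /\
  forall e : R, 0 < e -> exists N : nat, forall m, (N <= m)%N -> abs (f m) <= e.

Lemma ps_subst_in f d a : (0 < d)%N -> ps_subst f d (d * a)%N%:Z = f a.
Proof. by move=> d0; rewrite /ps_subst dvdn_mulr // mulKn. Qed.

Lemma ps_subst_out f d i : (forall a : nat, i != (d * a)%N%:Z) -> ps_subst f d i = 0.
Proof.
case: i => // m h; rewrite /ps_subst; case: ifP => // /dvdnP[a e].
by have := h a; rewrite e mulnC eqxx.
Qed.

Lemma int_multP (d : nat) (i : int) :
  (exists a : nat, i = (d * a)%N%:Z) \/ (forall a : nat, i != (d * a)%N%:Z).
Proof.
have [h|h] := pselect (exists a : nat, i = (d * a)%N%:Z); [by left|right=> a].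
by apply/eqP => e; apply: h; exists a.
Qed.

Lemma Hfield_subst f d : (0 < d)%N -> c0_seq f -> Hfield abs (ps_subst f d).
Proof.
move=> d0 [[C C0 hC] h0]; apply/HfieldP; split.
  exists C => // i; have [[a ->]|h] := int_multP d i; first by rewrite ps_subst_in.
  by rewrite ps_subst_out // pabs0 ltW.
move=> e e0; have [N hN] := h0 e e0; exists (d * N)%N => i hi.
have [[a ia]|h] := int_multP d i; last by rewrite ps_subst_out // pabs0 ltW.
rewrite ia ps_subst_in //; apply: hN; move: hi; rewrite ia ltz_nat ltn_pmul2l //.
exact: ltnW.
Qed.

Lemma lmul_subst f g d : (0 < d)%N ->
  Hfield abs (ps_subst f d) -> Hfield abs (ps_subst g d) ->
  lmul abs (ps_subst f d) (ps_subst g d) = ps_subst (psmul f g) d.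
Proof.
move=> d0 hf hg; apply: funext => n; rewrite lmulE.
have [[m nm]|hn] := int_multP d n; last first.
  rewrite [RHS]ps_subst_out // (zsum1 (k := 0)) => [|j _].
    have [[b hb]|h] := int_multP d (n - 0).
      by have := hn b; rewrite -hb subr0 eqxx.
    by rewrite [X in _ * X]ps_subst_out // mulr0.
  have [[a ja]|h] := int_multP d j; last by rewrite ps_subst_out // mul0r.
  have [[b hb]|h] := int_multP d (n - j); last by rewrite [X in _ * X]ps_subst_out // mulr0.
  have := hn (a + b)%N; rewrite mulnDr PoszD -ja -hb addrC subrK eqxx //.
rewrite nm ps_subst_in //.
have [_ /= E] := zsum_sum_delta (index_enum 'I_m.+1) (fun i => f i * g (m - i)%N)
  (fun i => (d * i)%N%:Z).
rewrite /psmul -E; congr zsum; apply: funext => j.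
have [[a ja]|h] := int_multP d j; last first.
  rewrite ps_subst_out // mul0r big1 // => i _.
  by rewrite (negbTE (h i)).
rewrite ja ps_subst_in //.
have dd (i b : nat) : ((d * i)%N%:Z == (d * b)%N%:Z) = (i == b).
  by rewrite eqz_nat eqn_pmul2l.
have [am|am] := leqP a m.
  rewrite -ltnS in am; rewrite (bigD1 (Ordinal am)) //= eqxx big1 ?addr0 => [|i ia].
    by rewrite subzn ?leq_pmul2l // -mulnBr ps_subst_in.
  by rewrite dd; case: eqP => // e; case/eqP: ia; apply/val_inj.
rewrite big1 => [|i _]; last first.
  by rewrite dd gtn_eqF // (leq_trans (ltn_ord i)).
rewrite [X in _ * X]ps_subst_out ?mulr0 // => b.
by apply/eqP => e; have : (d * m < d * a)%N by [rewrite ltn_pmul2l]; lia.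
Qed.

Lemma hval_substX x f d k : (0 < d)%N -> hval x = ps_subst f d ->
  hval (x ^+ k) = ps_subst (fun m => ((ptrunc m f) ^+ k)`_m) d.
Proof.
move=> d0 hx; elim: k => [|k IH].
  rewrite hval1; apply: funext => i; rewrite /mono.
  have [[a ->]|h] := int_multP d i.
    by rewrite ps_subst_in // expr0 coef1 eqz_nat muln_eq0 (gtn_eqF d0).
  by rewrite ps_subst_out //; have := h 0%N; rewrite muln0 => /negbTE ->.
rewrite exprS hvalM IH hx lmul_subst //.
- congr ps_subst; apply: funext => m; rewrite exprS coefM; apply: eq_bigr => i _.
  rewrite coef_ptrunc ?(leq_ord i) //; congr (_ * _).
  by apply: (eqm_exp (M := (m - i)%N)) => //; exact: eqm_ptrunc (leq_subr _ _).
- by rewrite -hx; exact: hvalP.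
- by rewrite -IH; exact: hvalP.
Qed.

End Hsubst.

Section Hexp.
Context {R : realType} {p : nat} {K : pvField R p}.
Local Notation abs := (@pabs R p K).
Local Notation q := (abs p%:R).
Local Notation H := (hring K).
Implicit Types (f g : nat -> K) (x y : H).

(* [|p|] times the radius of convergence [|p|^(1/(p-1))] of exp. *)
Definition exp_rad : R := q `^ (p%:R / p.-1%:R).

Let p1_gt0 : (0 < p.-1)%N.
Proof. by have := @p_gt1 _ _ K; rewrite -subn1 subn_gt0. Qed.

Lemma exp_rad_ge0 : 0 <= exp_rad. Proof. exact: powR_ge0. Qed.

Lemma exp_radX : exp_rad ^+ p.-1 = q ^+ p.
Proof.
rewrite -powR_mulrn ?exp_rad_ge0 // /exp_rad -powRrM divfK ?powR_mulrn ?pabs_ge0 //.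
by rewrite pnatr_eq0 -lt0n.
Qed.

(** Raising to the power p - 1 clears the fractional exponent of [exp_rad]. *)
Lemma le_exp_rad c : (abs c <= exp_rad) = (abs c ^+ p.-1 <= q ^+ p).
Proof. by rewrite -exp_radX ler_pXn2r // nnegrE ?pabs_ge0 // exp_rad_ge0. Qed.

Definition hsmall x := hle x exp_rad.

Lemma hsmallN x : hsmall x -> hsmall (- x). Proof. exact: hleN. Qed.
Lemma hsmallD x y : hsmall x -> hsmall y -> hsmall (x + y). Proof. exact: hleD. Qed.

Definition inv_fact k : H := hcst (k`!%:R)^-1.

Lemma inv_factM i j : inv_fact (i + j) *+ 'C(i + j, j) = inv_fact i * inv_fact j.
Proof. by rewrite -rmorphMn invfact_mul rmorphM. Qed.

(** By Legendre the division by k! costs at most |p|^(1/(p-1)) per factor of x^k, and [exp_rad]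
    leaves a further |p| per factor. *)
Lemma exp_term_le x k : hsmall x -> hle (inv_fact k * x ^+ k) (q ^+ k).
Proof.
move=> hx; apply: hle_trans (hleM (hle_cst _) (hleX k hx)) _.
rewrite pabsV (pabs_nat (fact_gt0 k)).
have q0 : 0 < q by exact: q_gt0.
rewrite -(ler_pXn2r p1_gt0) ?nnegrE ?exprn_ge0 ?mulr_ge0 ?invr_ge0 ?exprn_ge0 ?exp_rad_ge0 ?(ltW q0) //.
rewrite exprMn -[exp_rad ^+ k ^+ _]exprM [(k * _)%N]mulnC exprM exp_radX exprVn.
rewrite ler_pdivrMl ?exprn_gt0 // -!exprM -exprD.
apply: ler_wiXn2l; rewrite ?(ltW q0) ?q_le1 //.
have := logn_fact_le (K := K) k; have := @p_gt0 _ _ K.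
by move=> p0; rewrite [(logn _ _ * _)%N]mulnC -[X in _ -> (_ <= X * _)%N](prednK p0) mulSn [(k * _)%N]mulnC leq_add2r.
Qed.

Lemma hexp_ex x : hsmall x -> exists y, hcvg (fun N => exp_trunc inv_fact N x) y.
Proof.
move=> hx; apply: (hcvg_series (t := fun k => inv_fact k * x ^+ k)) => e e0; have [N hN] := q_expr_small (K := K) e0.
by exists N => n /hN; apply: hle_trans; exact: exp_term_le.
Qed.

(** Outside the elements of norm at most [exp_rad] the value is unspecified; [hexpP] is the only
    access to it. *)
Fact hexp_subproof :
  {f : H -> H | forall x, hsmall x -> hcvg (fun N => exp_trunc inv_fact N x) (f x)}.
Proof.
exists (fun x => xget 0 [set y | hcvg (fun N => exp_trunc inv_fact N x) y]).
by move=> x /hexp_ex h; exact: (xgetPex 0 h).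
Qed.
Definition hexp : H -> H := sval hexp_subproof.

Lemma hexpP x : hsmall x -> hcvg (fun N => exp_trunc inv_fact N x) (hexp x).
Proof. exact: svalP hexp_subproof x. Qed.

Lemma hexpD x y : hsmall x -> hsmall y -> hexp (x + y) = hexp x * hexp y.
Proof.
move=> hx hy; apply/esym/(hcvg_unique (hcvgM (hexpP hx) (hexpP hy))).
move=> e e0; have [N hN] := hexpP (hsmallD hx hy) e0.
have [M hM] := q_expr_small (K := K) e0.
exists (N + M)%N => n hn; pose S := exp_trunc inv_fact n (x + y).
rewrite -[X in hle X]/(_ * _ - _).
have -> : exp_trunc inv_fact n x * exp_trunc inv_fact n y - hexp (x + y) =
  (exp_trunc inv_fact n x * exp_trunc inv_fact n y - S) + (S - hexp (x + y)) by ring.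
apply: hleD; last by apply: hN; lia.
rewrite exp_truncD; last exact: inv_factM.
apply: hle_sum => [|i _]; first exact: ltW.
rewrite big_nat; apply: hle_sum => [|j /andP[hj _]]; first exact: ltW.
apply: hle_trans (hleM (exp_term_le i hx) (exp_term_le j hy)) _.
by rewrite -exprD; apply: hM; have := ltn_ord i; lia.
Qed.

Lemma hsmall0 : hsmall 0. Proof. exact/hle0/exp_rad_ge0. Qed.

Lemma hexp0 : hexp 0 = 1.
Proof.
apply: (hcvg_unique (hexpP hsmall0)) => e e0; exists 1%N => -[//|n] _.
rewrite /exp_trunc big_ord_recl /= expr0 big1 => [|i _]; last by rewrite expr0n mulr0.
rewrite addr0 mulr1 /inv_fact fact0 invr1 rmorph1 subrr; exact/hle0/ltW.
Qed.

Lemma hexp_sum (I : Type) (r : seq I) (F : I -> H) : (forall i, hsmall (F i)) ->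
  hexp (\sum_(i <- r) F i) = \prod_(i <- r) hexp (F i).
Proof.
move=> h; elim: r => [|i r IH]; first by rewrite !big_nil hexp0.
rewrite !big_cons hexpD ?IH //; apply: hle_sum => [|j _]; [exact: exp_rad_ge0 | exact: h].
Qed.

Lemma hexpNM x : hsmall x -> hexp x * hexp (- x) = 1.
Proof. by move=> hx; rewrite -hexpD ?subrr ?hexp0 //; exact: hsmallN. Qed.

Lemma hexp_le1 x : hsmall x -> hle (hexp x) 1.
Proof.
move=> hx; apply: (hle_lim (hexpP hx)) => //; exists 0%N => n _.
apply: hle_sum => // k _; apply: hle_trans (exp_term_le k hx) _.
by rewrite exprn_ile1 ?pabs_ge0 ?q_le1.
Qed.

(** In each degree the truncated exponentials are eventually constant, equal to the formal
    coefficient, while norm convergence forces them to the coefficient of [hexp x]. *)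
Lemma hexp_subst x f d : (0 < d)%N -> f 0%N = 0 -> hval x = ps_subst f d -> hsmall x ->
  hval (hexp x) = ps_subst (ps_exp f) d.
Proof.
move=> d0 f0 hx sx; apply: funext => i.
apply: (abs_cvg_unique (hcvg_coef i (hexpP sx))); apply/abs_cvgP => e e0.
have coefE N : exp_trunc inv_fact N x i =
    \sum_(k < N) (k`!%:R)^-1 * ps_subst (fun m => ((ptrunc m f) ^+ k)`_m) d i.
  rewrite hcoef_sum; apply: eq_bigr => k _; rewrite hcoef_cstM.
  by congr (_ * _); rewrite -(hval_substX k d0 hx).
have [[a ia]|h] := int_multP d i; last first.
  exists 0%N => n _; rewrite coefE ps_subst_out // subr0 big1 ?pabs0 ?ltW // => k _.
  by rewrite ps_subst_out // mulr0.
exists a.+1 => -[//|n] an; rewrite coefE ia.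
under eq_bigr => k _ do rewrite ps_subst_in //.
rewrite ps_subst_in // (@ps_exp_coef _ _ _ f a a n) // pexpE coef_sum.
under [X in _ - X]eq_bigr => k _ do rewrite coefZ.
by rewrite subrr pabs0 ltW.
Qed.

End Hexp.

(** * The standard basis and the closure of A *)

Section StandardBasis.
Context {R : realType} {p : nat} {K : pvField R p}.
Local Notation abs := (@pabs R p K).
Local Notation H := (hring K).
Implicit Types (x y a : H).

Lemma fct_sumE (I : Type) (r : seq I) (P : pred I) (F : I -> biseries K) j :
  (\sum_(i <- r | P i) F i) j = \sum_(i <- r | P i) F i j.
Proof. by elim/big_rec2: _ => // i y z _ <-. Qed.

Lemma hle_hnorm x : hle x (hnorm abs (hval x)).
Proof.
move=> i; apply: ub_le_sup; last by exists i.
by have [C _ hC] := hle_bounded x; exists C => _ [j _ <-].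
Qed.

Lemma hnorm_le x c : hle x c -> hnorm abs (hval x) <= c.
Proof.
move=> h; apply: ge_sup; first by exists (abs (x 0)); exists 0.
by move=> _ [j _ <-].
Qed.

Definition hneg x := forall i : int, 0 <= i -> x i = 0.

Variables (A : set (biseries K)) (s : nat -> int) (v : nat -> biseries K).
Hypothesis A_subalg : is_subalgebra abs A.
Hypothesis A_const : A `&` power_inv = constants.
Hypothesis s_std : is_standard_basis A s v.
Hypothesis v_int : forall i j, integer_ring abs (v i j).

Definition hA x := A (hval x).
Definition hAan x := forall e : R, 0 < e -> exists2 y, hA y & hle (x - y) e.

Lemma A_v i : A (v i). Proof. by have [] := std_basis s_std. Qed.

(** An element of A is a finite combination of the integral [v i], so its coefficients are bounded,
    and they vanish beyond its degree. *)
Lemma A_Hfield f : A f -> Hfield abs f.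
Proof.
move=> Af; have [d hd] := subalg_laurent A_subalg Af.
have [_ /(_ f Af) [N [c e]] _] := std_basis s_std.
pose C := \sum_(i < N) abs (c i) + 1.
have C0 : 0 < C by rewrite ltr_wpDl // sumr_ge0 // => i _; exact: pabs_ge0.
apply: (@Hfield_finite _ _ _ _ C (absz d)) => // [i|i hi]; last by apply: hd; lia.
rewrite e fct_sumE; apply: pabs_sum_le => [|j _]; first exact: ltW.
rewrite -[C]mulr1; apply: pabs_mul_le; last exact: v_int.
rewrite /C (bigD1 j) //= -addrA lerDl addr_ge0 // sumr_ge0 // => k _; exact: pabs_ge0.
Qed.

(** An element of negative degree would lie in K[[1/T]], hence be constant by [A_const], and a
    nonzero constant has degree 0. *)
Lemma degree_ge0 d : degree_set A d -> 0 <= d.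
Proof.
case=> f Af [fd hd]; rewrite leNgt; apply/negP => d0.
have [c _ e] : constants f.
  by rewrite -A_const; split => // i i0; apply: hd; exact: lt_trans i0.
move: fd; rewrite -e [X in X != 0](_ : _ = c * (d == 0)%:R) // lt_eqF // mulr0 eqxx //.
Qed.

Lemma s_degree i : degree_set A (s i).
Proof. by rewrite -(std_degrees s_std); exists i. Qed.

Lemma s_ge0 i : 0 <= s i. Proof. exact/degree_ge0/s_degree. Qed.

(** At [s j] the [v i] with i < j vanish by degree and those with i > j because the basis is
    reduced. Coordinates are therefore coefficients. *)
Lemma coef_std N (c : nat -> K) j : (j < N)%N ->
  (\sum_(i < N) c i *: v i) (s j) = c j.
Proof.
move=> jN; rewrite fct_sumE (bigD1 (Ordinal jN)) //=.
rewrite [X in X + _](_ : _ = c j); last first.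
  by rewrite [LHS](_ : _ = c j * v j (s j)) // (std_monic s_std) mulr1.
rewrite big1 ?addr0 // => i ij; rewrite [LHS](_ : _ = c i * v i (s j)) //.
have [h|h|e] := ltngtP i j.
- by have [_ ->] := std_deg s_std i; rewrite ?mulr0 //; exact: (std_increasing s_std).
- by rewrite (std_reduced s_std) // mulr0.
- by case/eqP: ij; apply/val_inj.
Qed.

(** The coefficients at the [s i] are the coordinates, and strict integrality gives the basis
    elements norm at most 1. *)
Lemma A_coef_le f c : A f -> 0 <= c -> (forall i, abs (f (s i)) <= c) ->
  forall j, abs (f j) <= c.
Proof.
move=> Af c0 h j; have [_ /(_ f Af) [N [b e]] _] := std_basis s_std.
rewrite e fct_sumE; apply: pabs_sum_le => // i _.
rewrite [X in abs X](_ : _ = b i * v i j) // mulrC; apply: pabs_mul_le1; first exact: v_int.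
by rewrite -(coef_std b (ltn_ord i)) -e.
Qed.

Lemma hA1 : hA 1. Proof. exact: subalg1 A_subalg. Qed.
Lemma hAD x y : hA x -> hA y -> hA (x + y). Proof. exact: (subalgD A_subalg). Qed.
Lemma hAM x y : hA x -> hA y -> hA (x * y).
Proof. by rewrite /hA hvalM; exact: (subalgM A_subalg). Qed.
Lemma hAN x : hA x -> hA (- x).
Proof. by move=> h; have := subalgZ A_subalg (-1) h; rewrite scaleN1r. Qed.
Lemma hA_cst c : hA (hcst c).
Proof. exact: (subalgZ A_subalg c (subalg1 A_subalg)). Qed.
Lemma hA0 : hA 0. Proof. by rewrite -(rmorph0 hcst); exact: hA_cst. Qed.

Lemma hA_hAan x : hA x -> hAan x.
Proof. by move=> h e e0; exists x => //; rewrite subrr; exact/hle0/ltW. Qed.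
Lemma hAan_cst c : hAan (hcst c). Proof. exact/hA_hAan/hA_cst. Qed.
Lemma hAan1 : hAan 1. Proof. exact/hA_hAan/hA1. Qed.
Lemma hAan0 : hAan 0. Proof. exact/hA_hAan/hA0. Qed.

Lemma hAanD x y : hAan x -> hAan y -> hAan (x + y).
Proof.
move=> hx hy e e0; have [a ha xa] := hx e e0; have [b hb yb] := hy e e0.
by exists (a + b); [exact: hAD | rewrite opprD addrACA; exact: hleD].
Qed.

Lemma hAanN x : hAan x -> hAan (- x).
Proof.
move=> hx e e0; have [a ha xa] := hx e e0; exists (- a); first exact: hAN.
by rewrite -opprD; exact: hleN.
Qed.

Lemma hAanM x y : hAan x -> hAan y -> hAan (x * y).
Proof.
move=> hx hy e e0; have [C C0 hC] := hle_bounded x; have [D D0 hD] := hle_bounded y.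
have [b hb yb] := hy _ (divr_gt0 e0 C0).
have [E E0 hE] := hle_bounded b; have [a ha xa] := hx _ (divr_gt0 e0 E0).
exists (a * b); first exact: hAM.
have -> : x * y - a * b = x * (y - b) + (x - a) * b by ring.
apply: hleD; last by rewrite -[e](divfK (lt0r_neq0 E0)); exact: hleM.
by rewrite (_ : e = C * (e / C)); [exact: hleM | rewrite mulrC divfK ?gt_eqF].
Qed.

Lemma hAanX x n : hAan x -> hAan (x ^+ n).
Proof.
by move=> h; elim: n => [|n IH]; [exact: hAan1 | rewrite exprS; exact: hAanM].
Qed.

Lemma hAan_sum (I : Type) (r : seq I) (P : pred I) (F : I -> H) :
  (forall i, P i -> hAan (F i)) -> hAan (\sum_(i <- r | P i) F i).
Proof. by move=> h; apply: (big_ind hAan) => //; [exact: hAan0 | exact: hAanD]. Qed.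

Lemma hAan_lim u x : (forall n, hAan (u n)) -> hcvg u x -> hAan x.
Proof.
move=> hu hx e e0; have [N /(_ N (leqnn N)) hN] := hx e e0.
have [a ha ua] := hu N e e0; exists a => //.
have -> : x - a = (u N - a) - (u N - x) by ring.
exact: hleB.
Qed.

Lemma hAan_exp x : hsmall x -> hAan x -> hAan (hexp x).
Proof.
move=> sx hx; apply: (hAan_lim _ (hexpP sx)) => N.
by apply: hAan_sum => k _; apply: hAanM (hAan_cst _) (hAanX _ _).
Qed.

Lemma AanE h : Aan abs A h <-> exists2 x, h = hval x & hAan x.
Proof.
split=> [[hh ha]|[x -> ha]].
  exists (HRing hh) => // e e0; have [f [Af hf hl]] := ha e e0.
  exists (HRing hf) => //; apply: hle_trans (ltW hl); exact: hle_hnorm.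
split=> [|e e0]; first exact: hvalP.
have [y hy xy] := ha _ (divr_gt0 e0 (ltr0n R 2)).
exists (hval y); split => //; first exact: hvalP.
apply: (@le_lt_trans _ _ (e / 2)); first exact: (hnorm_le xy).
by rewrite ltr_pdivrMr // ltr_pMr // ltr1n.
Qed.

Lemma hAan_coef_le x c : hAan x -> 0 <= c -> (forall i, abs (x (s i)) <= c) -> hle x c.
Proof.
move=> hx c0 h j; apply/ler_addgt0Pl => e e0; have [y hy xy] := hx e e0.
have ce : c <= e + c by rewrite lerDr ltW.
have ee : e <= e + c by rewrite lerDl.
have hy' : hle y (e + c).
  apply: A_coef_le => // [|i]; first exact: le_trans ce.
  have -> : y (s i) = x (s i) - (x - y) (s i) by rewrite hcoefB; ring.
  by apply: pabsB_le; [exact: le_trans ce | exact: le_trans (xy _) ee].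
have -> : x j = (x - y) j + y j by rewrite hcoefB subrK.
by apply: pabsD_le; [exact: le_trans (xy _) ee | exact: hy'].
Qed.

Variables (g : nat) (mu : 'I_g -> nat).
Hypothesis mu_gaps : is_gap_sequence A mu.

Lemma mu_neq_s i j : (mu i)%:Z != s j.
Proof.
apply/eqP => e; have : [set m : nat | ~ degree_set A m%:Z] (mu i).
  by rewrite -(mu_gaps.2); exists i.
by apply; rewrite e; exact: s_degree.
Qed.

Lemma mu_gt0 i : (0 < mu i)%N.
Proof.
rewrite lt0n; apply/eqP => e.
have : [set m : nat | ~ degree_set A m%:Z] (mu i) by rewrite -(mu_gaps.2); exists i.
apply; rewrite e; exists (mono 0); first exact: subalg1 A_subalg.
by split=> [|i0 i00]; rewrite /mono ?eqxx ?oner_eq0 // gt_eqF.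
Qed.

Lemma mu_inj : injective mu.
Proof.
move=> i j e; have [h|h|h] := ltngtP i j; last exact/val_inj.
  by have := mu_gaps.1 _ _ h; rewrite e ltnn.
by have := mu_gaps.1 _ _ h; rewrite e ltnn.
Qed.

Lemma gap_or_degree m : (exists i, s i = m%:Z) \/ (exists i, mu i = m).
Proof.
have [h|h] := pselect (degree_set A m%:Z).
  by left; move: h; rewrite -(std_degrees s_std) => -[i _ <-]; exists i.
by right; have : [set m : nat | ~ degree_set A m%:Z] m by []; rewrite -(mu_gaps.2) => -[i _ <-]; exists i.
Qed.

Definition gap_part (c : 'I_g -> K) : H := \sum_(i < g) hcst (c i) * hmono (mu i)%:Z.

Lemma coef_gap_part c j : gap_part c (mu j)%:Z = c j.
Proof.
rewrite hcoef_sum; under eq_bigr => i _ do rewrite hcoef_cstM hcoef_mono.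
rewrite (bigD1 j) //= eqxx mulr1 big1 ?addr0 // => i ij.
rewrite eqz_nat; case: eqP => [/mu_inj e|_]; last by rewrite mulr0.
by rewrite e eqxx in ij.
Qed.

Lemma coef_gap_part0 c k : (forall j, k != (mu j)%:Z) -> gap_part c k = 0.
Proof.
by move=> h; rewrite hcoef_sum big1 // => i _; rewrite hcoef_cstM hcoef_mono (negbTE (h i)) mulr0.
Qed.

(* The coefficients at the [s i] only see [a], and those at the gaps then give [c]. *)
Lemma decomp_le a n c (d : R) : hAan a -> hneg n -> hle (a + n + gap_part c) d ->
  [/\ hle a d, hle n d & forall i, abs (c i) <= d].
Proof.
move=> ha hn h; have d0 := hle_ge0 h.
have had : hle a d.
  apply: hAan_coef_le => // i; have := h (s i).
  rewrite !hcoefD hn ?s_ge0 // coef_gap_part0 ?addr0 // => j.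
  by rewrite eq_sym mu_neq_s.
have hc i : abs (c i) <= d.
  have -> : c i = (a + n + gap_part c) (mu i)%:Z - a (mu i)%:Z.
    rewrite !hcoefD coef_gap_part hn // addr0; ring.
  exact: pabsB_le.
split=> //; have -> : n = (a + n + gap_part c) - a - gap_part c by ring.
apply: hleB; first exact: hleB.
apply: hle_sum => // i _; rewrite -[d]mulr1; apply: hleM (hle_mono _).
exact: hle_trans (hle_cst _) (hc i).
Qed.

Lemma gap_part0 : gap_part (fun=> 0) = 0.
Proof. by rewrite /gap_part big1 // => i _; rewrite rmorph0 mul0r. Qed.

(** Division with remainder: the leading term in degree [d] is removed by the monic integral [v i]
    if [d] is a degree of A, and by T^(mu i) otherwise. Both keep the coefficients integral. *)
Lemma integral_decomp (d : nat) x : hle x 1 -> (forall i : int, d%:Z <= i -> x i = 0) ->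
  exists a n c, [/\ hA a, hle a 1, hneg n, hle n 1 &
    (forall i, abs (c i) <= 1) /\ x = a + n + gap_part c].
Proof.
elim: d x => [|d IH] x hx h0.
  exists 0, x, (fun=> 0); split => //; [exact: hA0 | exact: hle0 | split => [i|]].
    by rewrite pabs0.
  by rewrite gap_part0 addr0 add0r.
have step (w : H) : hle w 1 -> w d%:Z = 1 -> (forall i : int, d%:Z < i -> w i = 0) ->
    hle (x - hcst (x d%:Z) * w) 1 /\
    (forall i : int, d%:Z <= i -> (x - hcst (x d%:Z) * w) i = 0).
  move=> hw w1 w0; split.
    apply: hleB => //; rewrite -[1]mulr1; apply: hleM => //.
    exact: hle_trans (hle_cst _) (hx _).
  move=> i; rewrite le_eqVlt hcoefB hcoef_cstM => /predU1P[<-|di].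
    by rewrite w1 mulr1 subrr.
  by rewrite w0 // mulr0 subr0 h0.
have [[i si]|[i mi]] := gap_or_degree d.
  have hv : Hfield abs (v i) by apply: A_Hfield; exact: A_v.
  have [|||y1 y0] := step (HRing hv).
  - by move=> j; exact: v_int.
  - by rewrite /= -si (std_monic s_std).
  - by move=> j; rewrite -si; exact: (std_deg s_std i).2.
  have [a [n [c [ha a1 hn n1 [c1 e]]]]] := IH _ y1 y0.
  exists (a + hcst (x d%:Z) * HRing hv), n, c; split => //.
  - by apply: hAD => //; apply: hAM; [exact: hA_cst | exact: A_v].
  - apply: hleD => //; rewrite -[1]mulr1; apply: hleM; last by move=> j; exact: v_int.
    exact: hle_trans (hle_cst _) (hx _).
  by split => //; rewrite -[LHS](subrK (hcst (x d%:Z) * HRing hv)) e; ring.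
have [|||y1 y0] := step (hmono d%:Z).
- exact: hle_mono.
- by rewrite hcoef_mono eqxx.
- by move=> j dj; rewrite hcoef_mono gt_eqF.
have [a [n [c [ha a1 hn n1 [c1 e]]]]] := IH _ y1 y0.
exists a, n, (fun j => c j + (if j == i then x d%:Z else 0)); split => //; split => [j|].
  by apply: pabsD_le => //; case: ifP => _; [exact: hx | rewrite pabs0].
rewrite -[LHS](subrK (hcst (x d%:Z) * hmono d%:Z)) e -addrA; congr (_ + _).
rewrite /gap_part; under [RHS]eq_bigr => j _ do rewrite rmorphD mulrDl.
rewrite big_split /=; congr (_ + _).
rewrite (bigD1 i) //= eqxx mi big1 ?addr0 // => j /negbTE ->.
by rewrite rmorph0 mul0r.
Qed.

Lemma hval_gap_part c : hval (gap_part c) = \sum_(i < g) c i *: mono (mu i)%:Z.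
Proof.
apply: funext => j; rewrite hcoef_sum fct_sumE; apply: eq_bigr => i _.
by rewrite hcoef_cstM.
Qed.

(** [e_matrix] is a choice with default 0; [integral_decomp] applied to the monomials shows that a
    matrix with the defining property exists. *)
Lemma e_matrixP k (e := e_matrix abs A p mu k) :
  (forall i j, abs (e i j) <= 1) /\
  forall j, exists a n, [/\ hA a, hle a 1, hneg n, hle n 1 &
    hmono (mu j * p ^ k)%N%:Z = a + n + gap_part (fun i => e i j)].
Proof.
have [e_int hdec] : is_e_matrix abs A p mu k e; last first.
  split=> [//|j]; have [f1 [Af1 f1i] [f2 [f2n f2i] ef]] := hdec j.
  have hf2 : Hfield abs f2.
    by apply: (@Hfield_finite _ _ _ _ 1 0) => // i i0; apply: f2n; exact: ltW.
  exists (HRing (A_Hfield Af1)), (HRing hf2); split => //.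
  apply: hval_inj.
  rewrite -[LHS](subrK (hval (gap_part (fun i => e i j)))) [hval (gap_part _) in X in X + _ = _]hval_gap_part.
  by rewrite -ef.
apply: (@xgetPex _ 0 [set e | is_e_matrix abs A p mu k e]).
have /choice[F hF] j : exists anc : H * H * ('I_g -> K),
    [/\ hA anc.1.1, hle anc.1.1 1, hneg anc.1.2, hle anc.1.2 1 &
    (forall i, abs (anc.2 i) <= 1) /\
    hmono (mu j * p ^ k)%N%:Z = anc.1.1 + anc.1.2 + gap_part anc.2].
  have [|i hi|a [n [c h]]] := @integral_decomp (mu j * p ^ k).+1 (hmono (mu j * p ^ k)%N%:Z).
  - exact: hle_mono.
  - by rewrite hcoef_mono gt_eqF.
  - by exists (a, n, c).
exists (\matrix_(i, j) (F j).2 i); split=> [i j|j].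
  by rewrite mxE; have [_ _ _ _ [h _]] := hF j; exact: h.
have [h1 h2 h3 h4 [h5 h6]] := hF j.
exists (hval (F j).1.1); first by split => // i; exact: h2.
exists (hval (F j).1.2); first by split => // i; exact: h4.
have -> : \sum_(i < g) (\matrix_(i, j) (F j).2 i : 'M[K]_g) i j *: (mono (mu i)%:Z : biseries K) = hval (gap_part (F j).2).
  by rewrite hval_gap_part; apply: eq_bigr => i _; rewrite mxE.
rewrite -[mono _ in RHS]/(hval (hmono (mu j * p ^ k)%N%:Z)) h6.
by rewrite -[RHS]/(hval (_ - _)) addrK.
Qed.

End StandardBasis.

(** * The groups Gamma and Gamma_A *)

Section GammaTheory.
Context {R : realType} {p : nat} {K : pvField R p}.
Local Notation abs := (@pabs R p K).
Local Notation H := (hring K).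
Implicit Types (x y a u : H).

Definition hGam (rho : R) x := [/\ exists y, x * y = 1, hle x 1, abs (x 0) = 1 &
  forall i : nat, (0 < i)%N -> abs (x i%:Z) <= rho ^+ i].

Definition hGamma x := exists2 rho : R, 0 <= rho < 1 & hGam rho x.

Lemma Gamma_E rho h : Gamma_ abs rho h <-> exists2 x, h = hval x & hGam rho x.
Proof.
split=> [[[hh [f hf e]] h1 h0 hr]|[x -> [[y xy] x1 x0 xr]]].
  exists (HRing hh) => //; split => //; first by exists (HRing hf); apply: hval_inj; rewrite hvalM.
  by have := hle_hnorm (HRing hh); rewrite h1.
split => //.
  split; first exact: hvalP.
  by exists (hval y); [exact: hvalP | rewrite -hvalM xy].
apply/eqP; rewrite eq_le hnorm_le //=; have := hle_hnorm x 0.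
by rewrite x0.
Qed.

Lemma GammaE h : Gamma abs h <-> exists2 x, h = hval x & hGamma x.
Proof.
split=> [[rho hr /Gamma_E[x -> hx]]|[x -> [rho hr hx]]]; first by exists x => //; exists rho.
by exists rho => //; apply/Gamma_E; exists x.
Qed.

Lemma hGam_coef_le rho x (i : nat) : 0 <= rho < 1 -> hGam rho x -> (0 < i)%N ->
  abs (x i%:Z) <= rho.
Proof.
move=> /andP[r0 r1] [_ _ _ hx] i0; apply: le_trans (hx i i0) _.
by rewrite -(prednK i0) exprS ler_piMr // exprn_ile1 // ltW.
Qed.

(** In degree n > 0 the positive ones among [i] and [n - i] add up to at least n, whence the bound
    rho^n. In degree 0 every term but [x 0 * y 0] contains a coefficient of positive index, hence is
    at most rho < 1. *)
Lemma hGamM rho x y : 0 <= rho < 1 -> hGam rho x -> hGam rho y -> hGam rho (x * y).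
Proof.
move=> hr hx hy; have [[x' xx'] x1 x0 xr] := hx; have [[y' yy'] y1 y0 yr] := hy.
have [r0 r1] := andP hr.
split.
- by exists (x' * y'); rewrite mulrACA xx' yy' mulr1.
- by rewrite -[1]mulr1; exact: hleM.
- have -> : (x * y) 0 = x 0 * y 0 + ((x - hcst (x 0)) * y) 0.
    by rewrite mulrBl hcoefB hcoef_cstM; ring.
  rewrite pabs_addl pabsM x0 y0 ?mulr1 //; apply: le_lt_trans r1.
  rewrite hcoefM; apply: zsum_le => // [|i]; first by apply: c0_lmul; exact: hvalP.
  rewrite hcoefB hcoef_cst; case: eqP => [->|/eqP i0].
    by rewrite subrr mul0r pabs0.
  rewrite subr0 sub0r; case: i i0 => i i0.
    rewrite mulrC; apply: pabs_mul_le1; first exact: y1.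
    by apply: (hGam_coef_le hr hx); rewrite lt0n.
  by apply: pabs_mul_le1; [exact: x1 | rewrite NegzE opprK; exact: (hGam_coef_le hr hy)].
- move=> n n0; rewrite hcoefM; apply: zsum_le; rewrite ?exprn_ge0 //.
    by apply: c0_lmul; exact: hvalP.
  have rle m k : (m <= k)%N -> rho ^+ k <= rho ^+ m.
    by move=> mk; rewrite ler_wiXn2l // ltW.
  move=> i; have [ni|ni] := leP n%:Z i.
    rewrite mulrC; apply: pabs_mul_le1; first exact: y1.
    case: i ni => // i ni; apply: le_trans (xr i _) (rle _ _ _); lia.
  have [i0|i0] := leP i 0.
    apply: pabs_mul_le1; first exact: x1.
    have -> : n%:Z - i = (absz (n%:Z - i)%R)%:Z by lia.
    apply: le_trans (yr _ _) (rle _ _ _); lia.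
  have -> : n%:Z - i = (absz (n%:Z - i)%R)%:Z by lia.
  have {1}-> : i = (absz i)%:Z by lia.
  rewrite [X in rho ^+ X](_ : n = absz i + absz (n%:Z - i)%R)%N; last by lia.
  rewrite exprD; apply: pabs_mul_le; [apply: xr | apply: yr]; lia.
Qed.

Lemma hGam_le rho rho' x : 0 <= rho -> rho <= rho' -> hGam rho x -> hGam rho' x.
Proof.
move=> r0 rr [h1 h2 h3 h4]; split => // i i0; apply: le_trans (h4 i i0) _.
by rewrite lerXn2r // nnegrE // (le_trans r0).
Qed.

Lemma hGammaM x y : hGamma x -> hGamma y -> hGamma (x * y).
Proof.
move=> [r /andP[r0 r1] hx] [t /andP[t0 t1] hy].
have h : 0 <= Num.max r t < 1 by rewrite le_max r0 gt_max r1.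
exists (Num.max r t) => //; apply: hGamM => //.
  by apply: (hGam_le r0) hx; rewrite le_max lexx.
by apply: (hGam_le t0) hy; rewrite le_max lexx orbT.
Qed.

Lemma hGam1 rho : 0 <= rho -> hGam rho 1.
Proof.
move=> r0; split; [by exists 1; rewrite mulr1 | exact: hle1 | by rewrite hcoef1 eqxx pabs1 |].
by move=> [//|i] _; rewrite hcoef1 pabs0 exprn_ge0.
Qed.

Lemma hGamma1 : hGamma 1.
Proof. by exists 0; [rewrite lexx ltr01 | exact: hGam1]. Qed.

Lemma hGamma_prod (I : Type) (r : seq I) (F : I -> H) : (forall i, hGamma (F i)) ->
  hGamma (\prod_(i <- r) F i).
Proof. by move=> h; apply: (big_ind hGamma) => //; [exact: hGamma1 | exact: hGammaM]. Qed.

Lemma hGam0_hGamma x : hGam 0 x -> hGamma x.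
Proof. by exists 0 => //; rewrite lexx ltr01. Qed.

(** All positive powers of [n] stay in negative degrees, so exp n is 1 plus negative powers of T,
    with inverse exp (- n). *)
Lemma hGam0_exp n : hneg n -> hsmall n -> hGam 0 (hexp n).
Proof.
move=> hn sn; have coefE (i : int) : 0 <= i -> hexp n i = (i == 0)%:R.
  move=> i0; apply: (abs_cvg_unique (hcvg_coef i (hexpP sn))).
  apply/abs_cvgP => e e0; exists 1%N => -[//|N] _.
  rewrite /exp_trunc big_ord_recl hcoefD expr0 mulr1 /inv_fact fact0 invr1 rmorph1 hcoef1.
  rewrite addrAC subrr add0r hcoef_sum big1 ?pabs0 ?ltW // => k _.
  have hX (m : nat) : forall j : int, 0 <= j -> (n ^+ m.+1) j = 0.
    elim: m => [|m IH] j j0; first exact: hn.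
    rewrite exprS hcoefM (zsum1 (k := 0)) => [|l _]; first by rewrite hn // mul0r.
    have [l0|l0] := leP 0 l; first by rewrite hn // mul0r.
    by rewrite IH ?mulr0 // subr_ge0 (le_trans (ltW l0)).
  by rewrite hcoef_cstM hX // mulr0.
split; [by exists (hexp (- n)); exact: hexpNM | exact: hexp_le1 | by rewrite coefE // eqxx pabs1 |].
by move=> [//|i] _; rewrite coefE // pabs0 exprn_ge0.
Qed.

Variables (A : set (biseries K)).
Hypothesis A_subalg : is_subalgebra abs A.

Definition hGamma_sub x := exists a u, [/\ x = a * u, hAan A a, exists2 b, hAan A b & a * b = 1,
  hGamma a & hGam 0 u].

Lemma Gamma_subE h : Gamma_sub abs A h <-> exists2 x, h = hval x & hGamma_sub x.
Proof.
split=> [[a [[ha [b hb ab]] ga] [u gu <-]]|[x -> [a [u [-> ha [b hb ab] ga gu]]]]].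
  move/AanE: ha => [x -> hx] in ab ga *; move/AanE: hb => [y ey hy].
  move/GammaE: ga => [x' ex gx]; rewrite -(hval_inj ex) in gx; move/Gamma_E: gu => [z -> gz].
  exists (x * z); first by rewrite hvalM.
  exists x, z; split => //; exists y => //.
  by apply: hval_inj; rewrite hvalM -ey.
exists (hval a).
  split; last by apply/GammaE; exists a.
  split; first by apply/AanE; exists a.
  by exists (hval b); [apply/AanE; exists b | rewrite -hvalM ab].
by exists (hval u); [apply/Gamma_E; exists u | rewrite -hvalM].
Qed.

Lemma hGamma_subM x y : hGamma_sub x -> hGamma_sub y -> hGamma_sub (x * y).
Proof.
move=> [a [u [-> ha [a' ha' aa'] ga gu]]] [b [w [-> hb [b' hb' bb'] gb gw]]].
exists (a * b), (u * w); split.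
- by rewrite mulrACA.
- exact: hAanM.
- by exists (a' * b'); [exact: hAanM | rewrite mulrACA aa' bb' mulr1].
- exact: hGammaM.
- by apply: hGamM => //; rewrite lexx ltr01.
Qed.

Lemma hGamma_sub1 : hGamma_sub 1.
Proof.
exists 1, 1; split; rewrite ?mulr1 //; [exact: hAan1 | | exact: hGamma1 | exact: hGam1].
by exists 1; rewrite ?mulr1 //; exact: hAan1.
Qed.

Lemma clsE x h : cls abs A (hval x) h <-> exists2 n, h = hval (x * n) & hGamma_sub n.
Proof.
split=> [[_ -> [n /Gamma_subE[y -> hy] <-]]|[n -> hn]]; first by exists y; rewrite ?hvalM.
exists (hval x) => //; exists (hval n); last by rewrite hvalM.
by apply/Gamma_subE; exists n.
Qed.

(** The inverse of [x] is supplied as a member [y] of the subgroup; it is applied to parameters p^n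
    and - p^n. *)
Lemma cls_eq1 x y : hGamma_sub x -> hGamma_sub y -> x * y = 1 -> cls abs A (hval x) = GammaA1 abs A.
Proof.
move=> hx hy xy; apply/seteqP; split=> h.
  case/clsE=> n -> hn; apply/(clsE 1); exists (x * n); first by rewrite mul1r.
  exact: hGamma_subM.
case/(clsE 1)=> n -> hn; apply/clsE; exists (y * n); last exact: hGamma_subM.
by rewrite mulrA xy.
Qed.

Lemma prod_cls x y :
  prod_set abs (cls abs A (hval x)) (cls abs A (hval y)) = cls abs A (hval (x * y)).
Proof.
apply/seteqP; split=> h.
  move=> [f /clsE[n -> hn] [f' /clsE[m -> hm] <-]]; apply/clsE.
  by exists (n * m); [rewrite mulrACA [RHS]hvalM | exact: hGamma_subM].
case/clsE=> n -> hn; exists (hval x).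
  by apply/clsE; exists 1; [rewrite mulr1 | exact: hGamma_sub1].
by exists (hval (y * n)); [apply/clsE; exists n | rewrite -hvalM mulrA].
Qed.

Lemma GammaA_exp_cls x m :
  GammaA_exp abs A (cls abs A (hval x)) m = cls abs A (hval (x ^+ m)).
Proof.
by elim: m => // m IH; rewrite /GammaA_exp iterS -/(GammaA_exp _ _ _ _) IH prod_cls exprS.
Qed.

End GammaTheory.

(** * The elements exp (c l(x T^d)) for integers c *)

Section ArtinHasseElements.
Context {R : realType} {p : nat} {K : pvField R p}.
Local Notation abs := (@pabs R p K).
Local Notation H := (hring K).
Hypothesis artin_hasse : forall (c : int) m,
  abs (ps_exp (fun m => c%:~R * l_series p m) m) <= 1.

Definition toH (f : biseries K) : H :=
  if pselect (Hfield abs f) is left h then HRing h else 0.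

Lemma hval_toH f : Hfield abs f -> hval (toH f) = f.
Proof. by rewrite /toH; case: pselect. Qed.

Definition lfun (c : int) (x : K) (m : nat) : K := c%:~R * l_series p m * x ^+ m.

Lemma lfun0 c x : lfun c x 0%N = 0.
Proof. by rewrite /lfun l_series0 mulr0 mul0r. Qed.

(** Substituting x T for T multiplies the m-th coefficient of the integral series exp (c l) by
    x^m. *)
Lemma ps_exp_lfun_le c x m : abs (ps_exp (lfun c x) m) <= abs x ^+ m.
Proof.
rewrite /lfun (ps_exp_scale (f := fun m => c%:~R * l_series p m)) ?l_series0 ?mulr0 //.
by rewrite -pabsX; apply: pabs_mul_le1.
Qed.

Lemma c0_ps_exp_lfun c x : abs x < 1 -> c0_seq (ps_exp (lfun c x)).
Proof.
move=> x1; split.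
  exists 1 => // m; apply: le_trans (ps_exp_lfun_le c x m) _.
  by rewrite exprn_ile1 ?pabs_ge0 // ltW.
move=> e e0; have [|N hN] := @expr_small _ (abs x) e _ e0; first by rewrite pabs_ge0.
by exists N => m /hN; apply: le_trans; exact: ps_exp_lfun_le.
Qed.

(** The element exp (c l(x T^d)) of H, for |x| < 1. *)
Definition ah_subst (d : nat) (c : int) (x : K) : H := toH (ps_subst (ps_exp (lfun c x)) d).

Lemma hval_ah_subst d c x : (0 < d)%N -> abs x < 1 ->
  hval (ah_subst d c x) = ps_subst (ps_exp (lfun c x)) d.
Proof. by move=> d0 x1; apply/hval_toH/Hfield_subst => //; exact: c0_ps_exp_lfun. Qed.

Lemma ah_substD d b c x : (0 < d)%N -> abs x < 1 -> ah_subst d (b + c) x = ah_subst d b x * ah_subst d c x.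
Proof.
move=> d0 x1; apply: hval_inj; rewrite hvalM !hval_ah_subst // lmul_subst //; last 2 first.
- by apply/Hfield_subst => //; exact: c0_ps_exp_lfun.
- by apply/Hfield_subst => //; exact: c0_ps_exp_lfun.
rewrite -ps_expD ?lfun0 //; congr (ps_subst (ps_exp _) d); apply: funext => m.
by rewrite /lfun rmorphD !mulrDl.
Qed.

Lemma ah_subst0 d x : (0 < d)%N -> abs x < 1 -> ah_subst d 0 x = 1.
Proof.
move=> d0 x1; apply: hval_inj; rewrite hval_ah_subst //; apply: funext => i.
have -> : lfun 0 x = fun=> 0 by apply: funext => m; rewrite /lfun !mul0r.
rewrite [RHS](_ : _ = (i == 0)%:R) //.
have [[a ->]|h] := int_multP d i.
  by rewrite ps_subst_in // ps_exp_zero eqz_nat muln_eq0 (gtn_eqF d0).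
by rewrite ps_subst_out //; have := h 0%N; rewrite muln0 => /negbTE ->.
Qed.

(** The inverse is the element with parameter [- c], which is why [c] may be negative. *)
Lemma ah_subst_hGamma d c x : (0 < d)%N -> abs x < 1 -> hGamma (ah_subst d c x).
Proof.
(* The coefficient of T^(d a) is at most |x|^a, so rho is chosen with rho^d = |x|. *)
move=> d0 x1; pose rho : R := abs x `^ d%:R^-1.
have rd : rho ^+ d = abs x.
  rewrite -powR_mulrn ?powR_ge0 // /rho -powRrM mulVf ?powRr1 ?pabs_ge0 //.
  by rewrite pnatr_eq0 -lt0n.
have r0 : 0 <= rho by exact: powR_ge0.
have r1 : rho < 1.
  rewrite ltNge; apply/negP => h; move: x1; rewrite -rd ltNge => /negP; apply.
  exact: exprn_ege1.
exists rho; first by rewrite r0.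
split.
- by exists (ah_subst d (- c) x); rewrite -ah_substD // subrr ah_subst0.
- move=> i; rewrite hval_ah_subst //; have [[a ->]|h] := int_multP d i.
    rewrite ps_subst_in //; apply: le_trans (ps_exp_lfun_le _ _ _) _.
    by rewrite exprn_ile1 ?pabs_ge0 // ltW.
  by rewrite ps_subst_out // pabs0.
- rewrite hval_ah_subst //; have := ps_subst_in (ps_exp (lfun c x)) 0 d0; rewrite muln0 => ->.
  by rewrite ps_exp0 ?lfun0 // pabs1.
- move=> i i0; rewrite hval_ah_subst //; have [[a e]|h] := int_multP d i%:Z.
    rewrite e ps_subst_in //; apply: le_trans (ps_exp_lfun_le _ _ _) _.
    by rewrite -rd -exprM; case: e => ->.
  by rewrite ps_subst_out // pabs0 exprn_ge0.
Qed.

Variables (g : nat) (mu : 'I_g -> nat).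
Hypothesis mu_gt0 : forall i, (0 < mu i)%N.

Definition ah_prod (c : int) (x : 'rV[K]_g) : H := \prod_(i < g) ah_subst (mu i) c (x 0 i).

Lemma hval_ah_prod1 (x : 'rV[K]_g) : (forall i, abs (x 0 i) < 1) -> hval (ah_prod 1 x) = h_mu abs p mu x.
Proof.
move=> x1; rewrite hval_prod; apply: eq_bigr => i _; rewrite hval_ah_subst // /h_series.
congr (ps_subst (ps_exp _) _); apply: funext => m.
by rewrite /lfun mul1r.
Qed.

Lemma ah_prodD b c (x : 'rV[K]_g) : (forall i, abs (x 0 i) < 1) -> ah_prod (b + c) x = ah_prod b x * ah_prod c x.
Proof. by move=> x1; rewrite -big_split; apply: eq_bigr => i _; rewrite ah_substD. Qed.

Lemma ah_prod0 (x : 'rV[K]_g) : (forall i, abs (x 0 i) < 1) -> ah_prod 0 x = 1.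
Proof. by move=> x1; rewrite /ah_prod big1 // => i _; rewrite ah_subst0. Qed.

Lemma ah_prodX (x : 'rV[K]_g) m : (forall i, abs (x 0 i) < 1) -> ah_prod 1 x ^+ m = ah_prod m%:Z x.
Proof.
by move=> x1; elim: m => [|m IH]; rewrite ?ah_prod0 // exprS IH -ah_prodD // -intS.
Qed.

Lemma ah_prod_hGamma c (x : 'rV[K]_g) : (forall i, abs (x 0 i) < 1) -> hGamma (ah_prod c x).
Proof. by move=> x1; apply: hGamma_prod => i; exact: ah_subst_hGamma. Qed.

End ArtinHasseElements.

(** * Convergence estimates *)

Section Estimates.
Context {R : realType} {p : nat} {K : pvField R p}.
Local Notation abs := (@pabs R p K).
Local Notation q := (abs p%:R).

(** The inequality of exponents to which [lterm_small] comes down. *)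
Lemma bernoulli_pow j : (1 + j * p.-1 <= p ^ j)%N.
Proof.
have p0 := @p_gt0 _ _ K; elim: j => // j IH.
rewrite mulSn addnCA expnS -[X in (_ <= X * _)%N](prednK p0) mulSn addnC.
by apply: leq_add => //; rewrite leq_pmulr // expn_gt0 p0.
Qed.

(** The counterpart for [lterm_decay]: twice the linear slope, up to the constant p - 1. *)
Lemma bernoulli_pow2 j : (2 * j * p.-1 <= p.-1 + p ^ j)%N.
Proof.
have p0 := @p_gt0 _ _ K; have p1 := @p_gt1 _ _ K.
case: j => // j; elim: j => [|j IH]; first by rewrite expn1; lia.
have h : (2 <= p ^ j.+1)%N.
  by rewrite expnS; apply: (leq_trans p1); rewrite leq_pmulr // expn_gt0 p0.
have -> : (p ^ j.+2 = p.-1 * p ^ j.+1 + p ^ j.+1)%N.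
  by rewrite expnS -[X in (X * _)%N](prednK p0) mulSn addnC.
have h2 : (2 * p.-1 <= p.-1 * p ^ j.+1)%N by rewrite mulnC leq_mul2l h orbT.
have -> : (2 * j.+2 * p.-1 = 2 * j.+1 * p.-1 + 2 * p.-1)%N by lia.
lia.
Qed.

Variables (n : nat) (x : K).
Hypotheses (n_gt0 : (0 < n)%N) (x_lt1 : abs x < 1).
Hypothesis x_le : abs x <= q `^ ((p ^ n - p ^ n.-1)%N%:R^-1).

(** The k-th term of p^n l(x). *)
Definition lterm (k : nat) : K := (p ^ n)%N%:R * p%:R ^- k * x ^+ (p ^ k).

Let p1_gt0 : (0 < p.-1)%N.
Proof. by have := @p_gt1 _ _ K; rewrite -subn1 subn_gt0. Qed.

(** As p^n - p^(n-1) = p^(n-1) (p - 1), the bound on [x] says that |x|^(p^(n-1) (p-1)) <= |p|; it is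
    raised to the power p^j. *)
Lemma abs_x_pow j : abs x ^+ (p ^ (j + n.-1) * p.-1) <= q ^+ (p ^ j).
Proof.
have p0 := @p_gt0 _ _ K.
have e : (p ^ n - p ^ n.-1 = p ^ n.-1 * p.-1)%N.
  by rewrite -[in (p ^ n)%N](prednK n_gt0) expnSr -[X in (_ - X)%N]muln1 -mulnBr subn1.
have D0 : (0 < p ^ n - p ^ n.-1)%N by rewrite e muln_gt0 expn_gt0 p0.
rewrite expnD -mulnA mulnC exprM; apply: lerXn2r; rewrite ?nnegrE ?exprn_ge0 ?pabs_ge0 //.
rewrite -e; apply: le_trans (lerXn2r (p ^ n - p ^ n.-1) _ _ x_le) _; rewrite ?nnegrE ?pabs_ge0 ?powR_ge0 //.
by rewrite -powR_mulrn ?powR_ge0 // -powRrM mulVf ?powRr1 ?pabs_ge0 // pnatr_eq0 -lt0n.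
Qed.

Lemma abs_lterm k : abs (lterm k) = q ^+ n / q ^+ k * abs x ^+ (p ^ k).
Proof. by rewrite /lterm natrX !pabsM pabsV !pabsX. Qed.

Lemma abs_ltermX k : abs (lterm k) ^+ p.-1 * q ^+ (k * p.-1) =
  q ^+ (n * p.-1) * abs x ^+ (p ^ k * p.-1).
Proof.
have q0 : 0 < q by exact: q_gt0.
rewrite abs_lterm !exprM -!exprMn; congr (_ ^+ _).
by field; rewrite expf_neq0 // gt_eqF.
Qed.

(** Indices are shifted by n - 1, where the bound on [x] begins to act; powers p - 1 keep all
    exponents integral. *)
Lemma lterm_boundX j m : (m + (j + n.-1) * p.-1 <= n * p.-1 + p ^ j)%N ->
  abs (lterm (j + n.-1)) ^+ p.-1 <= q ^+ m.
Proof.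
have q0 : 0 < q by exact: q_gt0.
move=> h; rewrite -(ler_pM2r (x := q ^+ ((j + n.-1) * p.-1))) ?exprn_gt0 // abs_ltermX -exprD.
apply: (@le_trans _ _ (q ^+ (n * p.-1) * q ^+ (p ^ j))).
  by rewrite ler_pM2l ?exprn_gt0 //; exact: abs_x_pow.
by rewrite -exprD; apply: ler_wiXn2l; rewrite ?(ltW q0) ?q_le1.
Qed.

Lemma lterm_decay j : abs (lterm (j + n.-1)) <= q ^+ j.
Proof.
have q0 : 0 < q by exact: q_gt0.
rewrite -(ler_pXn2r p1_gt0) ?nnegrE ?pabs_ge0 ?exprn_ge0 ?(ltW q0) // -exprM.
apply: lterm_boundX; have := bernoulli_pow2 j.
have {2}-> : n = n.-1.+1 by rewrite prednK.
by move: (p ^ j)%N => P; nia.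
Qed.

Lemma lterm_small k : abs (lterm k) <= exp_rad (K := K).
Proof.
have q0 : 0 < q by exact: q_gt0.
have p0 := @p_gt0 _ _ K; have p1 := @p_gt1 _ _ K.
rewrite le_exp_rad; have [kn|kn] := ltnP k n.-1; last first.
  rewrite -(subnK kn); apply: lterm_boundX; have := bernoulli_pow (k - n.-1).
  move: (k - n.-1)%N => j; have {2}-> : n = n.-1.+1 by rewrite prednK.
  by move: (p ^ j)%N => P; nia.
rewrite -(ler_pM2r (x := q ^+ (k * p.-1))) ?exprn_gt0 // abs_ltermX -exprD.
apply: (@le_trans _ _ (q ^+ (n * p.-1))).
  by rewrite ler_piMr ?exprn_ge0 ?(ltW q0) // exprn_ile1 ?pabs_ge0 ?(ltW x_lt1).
apply: ler_wiXn2l; rewrite ?(ltW q0) ?q_le1 //.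
(* Here n - k >= 2 and 2 (p - 1) >= p, so the factor p^(n-k) alone makes the term small. *)
have : (k.+2 * p.-1 <= n * p.-1)%N by rewrite leq_mul2r; apply/orP; right; lia.
nia.
Qed.

Lemma lterm_cvg0 (e : R) : 0 < e ->
  exists N : nat, forall k, (N <= k)%N -> abs (lterm k) <= e.
Proof.
move=> e0; have [N hN] := q_expr_small (K := K) e0; exists (N + n.-1)%N => k hk.
have -> : k = (k - n.-1 + n.-1)%N by lia.
by apply: le_trans (lterm_decay _) (hN _ _); lia.
Qed.

Lemma l_series_pow k : l_series p (p ^ k) = p%:R ^- k :> K.
Proof. by rewrite /l_series pfactorK ?(pv_prime K) // eqxx. Qed.

Lemma lfun_pow k : lfun (p ^ n)%N x (p ^ k)%N = lterm k.
Proof. by rewrite /lfun l_series_pow. Qed.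

Lemma lfun_nopow m : (forall k, m != p ^ k)%N -> lfun (p ^ n)%N x m = 0.
Proof. by move=> h; rewrite /lfun /l_series (negbTE (h _)) mulr0 mul0r. Qed.

Lemma pow_or_not m : (exists k, m = p ^ k)%N \/ (forall k, m != p ^ k)%N.
Proof.
have [h|h] := pselect (exists k, m = p ^ k)%N; [by left|right=> k].
by apply/eqP => e; apply: h; exists k.
Qed.

Lemma lfun_le m : abs (lfun (p ^ n)%N x m) <= exp_rad (K := K).
Proof.
have [[k ->]|h] := pow_or_not m; first by rewrite lfun_pow; exact: lterm_small.
by rewrite lfun_nopow // pabs0 exp_rad_ge0.
Qed.

Lemma lfun_c0 : c0_seq (lfun (p ^ n)%N x).
Proof.
split.
  exists (exp_rad (K := K)) => [|m]; last exact: lfun_le.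
  by apply: powR_gt0; exact: q_gt0.
move=> e e0; have [N hN] := lterm_cvg0 e0; exists (p ^ N)%N => m hm.
have [[k mk]|h] := pow_or_not m; last by rewrite lfun_nopow // pabs0 ltW.
by rewrite mk lfun_pow; apply: hN; move: hm; rewrite mk leq_exp2l // (@p_gt1 _ _ K).
Qed.

(** The element p^n l(x T^d) of H. *)
Definition lsubst (d : nat) : hring K := toH (ps_subst (lfun (p ^ n)%N x) d).

Lemma hval_lsubst d : (0 < d)%N -> hval (lsubst d) = ps_subst (lfun (p ^ n)%N x) d.
Proof. by move=> d0; apply/hval_toH/Hfield_subst => //; exact: lfun_c0. Qed.

Lemma hsmall_lsubst d : (0 < d)%N -> hsmall (lsubst d).
Proof.
move=> d0 i; rewrite hval_lsubst //; have [[a ->]|h] := int_multP d i.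
  by rewrite ps_subst_in //; exact: lfun_le.
by rewrite ps_subst_out // pabs0 exp_rad_ge0.
Qed.

Lemma hcvg_lsubst d : (0 < d)%N ->
  hcvg (fun N => \sum_(k < N) hcst (lterm k) * hmono (d * p ^ k)%N%:Z) (lsubst d).
Proof.
move=> d0 e e0; have [N0 hN0] := lterm_cvg0 e0; exists N0 => N hN i.
rewrite hcoefB hcoef_sum hval_lsubst //.
under eq_bigr => k _ do rewrite hcoef_cstM hcoef_mono.
have [[a ->]|h] := int_multP d i; last first.
  rewrite ps_subst_out // subr0 big1 ?pabs0 ?ltW // => k _.
  by rewrite (negbTE (h _)) mulr0.
rewrite ps_subst_in //.
under eq_bigr => k _ do rewrite eqz_nat eqn_pmul2l //.
have [[k ->]|h] := pow_or_not a; last first.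
  rewrite lfun_nopow // subr0 big1 ?pabs0 ?ltW // => k _.
  by rewrite (negbTE (h _)) mulr0.
under eq_bigr => j _ do rewrite eqn_exp2l ?(@p_gt1 _ _ K) //.
rewrite lfun_pow; have [kN|kN] := ltnP k N.
  rewrite (bigD1 (Ordinal kN)) //= eqxx mulr1 big1 ?addr0 ?subrr ?pabs0 ?ltW // => j jk.
  have /negbTE -> : (k != j)%N by apply: contraNneq jk => e1; apply/eqP/val_inj; rewrite /= e1.
  by rewrite mulr0.
rewrite big1 => [|j _]; last by rewrite gtn_eqF ?mulr0 // (leq_trans (ltn_ord j)).
by rewrite sub0r pabsN; apply: hN0; exact: leq_trans kN.
Qed.

End Estimates.

(** * Torsion and injectivity *)

Section Main.
Context {R : realType} {p : nat} {K : pvField R p}.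
Local Notation abs := (@pabs R p K).
Local Notation q := (abs p%:R).
Local Notation H := (hring K).
Hypothesis artin_hasse : forall (c : int) m,
  abs (ps_exp (fun m => c%:~R * l_series p m : K) m) <= 1.

Variables (A : set (biseries K)) (s : nat -> int) (v : nat -> biseries K).
Hypothesis A_subalg : is_subalgebra abs A.
Hypothesis A_const : A `&` power_inv = constants.
Hypothesis s_std : is_standard_basis A s v.
Hypothesis v_int : forall i j, integer_ring abs (v i j).
Variables (g : nat) (mu : 'I_g -> nat).
Hypothesis mu_gaps : is_gap_sequence A mu.

Let mu0 i : (0 < mu i)%N. Proof. by have := mu_gt0 A_subalg mu_gaps i. Qed.

Section Torsion.
Variables (n : nat) (x : 'rV[K]_g).
Hypotheses (n_gt0 : (0 < n)%N) (Tx : T_ abs A p mu n x).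

Let x1 i : abs (x 0 i) < 1. Proof. by have [h _ _] := Tx; exact: h. Qed.

Let x_le i : abs (x 0 i) <= q `^ ((p ^ n - p ^ n.-1)%N%:R^-1).
Proof.
have [_ _ h] := Tx; apply: le_trans h.
exact: (le_bigmax 0 (fun i => abs (x 0 i)) i).
Qed.

Let t i k : K := lterm n (x 0 i) k.
Let e k := e_matrix abs A p mu k.

(** The series is p^n times the one defining [l_vec], which vanishes on [T_]. *)
Lemma l_vec_cvg i :
  abs_cvg abs (fun N => \sum_(k < N) \sum_(j < g) e k i j * t j k) 0.
Proof.
pose w (k : nat) : K := (p%:R ^- k *: (e k *m (map_mx (fun y => y ^+ (p ^ k)) x)^T)) i 0.
have wE k : \sum_(j < g) e k i j * t j k = (p ^ n)%N%:R * w k.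
  rewrite /w !mxE !mulr_sumr; apply: eq_bigr => j _; rewrite !mxE /t /lterm; ring.
have q0 : 0 < q ^+ n by rewrite exprn_gt0 // q_gt0.
have w0 : forall d : R, 0 < d -> exists N : nat, forall k, (N <= k)%N -> abs (w k) <= d.
  move=> d d0.
  have /choice[N hN] j : exists N : nat, forall k, (N <= k)%N -> abs (t j k) <= d * q ^+ n.
    by apply: lterm_cvg0 => //; exact: mulr_gt0.
  exists (\max_(j < g) N j)%N => k hk; rewrite -(ler_pM2r q0).
  have <- : abs (\sum_(j < g) e k i j * t j k) = abs (w k) * q ^+ n.
    by rewrite wE pabsM natrX pabsX mulrC.
  apply: pabs_sum_le => [|j _]; first by rewrite mulr_ge0 // ltW.
  apply: pabs_mul_le1; first by have [h _] := e_matrixP A_subalg s_std v_int mu_gaps k; exact: h.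
  by apply: hN; apply: leq_trans hk; exact: leq_bigmax.
(* [abs_lim] is 0 on divergent sequences too, so the vanishing of [l_vec] yields a limit only
   because [w0] provides convergence. *)
have cw : abs_cvg abs (fun N => \sum_(k < N) w k) 0.
  have [_ lx _] := Tx; suff : abs_cvg abs (fun N => \sum_(k < N) w k) (l_vec abs A p mu x i 0).
    by rewrite lx mxE.
  rewrite mxE; apply: (@abs_cvg_step _ _ _ (fun N => \sum_(k < N) w k)) => d /w0 [N hN]; exists N => k /hN.
  by rewrite big_ord_recr /= addrAC subrr add0r.
apply/abs_cvgP => d d0; have [N hN] := (abs_cvgP _ _).1 cw d d0.
exists N => m /hN; rewrite !subr0 => hm.
under eq_bigr => k _ do rewrite wE.
by rewrite -mulr_sumr; apply: pabs_mul_le1 (pabs_nat_le1 _) hm.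
Qed.

(** The exponent of [ah_prod mu (p ^ n) x]: p^n times the sum of the l(x_i T^(mu i)). *)
Definition lsum : H := \sum_(i < g) lsubst n (x 0 i) (mu i).

(* As [l_vec] vanishes at [x], the gap components of the monomials add up to 0. *)
Lemma lsum_decomp : exists a b, [/\ hAan A a, hsmall a, hneg b, hsmall b & lsum = a + b].
Proof.
have /choice[F hF] (k : nat) : exists ab : 'I_g -> H * H, forall j,
    [/\ hA A (ab j).1, hle (ab j).1 1, hneg (ab j).2, hle (ab j).2 1 &
    hmono (mu j * p ^ k)%N%:Z = (ab j).1 + (ab j).2 + gap_part mu (fun i => e k i j)].
  have [_ he] := e_matrixP A_subalg s_std v_int mu_gaps k.
  have /choice[ab hab] j : exists ab : H * H,
      [/\ hA A ab.1, hle ab.1 1, hneg ab.2, hle ab.2 1 &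
      hmono (mu j * p ^ k)%N%:Z = ab.1 + ab.2 + gap_part mu (fun i => e k i j)].
    by have [a [b h]] := he j; exists (a, b).
  by exists ab.
have small (y : nat -> 'I_g -> H) k : (forall k j, hle (y k j) 1) ->
    hsmall (\sum_(j < g) hcst (t j k) * y k j).
  move=> hy; apply: hle_sum => [|j _]; first exact: exp_rad_ge0.
  rewrite -[exp_rad]mulr1; apply: hleM => //; apply: hle_trans (hle_cst _) _.
  exact: lterm_small.
have cvg (y : nat -> 'I_g -> H) : (forall k j, hle (y k j) 1) ->
    exists z, hcvg (fun N => \sum_(k < N) \sum_(j < g) hcst (t j k) * y k j) z.
  move=> hy; apply: (hcvg_series (t := fun k => \sum_(j < g) hcst (t j k) * y k j)) => d d0.
  have /choice[N hN] j : exists N : nat, forall k, (N <= k)%N -> abs (t j k) <= d.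
    exact: lterm_cvg0.
  exists (\max_(j < g) N j)%N => k hk; apply: hle_sum => [|j _]; first exact: ltW.
  rewrite -[d]mulr1; apply: hleM => //; apply: hle_trans (hle_cst _) _.
  by apply: hN; apply: leq_trans hk; exact: leq_bigmax.
have F1 k j : hle (F k j).1 1 by have [] := hF k j.
have F2 k j : hle (F k j).2 1 by have [] := hF k j.
have [a ha] := cvg (fun k j => (F k j).1) F1.
have [b hb] := cvg (fun k j => (F k j).2) F2.
have psmall (y : nat -> 'I_g -> H) z : (forall k j, hle (y k j) 1) ->
    hcvg (fun N => \sum_(k < N) \sum_(j < g) hcst (t j k) * y k j) z -> hsmall z.
  move=> hy hz; apply: (hle_lim hz); first exact: exp_rad_ge0.
  by exists 0%N => N _; apply: hle_sum => [|k _]; [exact: exp_rad_ge0 | exact: small].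
exists a, b; split.
- apply: (hAan_lim _ ha) => N; apply: hAan_sum => // k _; apply: hAan_sum => // j _.
  apply: hAanM => //; first exact: hAan_cst.
  by apply: hA_hAan; have [] := hF k j.
- exact: psmall F1 ha.
- move=> i i0; apply: (abs_cvg_unique (hcvg_coef i hb)).
  apply/abs_cvgP => d d0; exists 0%N => N _; rewrite hcoef_sum big1 ?subrr ?pabs0 ?ltW // => k _.
  rewrite hcoef_sum big1 // => j _; rewrite hcoef_cstM.
  by have [_ _ -> //] := hF k j; rewrite mulr0.
- exact: psmall F2 hb.
(* The gap components, collected at each mu j: their partial sums tend to 0 by [l_vec_cvg]. *)
have hg : hcvg (fun N => \sum_(j < g) hcst (\sum_(k < N) \sum_(i < g) e k j i * t i k) * hmono (mu j)%:Z) 0.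
  have h0 : \sum_(j < g) hcst 0 * hmono (mu j)%:Z = 0 :> H.
    by rewrite big1 // => j _; rewrite rmorph0 mul0r.
  rewrite -[X in hcvg _ X]h0.
  apply: (hcvg_sum _ (u := fun j N => hcst (\sum_(k < N) \sum_(i < g) e k j i * t i k) * hmono (mu j)%:Z)) => j.
  by apply: hcvg_cstM; exact: l_vec_cvg.
have hl : hcvg (fun N => \sum_(i < g) \sum_(k < N) hcst (t i k) * hmono (mu i * p ^ k)%N%:Z) lsum.
  apply: (hcvg_sum _ (u := fun i N => \sum_(k < N) hcst (t i k) * hmono (mu i * p ^ k)%N%:Z)) => i.
  exact: hcvg_lsubst.
apply: (hcvg_unique hl); rewrite -[a + b]addr0.
apply: (hcvg_ext _ (hcvgD (hcvgD ha hb) hg)) => N.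
rewrite [RHS]exchange_big /=.
have -> : \sum_(j < g) hcst (\sum_(k < N) \sum_(i < g) e k j i * t i k) * hmono (mu j)%:Z =
    \sum_(k < N) \sum_(i < g) hcst (t i k) * gap_part mu (fun j => e k j i).
  under eq_bigr => j _ do rewrite rmorph_sum mulr_suml.
  rewrite exchange_big; apply: eq_bigr => k _ /=.
  under eq_bigr => j _ do rewrite rmorph_sum mulr_suml.
  rewrite exchange_big; apply: eq_bigr => i _ /=.
  rewrite /gap_part mulr_sumr; apply: eq_bigr => j _.
  by rewrite rmorphM mulrA [hcst (t i k) * _]mulrC.
rewrite -!big_split /=; apply: eq_bigr => k _; rewrite -!big_split /=.
by apply: eq_bigr => i _; have [_ _ _ _ ->] := hF k i; rewrite !mulrDr.
Qed.

(** The exponent has norm at most [exp_rad], so the formal exponential on the left is the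
    exponential of H. *)
Lemma ah_subst_lsubst i : ah_subst (mu i) (p ^ n)%N (x 0 i) = hexp (lsubst n (x 0 i) (mu i)).
Proof.
apply: hval_inj; rewrite hval_ah_subst // (hexp_subst (mu0 i) _ (hval_lsubst _ _ _ (mu0 i))) ?lfun0 //.
exact: hsmall_lsubst.
Qed.

Lemma ah_subst_lsubstN i : ah_subst (mu i) (- (p ^ n)%N%:Z) (x 0 i) = hexp (- lsubst n (x 0 i) (mu i)).
Proof.
have hs : hsmall (- lsubst n (x 0 i) (mu i)) by apply: hsmallN; exact: hsmall_lsubst.
apply: hval_inj; rewrite hval_ah_subst // (@hexp_subst _ _ _ _ (lfun (- (p ^ n)%N%:Z) (x 0 i)) _ (mu0 i)) ?lfun0 //.
apply: funext => j; rewrite hcoefN hval_lsubst //.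
have [[a ->]|h] := int_multP (mu i) j; last by rewrite !ps_subst_out // oppr0.
by rewrite !ps_subst_in // /lfun rmorphN !mulNr.
Qed.

Lemma ah_prod_torsion : hGamma_sub A (ah_prod mu (p ^ n)%N x) /\ hGamma_sub A (ah_prod mu (- (p ^ n)%N%:Z) x).
Proof.
have sl i : hsmall (lsubst n (x 0 i) (mu i)) by exact: hsmall_lsubst.
have e1 : ah_prod mu (p ^ n)%N x = hexp lsum.
  by rewrite hexp_sum //; apply: eq_bigr => i _; exact: ah_subst_lsubst.
have e2 : ah_prod mu (- (p ^ n)%N%:Z) x = hexp (- lsum).
  rewrite /lsum -sumrN hexp_sum => [|i]; last exact: hsmallN.
  by apply: eq_bigr => i _; exact: ah_subst_lsubstN.
have [a [b [ha sa hb sb e0]]] := lsum_decomp.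
have gG c : hGamma (ah_prod mu c x) by exact: ah_prod_hGamma.
have ha' : hAan A (- a) by exact: hAanN.
have sa' := hsmallN sa; have sb' := hsmallN sb.
have hb' : hneg (- b) by move=> i i0; rewrite hcoefN hb // oppr0.
have e1' : ah_prod mu (p ^ n)%N x = hexp a * hexp b by rewrite e1 e0; exact: hexpD.
have e2' : ah_prod mu (- (p ^ n)%N%:Z) x = hexp (- a) * hexp (- b).
  by rewrite e2 e0 opprD; exact: hexpD.
split; [rewrite e1' | rewrite e2'].
  exists (hexp a), (hexp b); split => //; first exact: hAan_exp.
  - by exists (hexp (- a)); [exact: hAan_exp | exact: hexpNM].
  (* The factor exp a lies in Gamma as the product of an element of Gamma and exp (- b) in
     Gamma_0. *)
  - have -> : hexp a = ah_prod mu (p ^ n)%N x * hexp (- b).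
      by rewrite e1' -mulrA (hexpNM sb) mulr1.
    by apply: hGammaM => //; apply/hGam0_hGamma/hGam0_exp.
  - exact: hGam0_exp.
exists (hexp (- a)), (hexp (- b)); split => //; first exact: hAan_exp.
- by exists (hexp a); [exact: hAan_exp | rewrite mulrC (hexpNM sa)].
- have -> : hexp (- a) = ah_prod mu (- (p ^ n)%N%:Z) x * hexp b.
    by rewrite e2' -mulrA [hexp (- b) * _]mulrC (hexpNM sb) mulr1.
  by apply: hGammaM => //; apply/hGam0_hGamma/hGam0_exp.
- exact: hGam0_exp.
Qed.

Lemma cls_torsion : cls abs A (hval (ah_prod mu 1 x ^+ (p ^ n))) = GammaA1 abs A.
Proof.
have [h1 h2] := ah_prod_torsion; rewrite ah_prodX //; apply: cls_eq1 h1 h2 _ => //.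
by rewrite -ah_prodD // subrr ah_prod0.
Qed.

End Torsion.

(** * Injectivity *)

Section Injectivity.
Variables (x y : 'rV[K]_g) (r d : R).
Hypotheses (r0 : 0 <= r < 1) (d0 : 0 <= d).
Hypotheses (xr : forall i, abs (x 0 i) <= r) (yr : forall i, abs (y 0 i) <= r).
Hypothesis xy_d : forall i, abs (x 0 i - y 0 i) <= d.

Let lt1 (z : K) : abs z <= r -> abs z < 1.
Proof. by move=> h; apply: le_lt_trans h _; case/andP: r0. Qed.

Lemma ah_subst_sub1 m c (z : K) : (0 < m)%N -> abs z <= r -> hle (ah_subst m c z - 1) r.
Proof.
have [r00 r01] := andP r0.
move=> m0 zr i; rewrite hcoefB hval_ah_subst ?lt1 // hcoef1.
have [[a ->]|h] := int_multP m i.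
  rewrite ps_subst_in // eqz_nat muln_eq0 (gtn_eqF m0) /=; case: a => [|a].
    by rewrite ps_exp0 ?lfun0 // subrr pabs0.
  rewrite subr0; apply: le_trans (ps_exp_lfun_le artin_hasse _ _ _) _.
  apply: le_trans (lerXn2r _ _ _ zr) _; rewrite ?nnegrE ?pabs_ge0 //.
  by rewrite exprS ler_piMr // exprn_ile1 // ltW.
have := h 0%N; rewrite muln0 => /negbTE ->.
by rewrite ps_subst_out // subrr pabs0.
Qed.

Lemma hle_prod_sub1 (I : Type) (l : seq I) (F : I -> H) :
  (forall i, hle (F i - 1) r) -> hle (\prod_(i <- l) F i - 1) r.
Proof.
have [r00 r01] := andP r0.
move=> h; elim: l => [|i l IH]; first by rewrite big_nil subrr; exact: hle0.
rewrite big_cons; set P := \prod_(_ <- _) _ in IH *.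
have -> : F i * P - 1 = F i * (P - 1) + (F i - 1) by ring.
apply: hleD => //; rewrite -[r]mul1r; apply: hleM => //.
rewrite -[F i](subrK 1); apply: hleD hle1; apply: hle_trans (h i) (ltW r01).
Qed.

Lemma ps_exp_lfun_1 (z : K) : ps_exp (lfun 1 z) 1 = z.
Proof.
rewrite (@ps_exp_coef _ _ _ _ 1 1 1) ?lfun0 // pexpE !big_ord_recl big_ord0 addr0 /=.
rewrite expr0 expr1 fact0 invr1 !scale1r coefD coef1 add0r coef_ptrunc //.
rewrite /lfun mul1r expr1.
by have := l_series_pow (K := K) 0; rewrite expn0 expr0 invr1 => ->; rewrite mul1r.
Qed.

(** Degree 0 cancels and degree 1 gives x_i - y_i. For a >= 2 the difference of the a-th powers is
    at most d r^(a-1) <= d r, and it is multiplied by an integral coefficient. *)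
Lemma ah_subst_diff i :
  hle (ah_subst (mu i) 1 (x 0 i) - ah_subst (mu i) 1 (y 0 i) -
       hcst (x 0 i - y 0 i) * hmono (mu i)%:Z) (d * r).
Proof.
have [r00 r01] := andP r0; have dr0 : 0 <= d * r by exact: mulr_ge0.
move=> j; rewrite !hcoefB hcoef_cstM hcoef_mono !hval_ah_subst ?lt1 //.
have [[a ->]|h] := int_multP (mu i) j; last first.
  have := h 1%N; rewrite muln1 => /negbTE ->.
  by rewrite !ps_subst_out // mulr0 !subr0 pabs0.
rewrite !ps_subst_in // eqz_nat -[X in (_ == X)%N]muln1 eqn_pmul2l //.
case: a => [|[|a]].
- by rewrite !ps_exp0 ?lfun0 // mulr0 subrr subr0 pabs0.
- by rewrite !ps_exp_lfun_1 mulr1 subrr pabs0.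
rewrite mulr0 subr0.
have sc z : ps_exp (lfun 1 z) a.+2 =
    ps_exp (fun m => 1%:~R * l_series p m : K) a.+2 * z ^+ a.+2.
  by rewrite -ps_exp_scale // l_series0 mulr0.
rewrite !sc -mulrBr; apply: pabs_mul_le1 (artin_hasse _ _) _.
rewrite subrXX; apply: pabs_mul_le => //.
apply: pabs_sum_le => // k _; rewrite pabsM !pabsX.
apply: (@le_trans _ _ (r ^+ (a.+2 - k.+1) * r ^+ k)).
  by apply: ler_pM; rewrite ?exprn_ge0 ?pabs_ge0 //; apply: lerXn2r; rewrite ?nnegrE ?pabs_ge0.
rewrite -exprD (_ : (a.+2 - k.+1 + k)%N = a.+1); last by have := ltn_ord k; lia.
by rewrite exprS ler_piMr // exprn_ile1 // ltW.
Qed.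

Lemma ah_prod_diff : hle (ah_prod mu 1 x - ah_prod mu 1 y - gap_part mu (fun i => x 0 i - y 0 i)) (d * r).
Proof.
have [r00 r01] := andP r0; have dr0 : 0 <= d * r by exact: mulr_ge0.
rewrite /ah_prod /gap_part; elim: (index_enum _) => [|i l IH].
  by rewrite !big_nil subrr subr0; exact: hle0.
rewrite !big_cons.
set P := \prod_(_ <- _) _ in IH *; set P' := \prod_(_ <- _) _ in IH *.
set S := \sum_(_ <- _) _ in IH *; set D := hcst _ * _.
set E := ah_subst _ _ _; set E' := ah_subst _ _ _.
(* Each summand is of second order: an error of size d r times an integral element, or a term of
   size d times one of size r. *)
have -> : E * P - E' * P' - (D + S) =
  E * (P - P' - S) + (E - 1) * S + (E - E' - D) * P' + D * (P' - 1) by ring.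
have hD k : hle (hcst (x 0 k - y 0 k) * hmono (mu k)%:Z) d.
  by rewrite -[d]mulr1; apply: hleM (hle_mono _); exact: hle_trans (hle_cst _) _.
have le1 (z : H) : hle (z - 1) r -> hle z 1.
  by move=> h; rewrite -[z](subrK 1); apply: hleD hle1; apply: hle_trans h (ltW r01).
have hE1 : hle (E - 1) r by exact: ah_subst_sub1.
have hP' : hle (P' - 1) r by apply: hle_prod_sub1 => k; exact: ah_subst_sub1.
apply: hleD; [apply: hleD; [apply: hleD|]|].
- by rewrite -[d * r]mul1r; apply: hleM => //; exact: le1.
- by rewrite mulrC; apply: hleM => //; apply: hle_sum => // k _; exact: hD.
- by rewrite -[d * r]mulr1; apply: hleM; [exact: ah_subst_diff | exact: le1].
- exact: hleM (hD i) hP'.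
Qed.

(* With [a = a_0 + a'], [u = u_0 + u'], the product [a' u'] is smaller than [u'] since *)
(* [a'], controlled by its positive coefficients, has norm < 1.                      *)
Lemma hGamma_sub_diff_le m : hGamma_sub A m -> hle (m - 1 - gap_part mu (fun i => x 0 i - y 0 i)) (d * r) ->
  (forall i, abs (x 0 i - y 0 i) <= d * r) \/ (forall i, abs (x 0 i - y 0 i) <= 0).
Proof.
move=> [a [u [-> ha _ [rho /andP[rho0 rho1] [_ a1 a01 arho]] [_ u1 u01 u_rho]]]] hm.
pose a' := a - hcst (a 0); pose u' := u - hcst (u 0).
have ha' : hAan A a' by apply: hAanD => //; apply: hAanN => //; exact: hAan_cst.
have a'rho : hle a' rho.
  apply: (hAan_coef_le s_std v_int ha' rho0) => i.
  have := s_ge0 A_const s_std i; rewrite hcoefB hcoef_cst; case: (s i) => // -[|k] _.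
    by rewrite subrr pabs0.
  rewrite subr0; apply: le_trans (arho k.+1 _) _ => //.
  by rewrite exprS ler_piMr // exprn_ile1 // ltW.
have hu' : hneg u'.
  case=> // -[|k] _; rewrite hcoefB hcoef_cst /=; first by rewrite subrr.
  by rewrite subr0; apply: pabs_eps_eq0 => e e0; apply: le_trans (u_rho k.+1 _) _; rewrite // expr0n ltW.
pose eta := hnorm abs (hval u').
have heta : hle u' eta by exact: hle_hnorm.
have eta0 := hle_ge0 heta.
pose B := Num.max (rho * eta) (d * r).
(* In a u - 1 the products of the parts are u_0 a' + (a_0 u_0 - 1), in the closure of A, then a_0
   u', in negative powers, and a' u', which is moved to the error. *)
have hB : hle ((hcst (u 0) * a' + hcst (a 0 * u 0 - 1)) + hcst (a 0) * u' +
    gap_part mu (fun i => - (x 0 i - y 0 i))) B.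
  have -> : gap_part mu (fun i => - (x 0 i - y 0 i)) = - gap_part mu (fun i => x 0 i - y 0 i).
    by rewrite /gap_part -sumrN; apply: eq_bigr => i _; rewrite rmorphN mulNr.
  have -> : hcst (u 0) * a' + hcst (a 0 * u 0 - 1) + hcst (a 0) * u' -
      gap_part mu (fun i => x 0 i - y 0 i) =
      (a * u - 1 - gap_part mu (fun i => x 0 i - y 0 i)) - a' * u'.
    rewrite /a' /u' rmorphB rmorphM rmorph1; ring.
  apply: hleB; first by apply: hle_trans hm _; rewrite le_max lexx orbT.
  by apply: hle_trans (hleM a'rho heta) _; rewrite le_max lexx.
have hAa : hAan A (hcst (u 0) * a' + hcst (a 0 * u 0 - 1)).
  by apply: hAanD => //; [apply: hAanM => // |]; exact: hAan_cst.
have hnu : hneg (hcst (a 0) * u') by move=> i i0; rewrite hcoef_cstM hu' // mulr0.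
have [_ hu hx] := decomp_le A_const s_std v_int mu_gaps hAa hnu hB.
have etaB : eta <= B.
  by apply: hnorm_le => i; have := hu i; rewrite hcoef_cstM pabsM a01 mul1r.
have hx' i : abs (x 0 i - y 0 i) <= B by rewrite -pabsN; exact: hx.
have [h|h] := leP (rho * eta) (d * r).
  by left=> i; apply: le_trans (hx' i) _; rewrite /B ge_max h lexx.
(* If rho eta dominates, then eta <= rho eta with rho < 1 forces eta <= 0, so the bound [B] is at
   most 0. *)
right=> i; apply: le_trans (hx' i) _.
have BE : B = rho * eta by rewrite /B max_l // ltW.
rewrite BE in etaB *; rewrite mulr_ge0_le0 // leNgt; apply/negP => eta_gt0.
by move: etaB; rewrite ler_pMl // leNgt rho1.
Qed.

End Injectivity.

Lemma cls_inj (x y : 'rV[K]_g) : (forall i, abs (x 0 i) < 1) -> (forall i, abs (y 0 i) < 1) ->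
  cls abs A (hval (ah_prod mu 1 x)) = cls abs A (hval (ah_prod mu 1 y)) -> x = y.
Proof.
move=> x1 y1 e.
have : cls abs A (hval (ah_prod mu 1 x)) (hval (ah_prod mu 1 x)).
  by apply/clsE; exists 1; [rewrite mulr1 | exact: hGamma_sub1].
rewrite e => /clsE[m /hval_inj em hm].
pose d := \big[Num.max/0]_(i < g) abs (x 0 i - y 0 i).
pose r := \big[Num.max/0]_(i < g) Num.max (abs (x 0 i)) (abs (y 0 i)).
have r0 : 0 <= r < 1.
  by rewrite bigmax_ge_id; apply: bigmax_lt => // i _; rewrite gt_max x1 y1.
have d0 : 0 <= d by exact: bigmax_ge_id.
have mr i : Num.max (abs (x 0 i)) (abs (y 0 i)) <= r.
  exact: (le_bigmax 0 (fun i => Num.max (abs (x 0 i)) (abs (y 0 i))) i).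
have xr i : abs (x 0 i) <= r by apply: le_trans (mr i); rewrite le_max lexx.
have yr i : abs (y 0 i) <= r by apply: le_trans (mr i); rewrite le_max lexx orbT.
have xyd i : abs (x 0 i - y 0 i) <= d.
  exact: (le_bigmax 0 (fun i => abs (x 0 i - y 0 i)) i).
have hd : hle (m - 1 - gap_part mu (fun i => x 0 i - y 0 i)) (d * r).
  have dr0 : 0 <= d * r by rewrite mulr_ge0 //; case/andP: r0.
  have := ah_prod_diff r0 d0 xr yr xyd; rewrite em.
  set D := gap_part _ _; set G := ah_prod _ _ y => hG.
  have hG' : ah_prod mu (-1) y * G = 1 by rewrite /G -ah_prodD // addNr ah_prod0.
  have hs : hle (ah_prod mu (-1) y - 1) r by apply: hle_prod_sub1 => // i; exact: ah_subst_sub1.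
  have hs1 : hle (ah_prod mu (-1) y) 1.
    by rewrite -[ah_prod _ _ _](subrK 1); apply: hleD hle1; apply: hle_trans hs _; apply/ltW; case/andP: r0.
  (* The estimate for G m - G is multiplied by the inverse of G; replacing D by its multiple costs d
     r, as that inverse is 1 up to r. *)
  have -> : m - 1 - D = ah_prod mu (-1) y * (G * m - G - D) + D * (ah_prod mu (-1) y - 1).
    rewrite !mulrBr !mulrA hG'; ring.
  apply: hleD; first by rewrite -[d * r]mul1r; exact: hleM.
  apply: hleM => //; apply: hle_sum => // i _.
  by rewrite -[d]mulr1; apply: hleM (hle_mono _); exact: hle_trans (hle_cst _) _.
have small c : 0 <= c -> (forall i, abs (x 0 i - y 0 i) <= c) -> d <= c.
  by move=> c0 h; apply: bigmax_le.
have d00 : d <= 0.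
  have [r00 r01] := andP r0.
  have [h|h] := hGamma_sub_diff_le hm hd; last exact: small.
  have := small _ (mulr_ge0 d0 r00) h; nra.
apply/rowP => i; apply/eqP; rewrite -subr_eq0 -pabs_eq0 eq_le pabs_ge0 andbT.
exact: le_trans (xyd i) d00.
Qed.

End Main.

(** * Finite extensions of the p-adic numbers *)

Section FiniteExtension.
Context {R : realType} {F : fieldType} {v : F -> R}.
Hypotheses (Hv : nonarch_absval v) (v_complete : abs_complete v).
Context {L : fieldExtType F} {abs : L -> R}.
Hypotheses (Habs : nonarch_absval abs) (abs_ext : forall x : F, abs (x%:A) = v x).

Lemma absval_scale (c : F) (y : L) : abs (c *: y) = v c * abs y.
Proof. by rewrite -mulr_algl (absvalM Habs) abs_ext. Qed.

Definition complete_on (U : {vspace L}) := forall u : nat -> L, (forall n, u n \in U) ->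
  abs_cauchy abs u -> exists2 l, l \in U & abs_cvg abs u l.

(** Otherwise [x] is a limit of elements of U, hence in U by completeness. *)
Lemma complete_dist (U : {vspace L}) (x : L) : complete_on U -> x \notin U ->
  exists2 d : R, 0 < d & forall w, w \in U -> d <= abs (x - w).
Proof.
move=> hU xU; have [//|h] := pselect (exists2 d : R, 0 < d & forall w, w \in U -> d <= abs (x - w)).
have /choice[W hW] (k : nat) : exists w, w \in U /\ abs (x - w) < k.+1%:R^-1.
  have [//|h'] := pselect (exists w, w \in U /\ abs (x - w) < k.+1%:R^-1).
  case: h; exists k.+1%:R^-1 => [|w wU]; first by rewrite invr_gt0 ltr0n.
  by rewrite leNgt; apply/negP => hw; apply: h'; exists w.
have small (e : R) : 0 < e -> exists N : nat, forall n, (N <= n)%N -> abs (x - W n) < e.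
  move=> e0; pose N := Num.truncn e^-1; exists N => n Nn.
  apply: lt_le_trans (hW n).2 _; rewrite invf_ple ?posrE ?ltr0n //.
  apply: le_trans (ltW (Num.Theory.truncnS_gt _)) _; last by rewrite ler_nat ltnS.
have [||l lU /(absval_cvgP Habs) hl] := hU W.
- by move=> n; exact: (hW n).1.
- move=> e e0; have [N hN] := small e e0; exists N => m n Nm Nn.
  have -> : W m - W n = (x - W n) - (x - W m) by ring.
  apply: le_lt_trans (_ : _ <= Num.max (abs (x - W n)) (abs (x - W m))) _.
    by apply: (absvalB_le Habs); rewrite le_max lexx ?orbT.
  by rewrite gt_max !hN.
case/negP: xU; suff -> : x = l by [].
apply/eqP; rewrite -subr_eq0; apply/eqP/(absval_eps_eq0 Habs) => e e0.
have [N hN] := small e e0; have [M hM] := hl e e0.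
have -> : x - l = (x - W (N + M)%N) + (W (N + M)%N - l) by ring.
apply: (absvalD_le Habs); first by apply/ltW/hN; rewrite leq_addr.
by apply: hM; rewrite leq_addl.
Qed.

(** The distance d from [x] to U gives |c| d <= |c x + w|, so for a Cauchy sequence the coordinate
    along [x] is Cauchy, and then so is the component in U. *)
Lemma complete_on_add (U : {vspace L}) (x : L) : complete_on U -> complete_on (<[x]> + U)%VS.
Proof.
move=> hU; have [xU|xU] := boolP (x \in U).
  by have /addv_idPr -> : (<[x]> <= U)%VS by [].
have [d d0 hd] := complete_dist hU xU.
have lin (c : F) w : w \in U -> v c * d <= abs (c *: x + w).
  move=> wU; have [->|c0] := eqVneq c 0.
    by rewrite (absval0 Hv) mul0r; exact: absval_ge0 Habs _.
  have -> : c *: x + w = c *: (x - (- (c^-1 *: w))).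
    by rewrite opprK scalerDr scalerA mulfV // scale1r.
  rewrite absval_scale ler_wpM2l ?(absval_ge0 Hv) // hd // memvN memvZ //.
move=> u uU cu.
have /choice[cw hcw] n : exists cw : F * L, cw.2 \in U /\ u n = cw.1 *: x + cw.2.
  have /memv_addP[y /vlineP[c ->] [w wU ->]] := uU n.
  by exists (c, w).
pose c n := (cw n).1; pose w n := (cw n).2.
have uE n : u n = c n *: x + w n by exact: (hcw n).2.
have wU n : w n \in U by exact: (hcw n).1.
have [c' hc'] : exists c', abs_cvg v c c'.
  apply: v_complete => e e0; have [N hN] := cu _ (mulr_gt0 e0 d0); exists N => m n Nm Nn.
  rewrite -(ltr_pM2r d0); apply: le_lt_trans (hN m n Nm Nn).
  have -> : u m - u n = (c m - c n) *: x + (w m - w n).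
    by rewrite !uE scalerBl opprD addrACA.
  by apply: lin; rewrite memvB.
have hcx : abs_cvg abs (fun n => c n *: x) (c' *: x).
  apply/(absval_cvgP Habs) => e e0.
  have x0 : 0 < abs x + 1 by rewrite ltr_wpDl // (absval_ge0 Habs).
  have [N hN] := (absval_cvgP Hv _ _).1 hc' _ (divr_gt0 e0 x0); exists N => n /hN h.
  rewrite -scalerBl absval_scale.
  apply: le_trans (_ : _ <= e / (abs x + 1) * (abs x + 1)) _; last by rewrite divfK // gt_eqF.
  by apply: ler_pM; rewrite ?(absval_ge0 Habs) ?(absval_ge0 Hv) // lerDl.
have [|w' w'U hw'] := hU w wU.
  move=> e e0; have e20 : 0 < e / 2 by rewrite divr_gt0.
  have [N hN] := cu _ e20; have [M hM] := (absval_cvgP Habs _ _).1 hcx _ e20.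
  exists (N + M)%N => m n hm hn.
  have -> : w m - w n = (u m - u n) - ((c m *: x - c' *: x) - (c n *: x - c' *: x)).
    by rewrite !uE; ring.
  apply: (@le_lt_trans _ _ (e / 2)); last by rewrite ltr_pdivrMr // ltr_pMr // ltr1n.
  apply: (absvalB_le Habs); first by apply/ltW/hN; lia.
  by apply: (absvalB_le Habs); apply: hM; lia.
exists (c' *: x + w'); first by rewrite memv_add // memvZ // memv_line.
apply/(absval_cvgP Habs) => e e0.
have [N hN] := (absval_cvgP Habs _ _).1 hcx _ e0.
have [M hM] := (absval_cvgP Habs _ _).1 hw' _ e0.
exists (N + M)%N => n hn.
have -> : u n - (c' *: x + w') = (c n *: x - c' *: x) + (w n - w') by rewrite uE; ring.
by apply: (absvalD_le Habs); [apply: hN | apply: hM]; lia.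
Qed.

Lemma finite_extension_complete : abs_complete abs.
Proof.
have hX (X : seq L) : complete_on <<X>>%VS.
  elim: X => [|x X IH]; last by rewrite span_cons; exact: complete_on_add.
  move=> u uU _; exists 0; first exact: mem0v.
  apply/(absval_cvgP Habs) => e e0; exists 0%N => n _.
  by have := uU n; rewrite span_nil memv0 => /eqP ->; rewrite subrr (absval0 Habs) ltW.
move=> u cu; have [|l _ hl] := hX (vbasis fullv) u _ cu; last by exists l.
by move=> n; rewrite (span_basis (vbasisP fullv)) memvf.
Qed.

End FiniteExtension.

(** * Fermat's congruence on the p-adic integers *)

Section Padic.
Context {R : realType} {p : nat} {Q : pvField R p}.
Local Notation v := (@pabs R p Q).
Local Notation q := (v p%:R).

(** As x - y divides x^p - y^p, the congruence depends only on the class modulo p. *)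
Lemma fermat_near (x y : Q) : v x <= 1 -> v y <= 1 -> v (x - y) <= q ->
  v (y ^+ p - y) <= q -> v (x ^+ p - x) <= q.
Proof.
move=> x1 y1 xy hy.
have -> : x ^+ p - x = (x ^+ p - y ^+ p) + (y ^+ p - y) - (x - y) by ring.
apply: pabsB_le => //; apply: pabsD_le => //.
rewrite subrXX mulrC; apply: pabs_mul_le1 => //.
apply: pabs_sum_le => // i _; apply: pabs_mul_le1; exact: pabs_X_le1.
Qed.

Lemma fermat_nat (m : nat) : v (m%:R ^+ p - m%:R) <= q.
Proof.
have pp := pv_prime Q; have h := fermat_little m pp.
have mp : (m <= m ^ p)%N.
  by case: (posnP m) => [->|m0] //; rewrite -[X in (X <= _)%N]expn1 leq_pexp2l // (@p_gt0 _ _ Q).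
rewrite -natrX -natrB //; apply: pabs_dvd.
by rewrite -eqn_mod_dvd //; apply/eqP.
Qed.

Lemma fermat_int (z : int) : v (z%:~R ^+ p - z%:~R) <= q.
Proof.
case: z => m; first exact: fermat_nat.
(* Modulo p the negative integer - (m + 1) is congruent to the natural number (m + 1) (p - 1). *)
apply: (@fermat_near _ ((m.+1 * p.-1)%N%:R)); last exact: fermat_nat.
- exact: pabs_int_le1.
- exact: pabs_nat_le1.
have -> : (Negz m)%:~R - (m.+1 * p.-1)%N%:R = - (m.+1 * p)%N%:R :> Q.
  rewrite NegzE mulrNz -[X in _ = - (_ * X)%N%:R](prednK (@p_gt0 _ _ Q)) mulnS natrD opprD.
  by [].
by rewrite pabsN; apply: pabs_dvd; exact: dvdn_mull.
Qed.

Lemma pabs_int (z : int) : z != 0 -> v z%:~R = q ^+ logn p (absz z).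
Proof.
case: z => m z0; first by apply: pabs_nat; case: m z0.
by rewrite [in LHS]NegzE mulrNz pabsN; exact: pabs_nat.
Qed.

Hypothesis Q_dense : forall (x : Q) (e : R), 0 < e -> exists r : rat, v (x - ratr r) < e.

(** By density x is congruent modulo p to a rational a / b. Integrality and coprimality make b a
    unit, and the congruences for a and b combine. *)
Lemma fermat_padic (x : Q) : v x <= 1 -> v (x ^+ p - x) <= q.
Proof.
move=> x1; have q0 : 0 < q by exact: q_gt0.
have [r /ltW hr] := Q_dense x q0.
have y1 : v (ratr r) <= 1.
  have -> : ratr r = x - (x - ratr r) by ring.
  by apply: pabsB_le => //; apply: le_trans hr _; exact: q_le1.
apply: (fermat_near x1 y1 hr).
have [->|r0] := eqVneq r 0.
  by rewrite (ratr_nat Q 0) expr0n gtn_eqF ?(@p_gt0 _ _ Q) // subr0 pabs0 ltW.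
move: y1; rewrite /ratr; set a := numq r; set b := denq r => y1.
have a0 : a != 0 by rewrite numq_eq0.
have b0 : b != 0 by rewrite denq_eq0.
have vb0 : v b%:~R != 0 by rewrite pabs_int // expf_neq0 // gt_eqF.
have bQ : b%:~R != 0 :> Q by rewrite -pabs_eq0.
have vb : v b%:~R = 1.
  have cab := coprime_num_den r; rewrite -/a -/b in cab.
  have [pb|pb] := boolP (p %| absz b)%N; last first.
    by rewrite pabs_int // logn_coprime ?expr0 // prime_coprime // (pv_prime Q).
  have va : v a%:~R = 1.
    rewrite pabs_int // logn_coprime ?expr0 // prime_coprime ?(pv_prime Q) //.
    apply/negP => pa; have : (p %| gcdn `|a| `|b|)%N by rewrite dvdn_gcd pa.
    by rewrite (eqP cab) dvdn1 => /eqP p1; have := @p_gt1 _ _ Q; lia.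
  apply/eqP; rewrite eq_le pabs_int_le1 /=.
  have vb1 : 0 < v b%:~R by rewrite lt_def vb0 pabs_ge0.
  by move: y1; rewrite pabsM pabsV va mul1r invf_le1.
(* Multiplication by the unit b^(p+1) preserves the absolute value and clears the denominators. *)
have -> : v ((a%:~R / b%:~R) ^+ p - a%:~R / b%:~R) =
    v (b%:~R * (a%:~R ^+ p - a%:~R) - a%:~R * (b%:~R ^+ p - b%:~R)).
  have -> : b%:~R * (a%:~R ^+ p - a%:~R) - a%:~R * (b%:~R ^+ p - b%:~R) =
      b%:~R ^+ p.+1 * ((a%:~R / b%:~R) ^+ p - a%:~R / b%:~R) :> Q.
    have := expf_neq0 p bQ; rewrite expr_div_n exprS.
    move: (_ ^+ p) (_ ^+ p) => ap bp bp0; field; rewrite ?bp0 ?bQ //.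
  by rewrite pabsM pabsX vb expr1n mul1r.
by apply: pabsB_le; apply: pabs_mul_le1; rewrite ?pabs_int_le1 ?fermat_int.
Qed.

End Padic.

Section Transport.
Context {F L : fieldType} (phi : {rmorphism F -> L}).

Lemma ps_exp_map (f : nat -> F) m : phi (ps_exp f m) = ps_exp (fun m => phi (f m)) m.
Proof.
have e : map_poly phi (\poly_(i < m.+1) f i) = \poly_(i < m.+1) phi (f i).
  by apply/polyP => i; rewrite coef_map /= !coef_poly; case: ifP => // _; exact: rmorph0.
rewrite /ps_exp !coef_sum rmorph_sum; apply: eq_bigr => k _.
by rewrite !coefZ rmorphM fmorphV rmorph_nat -coef_map rmorphXn /= e.
Qed.

Lemma l_series_map p m : phi (l_series p m) = l_series p m.
Proof.
by rewrite /l_series; case: ifP => _; rewrite ?rmorph0 // fmorphV rmorphXn rmorph_nat.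
Qed.

End Transport.

Section TorsionEmbedding.
Context {R : realType} {p : nat} {K : pvField R p}.
Local Notation abs := (@pabs R p K).

(** The result over an abstract complete field, with the integrality of exp (c l) for integers c as
    a hypothesis. *)
Lemma torsion_embedding (A : set (biseries K)) (g : nat) (mu : 'I_g -> nat) (n : nat) :
  (forall (c : int) m, pabs (ps_exp (fun m => c%:~R * l_series p m : K) m) <= 1) ->
  is_subalgebra abs A -> A `&` power_inv = constants ->
  strictly_integral abs A -> is_gap_sequence A mu -> (0 < n)%N ->
  (forall x : 'rV[K]_g, T_ abs A p mu n x ->
     Gamma abs (h_mu abs p mu x) /\
     cls abs A (lpow abs (h_mu abs p mu x) (p ^ n)) =
     GammaA1 abs A) /\
  (set_fun (T_ abs A p mu n) (GammaA_torsion abs A (p ^ n))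
     (fun x => cls abs A (h_mu abs p mu x)) /\
   set_inj (T_ abs A p mu n)
     (fun x => cls abs A (h_mu abs p mu x))).
Proof.
move=> ah A_sub A_const [s [v [s_std v_int]]] mu_gaps n_gt0.
have mu0 i : (0 < mu i)%N by have := mu_gt0 A_sub mu_gaps i.
have x1 (x : 'rV[K]_g) : T_ abs A p mu n x -> forall i, pabs (x 0 i) < 1.
  by move=> [h _ _] i; exact: h.
have tor (x : 'rV[K]_g) : T_ abs A p mu n x ->
    [/\ Gamma abs (h_mu abs p mu x),
      h_mu abs p mu x = hval (ah_prod mu 1 x) &
      cls abs A (hval (ah_prod mu 1 x ^+ (p ^ n))) = GammaA1 abs A].
  move=> Tx; have e := hval_ah_prod1 ah mu0 (x1 x Tx); rewrite -e; split => //.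
    by apply/GammaE; exists (ah_prod mu 1 x) => //; apply: ah_prod_hGamma => //; exact: x1 Tx.
  exact: (cls_torsion ah A_sub s_std v_int mu_gaps n_gt0 Tx).
split; last split.
- by move=> x /tor[hx e t]; rewrite {2}e -hval_lpow t.
- move=> x /tor[hx e t]; split; first by exists (h_mu abs p mu x).
  by rewrite e (GammaA_exp_cls A_sub).
- move=> x y; rewrite !inE => Tx Ty; have [_ ex _] := tor x Tx; have [_ ey _] := tor y Ty.
  rewrite ex ey; apply: (cls_inj ah A_sub A_const s_std v_int mu_gaps); exact: x1.
Qed.

End TorsionEmbedding.

Theorem proposition3p9 (R : realType) (p : nat) (p_prime : prime p)
    (Qp : fieldType) (v : Qp -> R) (Qp_padic : is_padic_field p v)
    (K : fieldExtType Qp) (abs : K -> R) (abs_absval : nonarch_absval abs)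
    (abs_ext : forall x : Qp, abs (x%:A) = v x)
    (A : set (biseries K)) (A_subalg : is_subalgebra abs A)
    (A_const : A `&` power_inv = constants)
    (g : nat)
    (A_codim : quotient_dim laurent_inv
                 [set a + b | a in A & b in power_inv] g)
    (A_strict : strictly_integral abs A)
    (mu : 'I_g -> nat) (mu_gaps : is_gap_sequence A mu)
    (n : nat) (n_gt0 : (0 < n)%N) :
  (forall x : 'rV[K]_g, T_ abs A p mu n x ->
     Gamma abs (h_mu abs p mu x) /\
     cls abs A (lpow abs (h_mu abs p mu x) (p ^ n)) = GammaA1 abs A) /\
  (set_fun (T_ abs A p mu n) (GammaA_torsion abs A (p ^ n))
     (fun x => cls abs A (h_mu abs p mu x)) /\
   set_inj (T_ abs A p mu n) (fun x => cls abs A (h_mu abs p mu x))).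
Proof.
case: Qp_padic => Hv v_ratr v_complete v_dense.
have vp : v p%:R = p%:R^-1.
  rewrite -(ratr_nat Qp p) v_ratr /padic_abs -[p%:R]/(p%:~R : rat) numq_int denq_int /=.
  rewrite intr_eq0 eqz_nat gtn_eqF ?prime_gt0 // logn1 expr0 mul1r.
  by rewrite logn_prime // eqxx expr1.
have vp01 : 0 < v p%:R < 1.
  by rewrite vp invr_gt0 ltr0n prime_gt0 // invf_lt1 ?ltr0n ?prime_gt0 // ltr1n prime_gt1.
have absp : 0 < abs p%:R < 1 by rewrite -(rmorph_nat (in_alg K)) /= abs_ext.
pose Q := PvField Hv v_complete p_prime vp01.
pose KV := PvField abs_absval (finite_extension_complete Hv v_complete abs_absval abs_ext)
  p_prime absp.
apply: (@torsion_embedding R p KV A g mu n) => // c m.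
(* For integer c the coefficients of exp (c l) come from Q_p, where Dwork's argument applies, and
   [abs] extends [v]. *)
have -> : ps_exp (fun m => c%:~R * l_series p m : KV) m =
    in_alg K (ps_exp (fun m => c%:~R * l_series p m : Qp) m).
  rewrite ps_exp_map; congr ps_exp; apply: funext => k.
  by rewrite rmorphM rmorph_int l_series_map.
change (abs (in_alg K (ps_exp (fun m => c%:~R * l_series p m : Qp) m)) <= 1).
rewrite /= abs_ext.
apply: (@artin_hasse_integral R p Q) => [x|]; first exact: (fermat_padic (Q := Q)).
exact: (pabs_int_le1 (K := Q)).
Qed.
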